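(* Let $P\in\Psi^q(\mathbb{T}^n_\theta)$, $q\in\mathbb{C}$, be elliptic with $m:=\Re q>0$ and $\mathrm{Sp}(P)\ne\mathbb{C}$. Let $\lambda\in\mathrm{Sp}(P)$. Then: (1) $E_\lambda(P)$ is a finite-dimensional subspace of $C^\infty(\mathbb{T}^n_\theta)$. In particular, there is an integer $\nu\ge1$ such that $E_\lambda(P)=\ker(P-\lambda)^\nu$. (2) $\Pi_\lambda(P)$ is the projection onto $E_\lambda(P)$ with kernel $E_{\overline\lambda}(P^* )^\perp$. In particular, $L_2(\mathbb{T}^n_\theta)=E_\lambda(P)\dotplus E_{\overline\lambda}(P^* )^\perp$. (3) $E_{\overline\lambda}(P^* )^\perp\supseteq\dot{\sum}_{\mu\in\mathrm{Sp}(P)\setminus\{\lambda\}}E_\mu(P)$, where $\dotplus$ and $\dot\sum$ denote algebraic direct sums of linear subspaces.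
   Context: Noncommutative torus. Let $n\ge 2$ and let $\theta=(\theta_{jk})$ be a real antisymmetric $n\times n$ matrix. $C(\mathbb{T}^n_\theta)$ is the universal $C^*$-algebra (norm $\|\cdot\|$) generated by unitaries $U_1,\dots,U_n$ with $U_kU_j=e^{2i\pi\theta_{jk}}U_jU_k$. Put $U^k=U_1^{k_1}\cdots U_n^{k_n}$, $k\in\mathbb{Z}^n$. $\tau$ is the trace with $\tau(U^k)=1$ if $k=0$ and $0$ otherwise. $L_2(\mathbb{T}^n_\theta)$ is the Hilbert space completion for $(u|v)=\tau(uv^* )$; $(U^k)_{k}$ is an orthonormal basis, and $C(\mathbb{T}^n_\theta)$ acts by left multiplication. $C^\infty(\mathbb{T}^n_\theta)=\{\sum_k u_kU^k:\ (u_k)\text{ rapidly decaying}\}$ is a Fréchet $*$-algebra with semi-norms $\|\delta^\beta u\|$, where $\delta_j(U^k)=k_jU^k$ and $\delta^\beta=\delta_1^{\beta_1}\cdots\delta_n^{\beta_n}$. $\mathscr{D}'(\mathbb{T}^n_\theta)$ is its topological dual (with $C^\infty\subset L_2\subset\mathscr{D}'$ via $\langle u,v\rangle=\tau(uv)$), and for $s\in\mathbb{R}$, $W_2^s(\mathbb{T}^n_\theta)=\{u\in\mathscr{D}':\sum_k(1+|k|^2)^s|u_k|^2<\infty\}$, $u_k=\langle u,(U^k)^*\rangle$. Symbols and operators. $C^\infty(\mathbb{T}^n_\theta\times V)=C^\infty(V;C^\infty(\mathbb{T}^n_\theta))$ for $V\subseteq\mathbb{R}^n$ open. $S_q(\mathbb{T}^n_\theta\times\mathbb{R}^n)$,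 $q\in\mathbb{C}$: $\rho\in C^\infty(\mathbb{T}^n_\theta\times(\mathbb{R}^n\setminus0))$ with $\rho(t\xi)=t^q\rho(\xi)$, $t>0$. $S^q(\mathbb{T}^n_\theta\times\mathbb{R}^n)$: $\rho\in C^\infty(\mathbb{T}^n_\theta\times\mathbb{R}^n)$ for which there are $\rho_{q-j}\in S_{q-j}$, $j\ge0$, such that for all $N,\alpha,\beta$ there is $C$ with $\|\delta^\alpha\partial_\xi^\beta(\rho-\sum_{j<N}\rho_{q-j})(\xi)\|\le C|\xi|^{\Re q-N-|\beta|}$ for $|\xi|\ge1$. $P_\rho(\sum_ku_kU^k)=\sum_ku_k\rho(k)U^k$, which extends continuously to $\mathscr{D}'(\mathbb{T}^n_\theta)$ and to $W_2^{s+\Re q}\to W_2^s$; $\Psi^q(\mathbb{T}^n_\theta)=\{P_\rho:\rho\in S^q\}$. $\rho_q$ (depending only on $P_\rho$) is the principal symbol; $P_\rho$ is elliptic if $\rho_q(\xi)$ is invertible for all $\xi\ne0$. Spectral notions. $P$ is regarded as a closed unbounded operator on $L_2(\mathbb{T}^n_\theta)$ with domain $W_2^m(\mathbb{T}^n_\theta)$; its adjoint $P^*$ is the formal adjoint, in $\Psi^{\bar q}(\mathbb{T}^n_\theta)$, with domain $W_2^m(\mathbb{T}^n_\theta)$, and $\mathrm{Sp}(P^* )=\overline{\mathrm{Sp}(P)}$. As $\mathrm{Sp}(P)\neq\mathbb{C}$, $\mathrm{Sp}(P)$ is a discrete set of eigenvalues of finite multiplicity. For $\lambda\in\mathrm{Sp}(P)$,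 $E_\lambda(P)=\bigcup_{\ell\ge1}\ker(P-\lambda)^\ell$ and $\Pi_\lambda(P)=\frac1{2i\pi}\int_{|\zeta-\lambda|=r}(\zeta-P)^{-1}d\zeta$, where $r>0$ is such that $\lambda$ is the only eigenvalue of $P$ in $|\zeta-\lambda|\le r$. *)

(* Defs.v *)
From HB Require Import structures.
From mathcomp Require Import all_boot all_order all_algebra finmap complex.
From mathcomp Require Import all_classical all_reals all_analysis.
From mathcomp Require Import summability.

Set Implicit Arguments.
Unset Strict Implicit.
Unset Printing Implicit Defensive.

Import Order.TTheory GRing.Theory Num.Theory.
Import numFieldNormedType.Exports.

Local Open Scope classical_set_scope.
Local Open Scope ring_scope.
Local Open Scope complex_scope.

Reserved Notation "a *c b" (at level 40, left associativity).

(* Norms of normed modules over R[i] take their values in R[i]; they are       *)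
(* compared with real bounds through the embedding _%:C.                       *)

(* Unital C*-algebras. The product is a field of the mixin because             *)
(* Hierarchy-Builder has no join of the ring and of the normed module          *)
(* hierarchies below NumDomain.                                                *)
HB.mixin Record isCStarAlg (R : realType) A of CompleteNormedModule R[i] A := {
  amul : A -> A -> A;
  aone : A;
  star : A -> A;
  amulA : associative amul;
  amul1l : left_id aone amul;
  amul1r : right_id aone amul;
  amulDl : left_distributive amul +%R;
  amulDr : right_distributive amul +%R;
  amulZl : forall (c : R[i]) (a b : A), amul (c *: a) b = c *: amul a b;
  amulZr : forall (c : R[i]) (a b : A), amul a (c *: b) = c *: amul a b;
  starD : forall a b : A, star (a + b) = star a + star b;
  starZ : forall (c : R[i]) (a : A), star (c *: a) = c^* *: star a;
  starM : forall a b : A, star (amul a b) = amul (star b) (star a);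
  starK : involutive star;
  cstar_normM : forall a b : A, `|amul a b| <= `|a| * `|b|;
  cstar_normE : forall a : A, `|amul (star a) a| = `|a| ^+ 2
}.

#[short(type="cstarAlgType")]
HB.structure Definition CStarAlg (R : realType) :=
  {A of isCStarAlg R A & CompleteNormedModule R[i] A}.

Notation "a *c b" := (amul a b) : ring_scope.

(* The inner product is linear in its first argument. *)
HB.mixin Record isHilbert (R : realType) H of CompleteNormedModule R[i] H := {
  dot : H -> H -> R[i];
  dotDl : forall u v w : H, dot (u + v) w = dot u w + dot v w;
  dotZl : forall (c : R[i]) (u v : H), dot (c *: u) v = c * dot u v;
  dotC : forall u v : H, dot v u = (dot u v)^*;
  dot_normE : forall u : H, dot u u = `|u| ^+ 2
}.

#[short(type="hilbertType")]
HB.structure Definition Hilbert (R : realType) :=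
  {H of isHilbert R H & CompleteNormedModule R[i] H}.

Section Scalars.
Variable R : realType.

Definition cexp (z : R[i]) : R[i] :=
  (expR (complex.Re z))%:C * (cos (complex.Im z) +i* sin (complex.Im z)).

Definition cpow (t : R) (q : R[i]) : R[i] := cexp (q * (ln t)%:C).

Definition enorm (n : nat) (x : 'rV[R]_n) : R :=
  Num.sqrt (\sum_(j < n) x 0 j ^+ 2).

Definition zvec (n : nat) (k : 'rV[int]_n) : 'rV[R]_n := map_mx intr k.

End Scalars.

Arguments zvec R {n} k.

(* D_1^(beta_1) ... D_n^(beta_n) applied to x *)
Definition multi_iter (n : nat) (X : Type) (D : 'I_n -> X -> X)
    (beta : 'I_n -> nat) (x : X) : X :=
  foldr (fun j y => iter (beta j) (D j) y) x (enum 'I_n).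

Section UniversalAlgebra.
Variables (R : realType) (n : nat) (theta : 'M[R]_n).

Definition unitary (A : cstarAlgType R) (u : A) : Prop :=
  star u *c u = aone /\ u *c star u = aone.

(* integer powers of a unitary u, with u^(-1) = u^* *)
Definition upow (A : cstarAlgType R) (u : A) (z : int) : A :=
  match z with
  | Posz m => iter m (amul u) aone
  | Negz m => iter m.+1 (amul (star u)) aone
  end.

Definition umonom (A : cstarAlgType R) (U : 'I_n -> A) (k : 'rV[int]_n) : A :=
  \big[amul/aone]_(j < n) upow (U j) (k 0 j).

Definition nct_relations (A : cstarAlgType R) (U : 'I_n -> A) : Prop :=
  (forall j, unitary (U j)) /\
  (forall j k, U k *c U j = cexp (0 +i* (2 * pi * theta j k)) *: (U j *c U k)).

Definition cstar_generated (A : cstarAlgType R) (U : 'I_n -> A) : Prop :=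
  forall S : set A, closed S -> S aone -> (forall j, S (U j)) ->
    (forall a b, S a -> S b -> S (a + b)) ->
    (forall a b, S a -> S b -> S (a *c b)) ->
    (forall c a, S a -> S (c *: a)) ->
    (forall a, S a -> S (star a)) ->
    forall a, S a.

Definition nct_universal (A : cstarAlgType R) (U : 'I_n -> A) : Prop :=
  [/\ nct_relations U, cstar_generated U &
    forall (B : cstarAlgType R) (V : 'I_n -> B), nct_relations V ->
      exists phi : {linear A -> B},
        [/\ phi aone = aone,
            (forall a b, phi (a *c b) = phi a *c phi b),
            (forall a, phi (star a) = star (phi a)) &
            (forall j, phi (U j) = V j)]].

Definition nct_trace_spec (A : cstarAlgType R) (U : 'I_n -> A)
    (tau : {scalar A}) : Prop :=
  [/\ (forall a, `|tau a| <= `|a|),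
      (forall a, 0 <= tau (a *c star a)),
      (forall a b, tau (a *c b) = tau (b *c a)) &
      (forall k, tau (umonom U k) = (k == 0)%:R)].

Record nctorus := NCTorus {
  nct_alg :> cstarAlgType R;
  nct_gen : 'I_n -> nct_alg;
  nct_univ : nct_universal nct_gen;
  nct_tr : {scalar nct_alg};
  nct_trP : nct_trace_spec nct_gen nct_tr
}.

End UniversalAlgebra.

Section SmoothAlgebra.
Variables (R : realType) (n : nat) (theta : 'M[R]_n) (A : nctorus theta).

Definition Uk (k : 'rV[int]_n) : A := umonom (@nct_gen R n theta A) k.

Definition fourier (u : A) (k : 'rV[int]_n) : R[i] :=
  nct_tr A (u *c star (Uk k)).

Definition rapidly_decaying (c : 'rV[int]_n -> R[i]) : Prop :=
  forall N : nat, exists C : R, forall k,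
    ((1 + enorm (zvec R k)) ^+ N)%:C * `|c k| <= C%:C.

Definition smooth : set A := [set u | exists c, rapidly_decaying c /\
  partial_sum (fun k : 'rV[int]_n => c k *: Uk k) @ totally --> u].

(* [summability.sum] is the limit in norm of the net of finite partial sums;   *)
(* the series below converge for smooth u.                                     *)
Definition delta (j : 'I_n) (u : A) : A :=
  summability.sum (fun k : 'rV[int]_n => ((k 0 j)%:~R * fourier u k) *: Uk k).

Definition deltas : ('I_n -> nat) -> A -> A := multi_iter delta.

(* convergence for the semi-norms |delta^alpha u| *)
Definition frechet_cvg (T : Type) (F : set_system T) (f : T -> A) (l : A)
  : Prop :=
  forall alpha, (fun x => deltas alpha (f x - l)) @ F --> (0 : A).

Definition smooth_invertible (u : A) : Prop :=
  exists v, [/\ smooth v, u *c v = aone & v *c u = aone].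

End SmoothAlgebra.

Arguments smooth {R n theta} A.
Arguments Uk {R n theta} A k.

Section Symbols.
Variables (R : realType) (n : nat) (theta : 'M[R]_n) (A : nctorus theta).
Implicit Types (f rho sigma : 'rV[R]_n -> A) (V : set 'rV[R]_n).

Definition diff_quot (j : 'I_n) f (xi : 'rV[R]_n) (h : R) : A :=
  (h^-1)%:C *: (f (xi + h *: delta_mx 0 j) - f xi).

Definition pd (j : 'I_n) f (xi : 'rV[R]_n) : A :=
  lim (diff_quot j f xi h @[h --> 0^']).

Definition pds : ('I_n -> nat) -> ('rV[R]_n -> A) -> 'rV[R]_n -> A :=
  multi_iter pd.

(* C^oo(V; C^oo(T_theta)), for V open: every iterated partial derivative       *)
(* exists on V as a limit in the Frechet space C^oo(T_theta), takes its values *)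
(* there and is continuous.                                                    *)
Definition smooth_map V f : Prop :=
  forall (s : seq 'I_n) (xi : 'rV[R]_n), V xi ->
    let g := foldr pd f s in
    [/\ smooth A (g xi),
        frechet_cvg (nbhs xi) g (g xi) &
        forall j, frechet_cvg 0^' (diff_quot j g xi) (pd j g xi)].

Definition homogeneous_symbol (q : R[i]) rho : Prop :=
  smooth_map [set xi | xi != 0] rho /\
  forall (t : R) xi, 0 < t -> xi != 0 -> rho (t *: xi) = cpow t q *: rho xi.

Definition symbol_expansion (q : R[i]) rho (rhos : nat -> 'rV[R]_n -> A)
  : Prop :=
  [/\ smooth_map setT rho,
      (forall j, homogeneous_symbol (q - j%:R) (rhos j)) &
      forall (N : nat) (alpha beta : 'I_n -> nat), exists C : R,
        forall xi : 'rV[R]_n, 1 <= enorm xi ->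
        `|deltas alpha
            (pds beta (fun eta => rho eta - \sum_(j < N) rhos j eta) xi)|
        <= (C * powR (enorm xi)
              (complex.Re q - N%:R - (\sum_(j < n) beta j)%N%:R))%:C].

Definition symbol (q : R[i]) rho : Prop := exists rhos, symbol_expansion q rho rhos.

Definition quantization rho (u : A) : A :=
  summability.sum (fun k : 'rV[int]_n => fourier u k *: (rho (zvec R k) *c Uk A k)).

(* P is an operator on C^oo(T_theta); its values outside [smooth] are          *)
(* irrelevant.                                                                 *)
Definition pdo (q : R[i]) (P : A -> A) : Prop :=
  exists rho, symbol q rho /\ (forall u, smooth A u -> P u = quantization rho u).

Definition principal_symbol (q : R[i]) (P : A -> A) sigma : Prop :=
  exists rho rhos, [/\ symbol_expansion q rho rhos,
    (forall u, smooth A u -> P u = quantization rho u) &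
    forall xi, xi != 0 -> sigma xi = rhos 0%N xi].

Definition elliptic (q : R[i]) (P : A -> A) : Prop :=
  exists sigma, principal_symbol q P sigma /\
    forall xi, xi != 0 -> smooth_invertible (sigma xi).

End Symbols.

Section L2.
Variables (R : realType) (n : nat) (theta : 'M[R]_n) (A : nctorus theta).

(* Hilbert space completion of A for (u|v) = tau(u v^* ) *)
Record L2completion := L2Completion {
  L2_space :> hilbertType R;
  L2_emb : {linear A -> L2_space};
  L2_embE : forall u v, dot (L2_emb u) (L2_emb v) = nct_tr A (u *c star v);
  L2_dense : dense (range L2_emb)
}.

Variable H : L2completion.

Definition L2_coef (u : H) (k : 'rV[int]_n) : R[i] :=
  dot u (L2_emb H (Uk A k)).

Definition sobolev_norm2 (s : R) (u : H) : \bar R :=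
  \esum_(k in [set: 'rV[int]_n])
    (powR (1 + enorm (zvec R k) ^+ 2) s * complex.Re `|L2_coef u k| ^+ 2)%:E.

(* W_2^s as a subspace of L_2, which is its definition for s >= 0 *)
Definition sobolev (s : R) : set H := [set u | (sobolev_norm2 s u < +oo)%E].

(* Graph of the continuous extension of P to an operator from W_2^m to L_2 *)
Definition realization (m : R) (P : A -> A) : set (H * H)%type :=
  [set uv | sobolev m uv.1 /\
    forall eps : R, 0 < eps -> exists d : R, 0 < d /\
      forall w, smooth A w ->
        (sobolev_norm2 m (uv.1 - L2_emb H w)%R < d%:E)%E ->
        `|uv.2 - L2_emb H (P w)| < eps%:C].

End L2.

Arguments realization {R n theta A} H m P.

(* Unbounded operators are given by their graphs. *)
Section Operators.
Variables (R : realType) (H : hilbertType R).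
Implicit Types (T : set (H * H)%type) (E F : set H) (lambda z : R[i]) (r : R).

Definition op_shift T lambda : set (H * H)%type :=
  [set uv | T (uv.1, uv.2 + lambda *: uv.1)].

Fixpoint op_pow T (l : nat) : set (H * H)%type :=
  if l is l'.+1 then
    [set uv | exists w, op_pow T l' (uv.1, w) /\ T (w, uv.2)]
  else [set uv | uv.2 = uv.1].

Definition op_ker T : set H := [set u | T (u, 0)].

Definition op_adjoint T : set (H * H)%type :=
  [set vw | forall u u', T (u, u') -> dot u' vw.1 = dot u vw.2].

Definition is_resolvent T z (S : {linear H -> H}) : Prop :=
  [/\ continuous S,
      (forall u, T (S u, z *: S u - u)) &
      (forall u v, T (u, v) -> S (z *: u - v) = u)].

Definition spectrum T : set R[i] :=
  [set z | ~ exists S : {linear H -> H}, is_resolvent T z S].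

Definition eigenvalue_op T : set R[i] :=
  [set z | exists u, u != 0 /\ T (u, z *: u)].

Definition gen_eigenspace T lambda : set H :=
  \bigcup_(l in [set l | (1 <= l)%N]) op_ker (op_pow (op_shift T lambda) l).

Definition circle_pt lambda r (t : R) : R[i] := lambda + r%:C * cexp (0 +i* t).

(* J is the integral of F(zeta) d zeta over |zeta - lambda| = r, as a limit of *)
(* Riemann sums in operator norm.                                              *)
Definition is_circle_integral lambda r (F : R[i] -> H -> H) (J : H -> H)
  : Prop :=
  forall eps : R, 0 < eps -> exists d : R, 0 < d /\
    forall (N : nat) (t s : nat -> R), t 0%N = 0 -> t N = 2 * pi ->
      (forall j, (j < N)%N ->
        [/\ t j <= s j, s j <= t j.+1 & t j.+1 - t j < d]) ->
      forall u, `|\sum_(j < N)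
          (circle_pt lambda r (t j.+1) - circle_pt lambda r (t j))
            *: F (circle_pt lambda r (s j)) u - J u| <= eps%:C * `|u|.

Definition isolating_radius T lambda r : Prop :=
  0 < r /\
  forall z, eigenvalue_op T z -> `|z - lambda| <= r%:C -> z = lambda.

(* The value does not depend on the choice of the isolating radius. *)
Definition is_riesz_projection T lambda (Pi : {linear H -> H}) : Prop :=
  [/\ continuous Pi,
      (exists r, isolating_radius T lambda r) &
      forall r, isolating_radius T lambda r ->
        exists Res : R[i] -> {linear H -> H},
          (forall z, `|z - lambda| = r%:C -> is_resolvent T z (Res z)) /\
          is_circle_integral lambda r Res (fun u => (2 * pi *i) *: Pi u)].

Definition orthocomp E : set H := [set u | forall v, E v -> dot u v = 0].

Definition finite_dim_subspace E : Prop :=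
  exists (d : nat) (b : 'I_d -> H), forall u,
    E u <-> exists c : 'I_d -> R[i], u = \sum_(i < d) c i *: b i.

Definition projection_onto_along (Pi : H -> H) E F : Prop :=
  [/\ (forall u, Pi (Pi u) = Pi u), range Pi = E & [set u | Pi u = 0] = F].

Definition direct_decomposition E F : Prop :=
  (forall u, exists v w, [/\ E v, F w & u = v + w]) /\
  (forall u, E u -> F u -> u = 0).

(* algebraic sum of the subspaces E_ i, i in I *)
Definition family_sum (I : set R[i]) (E_ : R[i] -> set H) : set H :=
  [set u | exists (s : seq R[i]) (x : R[i] -> H),
    [/\ uniq s, (forall i, i \in s -> I i /\ E_ i (x i)) &
        u = \sum_(i <- s) x i]].

Definition family_independent (I : set R[i]) (E_ : R[i] -> set H) : Prop :=
  forall (s : seq R[i]) (x : R[i] -> H), uniq s ->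
    (forall i, i \in s -> I i /\ E_ i (x i)) ->
    \sum_(i <- s) x i = 0 -> forall i, i \in s -> x i = 0.

End Operators.

(* Main.v *)
(* The operator T is studied through one resolvent K = (z0 - T)^-1. If K is
   compact, Riesz-Schauder theory for K - 1/(z0 - lambda) splits the Hilbert space
   into a finite-dimensional generalized kernel and a closed range, on which the
   resolvent of T is holomorphic near lambda. Laurent expansion of the resolvent
   on a circle, whose regular part is bounded on the whole isolating disc by
   Rickart's real-variable form of the spectral radius formula, identifies Pi with
   the projection of that splitting, and K^* gives its kernel.

   Compactness of K and smoothness of E_lambda come from a single a priori
   estimate on Fourier coefficients. Let sigma(i) be the inverse of the principal
   symbol at i <> 0. Pairing P u with sigma(i)^* U^i gives u_i + sum_k R_ik u_k, where
   R_ik = O(|i|^-1 (1 + |i - k|)^-N) for all N, because the symbol is Lipschitz with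
   the bound given by its order and sigma has rapidly decaying coefficients,
   uniformly after scaling to the unit sphere (Leibniz rule applied to
   sigma rho_q = 1). Hence, if P u = w, u_i is dominated by (1 + |i|)^-d times a rapidly
   decaying average of |u| + |w| around i, with d = min(1, m). Schur's test turns
   this into compactness, and bootstrapping it on E_lambda gives rapid decay. *)

Require Import Defs.
From HB Require Import structures.
From mathcomp Require Import all_boot all_order all_algebra finmap complex.
From mathcomp Require Import all_classical all_reals all_analysis.
From mathcomp Require Import summability.
From mathcomp Require Import ring lra.

Set Implicit Arguments.
Unset Strict Implicit.
Unset Printing Implicit Defensive.

Import Order.TTheory GRing.Theory Num.Theory.
Import numFieldNormedType.Exports.

Local Open Scope classical_set_scope.
Local Open Scope ring_scope.
Local Open Scope complex_scope.

(** Passing to K makes everything bounded: formally [L = mu K (T - lambda)], where [L = K - mu] and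
    [mu = 1/(z0 - lambda)]. As K is injective and commutes with L, the generalized eigenspaces of T
    are the kernels of the powers of L, and the adjoint of T has the same form. The contour radius r
    is constrained only by the eigenvalues, so a Neumann series near lambda need not reach it. What
    is known is that [1 - c G] is invertible for all |c| <= r, G being the reduced resolvent;
    Rickart's argument turns this into [r^M |G^M| -> 0] along M = 2^k, which makes the remainder of
    the Laurent expansion uniformly small on the circle. The contour integral being a limit of
    Riemann sums, the terms of the expansion are summed directly. On the torus no composition of
    pseudodifferential operators is used: the principal symbol is frozen at the output frequency i,
    which leaves an infinite matrix to estimate. In d = min(1, m), the 1 is the order gained by
    freezing the symbol and dropping lower-order terms, and m is the order gained by applying
    sigma(i) to w. *)

Section RealNorm.
Variable R : realType.

(* Norms take values in R[i]; the estimates below use this real-valued norm. *)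
Definition nrm (V : normedZmodType R[i]) (x : V) : R := complex.Re `|x|.

Lemma ge0_ReC (z : R[i]) : 0 <= z -> z = (complex.Re z)%:C.
Proof. by move=> z0; rewrite RRe_real // ger0_real. Qed.

Lemma gt0_ReC (z : R[i]) : 0 < z -> z = (complex.Re z)%:C /\ 0 < complex.Re z.
Proof.
move=> z0; have zE := ge0_ReC (ltW z0); split=> //.
by rewrite -ltcR -zE.
Qed.

Section Zmod.
Variable V : normedZmodType R[i].
Implicit Types x y : V.

Lemma nrmE x : `|x| = (nrm x)%:C.
Proof. by rewrite -ge0_ReC. Qed.

Lemma nrm_ge0 x : 0 <= nrm x.
Proof. by rewrite -ler0c -nrmE. Qed.

Lemma nrm0 : nrm (0 : V) = 0.
Proof. by rewrite /nrm normr0. Qed.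

Lemma nrm0_eq x : nrm x = 0 -> x = 0.
Proof. by move=> h; apply/normr0_eq0; rewrite nrmE h. Qed.

Lemma nrm_le0 x : nrm x <= 0 -> x = 0.
Proof. by move=> h; apply/nrm0_eq/le_anti; rewrite h nrm_ge0. Qed.

Lemma nrm_eps0 x : (forall e : R, 0 < e -> nrm x <= e) -> x = 0.
Proof. by move=> h; apply: nrm_le0; apply/ler_addgt0Pr => e e0; rewrite add0r h. Qed.

Lemma nrm_gt0 x : x != 0 -> 0 < nrm x.
Proof.
move=> x0; rewrite lt0r nrm_ge0 andbT; apply: contraNneq x0 => h.
by apply/eqP/nrm0_eq.
Qed.

Lemma nrmN x : nrm (- x) = nrm x.
Proof. by rewrite /nrm normrN. Qed.

Lemma nrmBC x y : nrm (x - y) = nrm (y - x).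
Proof. by rewrite -nrmN opprB. Qed.

Lemma nrmD x y : nrm (x + y) <= nrm x + nrm y.
Proof. by rewrite -lecR rmorphD /= -!nrmE ler_normD. Qed.

Lemma nrmB x y : nrm (x - y) <= nrm x + nrm y.
Proof. by rewrite -(nrmN y) nrmD. Qed.

Lemma nrm_tri x y z : nrm (x - z) <= nrm (x - y) + nrm (y - z).
Proof. by have := nrmD (x - y) (y - z); rewrite subrKA. Qed.

Lemma nrm_lebD x y : nrm x <= nrm (x - y) + nrm y.
Proof. by have := nrmD (x - y) y; rewrite subrK. Qed.

Lemma nrm_sum (I : Type) (r : seq I) (P : pred I) (F : I -> V) :
  nrm (\sum_(i <- r | P i) F i) <= \sum_(i <- r | P i) nrm (F i).
Proof.
elim/big_rec2: _ => [|i y x _ h]; first by rewrite nrm0.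
by apply: (le_trans (nrmD _ _)); rewrite lerD2l.
Qed.
End Zmod.

Lemma nrm_norm_le (V : normedZmodType R[i]) (x : V) (c : R) :
  (`|x| <= c%:C) = (nrm x <= c).
Proof. by rewrite nrmE lecR. Qed.

Lemma nrm_norm_lt (V : normedZmodType R[i]) (x : V) (c : R) :
  (`|x| < c%:C) = (nrm x < c).
Proof. by rewrite nrmE ltcR. Qed.

Lemma nrmZ (V : normedModType R[i]) (c : R[i]) (x : V) :
  nrm (c *: x) = nrm c * nrm x.
Proof. by apply: complexI; rewrite rmorphM /= -!nrmE normrZ. Qed.

Lemma nrmM (a b : R[i]) : nrm (a * b) = nrm a * nrm b.
Proof. by apply: complexI; rewrite rmorphM /= -!nrmE normrM. Qed.

Lemma nrm1 : nrm (1 : R[i]) = 1.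
Proof. by rewrite /nrm normr1. Qed.

Lemma nrmX (a : R[i]) n : nrm (a ^+ n) = nrm a ^+ n.
Proof. by elim: n => [|n ih]; rewrite ?expr0 ?nrm1 // !exprS nrmM ih. Qed.

Lemma nrmV (a : R[i]) : nrm a^-1 = (nrm a)^-1.
Proof.
have [->|a0] := eqVneq a 0; first by rewrite invr0 nrm0 invr0.
have n0 : nrm a != 0 by rewrite gt_eqF ?nrm_gt0.
by apply: (mulfI n0); rewrite -nrmM !mulfV // nrm1.
Qed.

Lemma nrmR (a : R) : nrm (a%:C : R[i]) = `|a|.
Proof. by apply: complexI; rewrite -nrmE normc_def /= expr0n addr0 sqrtr_sqr. Qed.

(* The notation [^*] is shared by [conjc] and [Num.conj]. *)
Definition cj (a : R[i]) : R[i] := conjc a.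

Lemma nrmJ (a : R[i]) : nrm (cj a) = nrm a.
Proof. by apply: complexI; rewrite -!nrmE !normc_def /cj; case: a => x y /=; rewrite sqrrN. Qed.

Lemma nrmC_sqr (a : R[i]) : nrm a ^+ 2 = complex.Re a ^+ 2 + complex.Im a ^+ 2.
Proof. by apply: complexI; rewrite rmorphXn /= -nrmE -add_Re2_Im2. Qed.

Lemma mulcJ (a : R[i]) : a * cj a = (nrm a ^+ 2)%:C.
Proof. by rewrite rmorphXn /= -nrmE /cj; case: a => x y; rewrite -add_Re2_Im2 /=; simpc; rewrite /= !expr2 [x * y]mulrC addNr. Qed.

Lemma Re_le_nrm (a : R[i]) : `|complex.Re a| <= nrm a.
Proof.
rewrite -(@ler_pXn2r _ 2) ?nnegrE ?nrm_ge0 // real_normK ?num_real // nrmC_sqr.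
by rewrite lerDl sqr_ge0.
Qed.

Lemma Im_le_nrm (a : R[i]) : `|complex.Im a| <= nrm a.
Proof.
rewrite -(@ler_pXn2r _ 2) ?nnegrE ?nrm_ge0 // real_normK ?num_real // nrmC_sqr.
by rewrite lerDr sqr_ge0.
Qed.

Lemma nrm_le_ReIm (a : R[i]) : nrm a <= `|complex.Re a| + `|complex.Im a|.
Proof.
rewrite -(@ler_pXn2r _ 2) ?nnegrE ?nrm_ge0 ?addr_ge0 // nrmC_sqr sqrrD !real_normK ?num_real //.
by rewrite [X in _ <= X]addrAC lerDl mulrn_wge0 // mulr_ge0.
Qed.

Lemma mklin (U V : lmodType R[i]) (f : U -> V) :
  (forall x y, f (x + y) = f x + f y) -> (forall c x, f (c *: x) = c *: f x) ->
  exists g : {linear U -> V}, forall x, g x = f x.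
Proof.
move=> fD fZ.
have lf : linear f by move=> c x y; rewrite fD fZ.
pose m := GRing.isLinear.Build R[i] U V *:%R f lf.
pose g : {linear U -> V} := HB.pack f m.
by exists g.
Qed.

(** Adjoints, projections and partial inverses are specified below by linear relations with a unique
    solution; linearity of the chosen map comes from uniqueness, and bounds are proved
    afterwards. *)
Lemma linear_choice (U V : lmodType R[i]) (P : U -> V -> Prop) :
  (forall x, exists y, P x y) -> (forall x y y', P x y -> P x y' -> y = y') ->
  (forall x x' y y', P x y -> P x' y' -> P (x + x') (y + y')) ->
  (forall c x y, P x y -> P (c *: x) (c *: y)) ->
  exists g : {linear U -> V}, forall x, P x (g x).
Proof.
move=> /choice[f fP] uP dP zP.
have [x y|c x|g gE] := @mklin U V f.
- by apply: (uP (x + y)) => //; apply: dP.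
- by apply: (uP (c *: x)) => //; apply: zP.
by exists g => x; rewrite gE.
Qed.

Lemma cjM (a b : R[i]) : cj (a * b) = cj a * cj b.
Proof. exact: rmorphM. Qed.

Lemma cjD (a b : R[i]) : cj (a + b) = cj a + cj b.
Proof. exact: rmorphD. Qed.

Lemma cjN (a : R[i]) : cj (- a) = - cj a.
Proof. exact: rmorphN. Qed.

Lemma cjV (a : R[i]) : cj a^-1 = (cj a)^-1.
Proof. exact: conjc_inv. Qed.

Lemma cjR (a : R) : cj a%:C = a%:C :> R[i].
Proof. exact: conjc_real. Qed.

Lemma cjK (a : R[i]) : cj (cj a) = a.
Proof. exact: conjcK. Qed.

Lemma cj0 : cj 0 = 0 :> R[i].
Proof. exact: conjc0. Qed.

Definition bounded_op (U V : normedModType R[i]) (f : U -> V) :=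
  exists2 C : R, 0 <= C & forall x, nrm (f x) <= C * nrm x.

Lemma continuous_bounded_op (U V : normedModType R[i]) (f : {linear U -> V}) :
  continuous f -> bounded_op f.
Proof.
move=> /linear_bounded_continuous/linear_boundedP h.
have : \forall r \near +oo, 0 <= r /\ forall x : U, `|f x| <= r * `|x|.
  near=> r; split; last by near: r.
  by near: r; exact: nbhs_pinfty_ge.
move=> /filter_ex[r [r0 fr]]; exists (complex.Re r) => [|x].
  by rewrite -ler0c -ge0_ReC.
by rewrite -lecR rmorphM /= -!nrmE -ge0_ReC.
Unshelve. all: by end_near. Qed.

Lemma bounded_op_continuous (U V : normedModType R[i]) (f : {linear U -> V}) :
  bounded_op f -> continuous f.
Proof.
move=> [C C0 fC]; apply/linear_bounded_continuous/linear_boundedP.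
near=> r => x; have rC : C%:C <= r by near: r; apply: nbhs_pinfty_ge; rewrite complex_real.
apply: le_trans (_ : C%:C * `|x| <= _); last by rewrite ler_wpM2r.
by rewrite !nrmE -rmorphM lecR.
Unshelve. all: by end_near. Qed.

End RealNorm.

(** * Hilbert spaces *)

Section Completeness.
Variables (R : realType).

Definition subsp (V : lmodType R[i]) (G : set V) :=
  [/\ G 0, (forall x y, G x -> G y -> G (x + y)) & forall c x, G x -> G (c *: x)].

Definition closedE (V : normedZmodType R[i]) (G : set V) :=
  forall x, (forall e : R, 0 < e -> exists2 y, G y & nrm (x - y) <= e) -> G x.

Lemma cvg_nrmP (V : normedModType R[i]) T (F : set_system T) {FF : Filter F} (f : T -> V) (l : V) :
  f @ F --> l <-> forall e : R, 0 < e -> \forall x \near F, nrm (l - f x) < e.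
Proof.
split=> [/cvgrPdist_lt h e e0|h].
  have := h e%:C; rewrite ltcR => /(_ e0); apply: filterS => x.
  by rewrite nrm_norm_lt.
apply/cvgrPdist_lt => e /gt0_ReC[-> e0]; apply: filterS (h _ e0) => x.
by rewrite nrm_norm_lt.
Qed.

Lemma closedEP (V : normedModType R[i]) (G : set V) : closedE G <-> closed G.
Proof.
split=> [h x clx|cG x h].
  apply: h => e e0; have [] := clx (ball x e%:C).
    by apply: nbhsx_ballx; rewrite ltcR.
  move=> y [Gy]; rewrite -ball_normE /= => xy; exists y => //.
  by apply/ltW; rewrite -nrm_norm_lt.
apply: cG => B /nbhs_ballP[e] /= /gt0_ReC[eE e0] sB.
have [|y Gy xy] := h (complex.Re e / 2); first by rewrite divr_gt0.
exists y; split=> //; apply: sB; rewrite -ball_normE /= eE nrm_norm_lt.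
by apply: le_lt_trans xy _; rewrite ltr_pdivrMr // ltr_pMr // ltr1n.
Qed.

Lemma complete_net (V : completeNormedModType R[i]) T (F : set_system T) {FF : ProperFilter F} (f : T -> V) :
  (forall e : R, 0 < e -> exists2 A, F A & forall p q, A p -> A q -> nrm (f p - f q) < e) ->
  exists l : V, f @ F --> l.
Proof.
move=> h; have : cauchy (f @ F).
  apply/cauchy_ballP => e /gt0_ReC[-> e0].
  have [A FA hA] := h _ e0.
  exists (f @` A, f @` A) => /=; last first.
    move=> [_ _] /= [[p Ap <-] [q Aq <-]]; rewrite -ball_normE /= nrm_norm_lt; exact: hA.
  by split; rewrite /nbhs /=; apply: (@filterS _ F _ A) => // p Ap; exists p.
by move=> /cauchy_cvg cv; exists (lim (f @ F)).
Qed.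

Lemma complete_seq (V : completeNormedModType R[i]) (x : nat -> V) :
  (forall e : R, 0 < e -> exists N, forall p q, (N <= p)%N -> (N <= q)%N -> nrm (x p - x q) < e) ->
  exists l, forall e : R, 0 < e -> exists N, forall p, (N <= p)%N -> nrm (l - x p) < e.
Proof.
move=> h; have [|l] := @complete_net V nat \oo _ x.
  move=> e /h[N hN]; exists [set p | (N <= p)%N]; last by move=> p q; apply: hN.
  by exists N.
by move=> /cvg_nrmP hl; exists l => e /hl[N _ hN]; exists N => p /hN.
Qed.

Lemma pos_choice_nat (c e : R) : 0 < e -> exists N : nat, forall p, (N <= p)%N -> c / p.+1%:R < e.
Proof.
move=> e0; have [c0|c0] := leP c 0.
  by exists 0%N => p _; apply: le_lt_trans e0; rewrite mulr_le0_ge0.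
exists (Num.truncn (c / e)) => p Np; rewrite ltr_pdivrMr // mulrC -ltr_pdivrMr //.
apply: lt_le_trans (truncnS_gt _) _; by rewrite ler_nat.
Qed.

End Completeness.

Section Hilbert.
Variables (R : realType) (H : hilbertType R).
Implicit Types u v w x y : H.

Lemma dot_cj u v : dot v u = cj (dot u v).
Proof. exact: dotC. Qed.

Lemma dotDr u v w : dot u (v + w) = dot u v + dot u w.
Proof. by rewrite dot_cj dotDl cjD -!dot_cj. Qed.

Lemma dotZr c u v : dot u (c *: v) = cj c * dot u v.
Proof. by rewrite dot_cj dotZl cjM -dot_cj. Qed.

Lemma dot0l u : dot 0 u = 0.
Proof. by rewrite -(scale0r u) dotZl mul0r. Qed.

Lemma dot0r u : dot u 0 = 0.
Proof. by rewrite dot_cj dot0l cj0. Qed.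

Lemma dotNl u v : dot (- u) v = - dot u v.
Proof. by rewrite -scaleN1r dotZl mulN1r. Qed.

Lemma dotNr u v : dot u (- v) = - dot u v.
Proof. by rewrite dot_cj dotNl cjN -dot_cj. Qed.

Lemma dotBl u v w : dot (u - v) w = dot u w - dot v w.
Proof. by rewrite dotDl dotNl. Qed.

Lemma dotBr u v w : dot u (v - w) = dot u v - dot u w.
Proof. by rewrite dotDr dotNr. Qed.

Lemma dot_suml (I : Type) (r : seq I) (P : pred I) (F : I -> H) v :
  dot (\sum_(i <- r | P i) F i) v = \sum_(i <- r | P i) dot (F i) v.
Proof. by elim/big_rec2: _ => [|i y x _ <-]; rewrite ?dot0l ?dotDl. Qed.

Lemma dot_sumr (I : Type) (r : seq I) (P : pred I) (F : I -> H) v :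
  dot v (\sum_(i <- r | P i) F i) = \sum_(i <- r | P i) dot v (F i).
Proof. by elim/big_rec2: _ => [|i y x _ <-]; rewrite ?dot0r ?dotDr. Qed.

Lemma dot_self u : dot u u = (nrm u ^+ 2)%:C.
Proof. by rewrite dot_normE nrmE rmorphXn. Qed.

Lemma dot_self_eq0 u : dot u u = 0 -> u = 0.
Proof.
rewrite dot_self => /complexI/eqP; rewrite expf_eq0 /= => /eqP; exact: nrm0_eq.
Qed.

Lemma nrm_sqrD u v : nrm (u + v) ^+ 2 = nrm u ^+ 2 + nrm v ^+ 2 + complex.Re (dot u v) *+ 2.
Proof.
have := dot_self (u + v); rewrite dotDl !dotDr !dot_self (dot_cj u v) => /(congr1 (@complex.Re R)) /= <-.
by case: (dot u v) => a b /=; rewrite mulr2n; ring.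
Qed.

Lemma nrm_sqrB u v : nrm (u - v) ^+ 2 = nrm u ^+ 2 + nrm v ^+ 2 - complex.Re (dot u v) *+ 2.
Proof. by rewrite nrm_sqrD nrmN dotNr; case: (dot u v) => a b /=; rewrite mulNrn. Qed.

Lemma CauchySchwarz u v : nrm (dot u v) <= nrm u * nrm v.
Proof.
have [->|v0] := eqVneq v 0; first by rewrite dot0r !nrm0 mulr0.
have nv := nrm_gt0 v0.
rewrite -(@ler_pXn2r _ 2) ?nnegrE ?mulr_ge0 ?nrm_ge0 // exprMn.
have := sqr_ge0 (nrm ((nrm v ^+ 2)%:C *: u - dot u v *: v)).
rewrite nrm_sqrB !nrmZ nrmR ger0_norm ?sqr_ge0 // dotZl dotZr [X in _%:C * X]mulrC mulcJ.
rewrite -rmorphM /= => h.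
rewrite -subr_ge0 -(@pmulr_rge0 _ (nrm v ^+ 2)) ?exprn_gt0 //.
by apply: le_trans h _; rewrite le_eqVlt; apply/orP; left; apply/eqP; ring.
Qed.

Lemma dot_eq_l x y : (forall w, dot x w = dot y w) -> x = y.
Proof.
by move=> h; apply/eqP; rewrite -subr_eq0; apply/eqP/dot_self_eq0; rewrite dotBl h subrr.
Qed.

Lemma dot_eq_r x y : (forall w, dot w x = dot w y) -> x = y.
Proof. by move=> h; apply: dot_eq_l => w; rewrite dot_cj h -dot_cj. Qed.

Lemma closedE_dot0 v : closedE [set x | dot x v = 0].
Proof.
move=> x h /=; apply: nrm_eps0 => e e0.
have [|y /= yv xy] := h (e / (nrm v + 1)).
  by rewrite divr_gt0 // ltr_wpDl ?nrm_ge0.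
have -> : dot x v = dot (x - y) v by rewrite dotBl yv subr0.
apply: le_trans (CauchySchwarz _ _) _.
apply: le_trans (ler_wpM2r (nrm_ge0 _) xy) _.
rewrite mulrAC ler_pdivrMr ?ltr_wpDl ?nrm_ge0 // ler_wpM2l ?ltW //.
by rewrite ltrDl.
Qed.

Lemma subsp_dot0 v : subsp [set x | dot x v = 0].
Proof.
split=> /= [|x y xv yv|c x xv]; first exact: dot0l.
  by rewrite dotDl xv yv addr0.
by rewrite dotZl xv mulr0.
Qed.

Lemma subspI (G1 G2 : set H) : subsp G1 -> subsp G2 -> subsp (G1 `&` G2).
Proof.
move=> [a1 b1 c1] [a2 b2 c2]; split=> //.
  by move=> x y [? ?] [? ?]; split; [apply: b1|apply: b2].
by move=> c x [? ?]; split; [apply: c1|apply: c2].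
Qed.

Lemma closedEI (G1 G2 : set H) : closedE G1 -> closedE G2 -> closedE (G1 `&` G2).
Proof.
move=> h1 h2 x h; split.
  by apply: h1 => e /h[y [? _] ?]; exists y.
by apply: h2 => e /h[y [_ ?] ?]; exists y.
Qed.

Lemma subspB (G : set H) x y : subsp G -> G x -> G y -> G (x - y).
Proof. by move=> [_ sD sZ] Gx Gy; apply: sD => //; rewrite -scaleN1r; apply: sZ. Qed.

Lemma subsp_orthocomp (G : set H) : subsp (orthocomp G).
Proof.
split=> [v _|x y hx hy v Gv|c x hx v Gv]; first exact: dot0l.
  by rewrite dotDl hx // hy // addr0.
by rewrite dotZl hx // mulr0.
Qed.

Lemma closedE_orthocomp (G : set H) : closedE (orthocomp G).
Proof. by move=> x h v Gv; apply: (@closedE_dot0 v x) => e /h[y Gy xy]; exists y => //; apply: Gy. Qed.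

Lemma parallelogram x y z :
  nrm (y - z) ^+ 2 = 2 * nrm (x - y) ^+ 2 + 2 * nrm (x - z) ^+ 2
    - 4 * nrm (x - (1 / 2) *: (y + z)) ^+ 2.
Proof.
pose a := x - y; pose b := x - z.
have -> : y - z = b - a by rewrite /a /b opprB [RHS]addrC subrKA.
have -> : x - (1 / 2) *: (y + z) = (1 / 2) *: (a + b).
  rewrite /a /b addrACA -opprD scalerBr; congr (_ - _).
  by rewrite -mulr2n -(scaler_nat 2 x) scalerA div1r mulVf ?scale1r // pnatr_eq0.
rewrite nrmZ exprMn (nrm_sqrD a b) (nrm_sqrB b a).
have -> : nrm (1 / 2 : R[i]) = 1 / 2.
  by rewrite !div1r nrmV; congr (_^-1); rewrite -[2 in LHS](rmorph_nat (real_complex R)) nrmR normr_nat.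
have -> : dot b a = cj (dot a b) by rewrite dot_cj.
have -> : complex.Re (cj (dot a b)) = complex.Re (dot a b) by case: (dot a b).
by rewrite !mulr2n -/a -/b; field.
Qed.

Lemma projection_theorem (G : set H) : subsp G -> closedE G ->
  forall x, exists y, G y /\ forall z, G z -> dot (x - y) z = 0.
Proof.
move=> sG cG x; have [G0 GD GZ] := sG.
pose D := [set nrm (x - y) ^+ 2 | y in G].
have D0 : has_inf D.
  split; first by exists (nrm (x - 0) ^+ 2); exists 0.
  by exists 0 => _ [y _ <-]; rewrite sqr_ge0.
pose d := inf D.
have dle y : G y -> d <= nrm (x - y) ^+ 2.
  by move=> Gy; apply: ge_inf; [case: D0|exists y].
have /choice[y yP] (k : nat) : exists y, G y /\ nrm (x - y) ^+ 2 < d + 1 / k.+1%:R.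
  have k0 : 0 < 1 / k.+1%:R :> R by rewrite divr_gt0.
  by have [_ [y Gy <-] h] := inf_adherent k0 D0; exists y.
have [e e0|l hl] := @complete_seq R H y.
  (* The midpoint of [y p] and [y q] lies in [G], so the parallelogram law bounds the square of
     their distance by [2/(p+1) + 2/(q+1) <= 4/(N+1)]. *)
  have [N hN] := pos_choice_nat 4 (exprn_gt0 2 e0).
  exists N => p q Np Nq; rewrite -(@ltr_pXn2r _ 2) ?nnegrE ?nrm_ge0 ?ltW // (parallelogram x).
  have := hN N (leqnn _); apply: le_lt_trans.
  have Gm : G ((1 / 2) *: (y p + y q)) by apply: GZ; apply: GD; case: (yP p); case: (yP q).
  have := dle _ Gm; have [_ h1] := yP p; have [_ h2] := yP q.
  have le1 r : (N <= r)%N -> 1 / r.+1%:R <= 1 / N.+1%:R :> R.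
    by move=> Nr; rewrite !div1r lef_pV2 ?posrE // ler_nat.
  have := le1 _ Np; have := le1 _ Nq; have -> : 4 / N.+1%:R = 4 * (1 / N.+1%:R) :> R by rewrite div1r.
  move: (1 / N.+1%:R) (1 / p.+1%:R) (1 / q.+1%:R) h1 h2; clear; move=> *; lra.
exists l.
have Gl : G l.
  by apply: cG => e /hl[N /(_ _ (leqnn _)) h]; exists (y N); [case: (yP N)|exact: ltW].
split=> // z Gz.
have d0 : 0 <= d by apply: lb_le_inf; [case: D0|move=> _ [? _ <-]; exact: sqr_ge0].
have hd : nrm (x - l) ^+ 2 <= d.
  rewrite -(sqr_sqrtr d0) ler_pXn2r ?nnegrE ?nrm_ge0 ?sqrtr_ge0 //.
  apply/ler_addgt0Pr => e e0; have e20 : 0 < e / 2 by rewrite divr_gt0.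
  have [N1 h1] := hl _ e20; have [N2 h2] := pos_choice_nat 1 (exprn_gt0 2 e20).
  pose p := maxn N1 N2; have [_ hy] := yP p.
  have h3 : nrm (x - y p) < Num.sqrt d + e / 2.
    rewrite -(@ltr_pXn2r _ 2) ?nnegrE ?nrm_ge0 ?addr_ge0 ?sqrtr_ge0 ?(ltW e20) //.
    apply: lt_trans hy _; rewrite sqrrD sqr_sqrtr // -addrA ltrD2l.
    have := h2 p (leq_maxr _ _); have : 0 <= Num.sqrt d * (e / 2) by rewrite mulr_ge0 ?sqrtr_ge0 ?ltW.
    rewrite mulr2n; move: (1 / _) (Num.sqrt d * _) ((e / 2) ^+ 2); clear; move=> *; lra.
  have := h1 p (leq_maxl _ _); have := nrm_tri x (y p) l; rewrite (nrmBC (y p) l).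
  move: h3; clear; move=> *; lra.
(* Comparing l with the competitor [l + t s z] gives [2 t |s|^2 <= t^2 |s|^2 |z|^2]; this t
   satisfies [t |z|^2 <= 1], which forces s = 0. *)
pose t := 1 / (nrm z ^+ 2 + 1); pose s := dot (x - l) z.
have z1 : 0 < nrm z ^+ 2 + 1 by rewrite ltr_wpDl ?sqr_ge0.
have t0 : 0 < t by rewrite divr_gt0.
have := dle (l + (t%:C * s) *: z) (GD _ _ Gl (GZ _ _ Gz)).
have cts : cj (t%:C * s) = t%:C * cj s by rewrite cjM cjR.
rewrite opprD addrA nrm_sqrB nrmZ dotZr -/s cts nrmM nrmR gtr0_norm //.
rewrite -(mulrA t%:C) (mulrC _ s) mulcJ -rmorphM /= => h.
have tz : t * nrm z ^+ 2 <= 1.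
  by rewrite /t mul1r mulrC ler_pdivrMr // mul1r lerDl.
have h4 : t * nrm s ^+ 2 *+ 2 <= (t * nrm s * nrm z) ^+ 2.
  by move: h hd; clear; move: (_ *+ 2) => *; lra.
have h5 : (t * nrm s * nrm z) ^+ 2 <= t * nrm s ^+ 2.
  have -> : (t * nrm s * nrm z) ^+ 2 = (t * nrm s ^+ 2) * (t * nrm z ^+ 2) by ring.
  by rewrite ler_piMr // mulr_ge0 ?sqr_ge0 ?ltW.
have h6 : t * nrm s ^+ 2 <= 0 by move: h4 h5; rewrite mulr2n; clear; move=> *; lra.
apply: nrm_le0; rewrite -/s.
move: h6; rewrite pmulr_rle0 // => h6.
have : nrm s ^+ 2 == 0 by rewrite eq_le h6 sqr_ge0.
by rewrite expf_eq0 /= => /eqP ->.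
Qed.

Lemma orthocompK (G : set H) : subsp G -> closedE G -> orthocomp (orthocomp G) `<=` G.
Proof.
move=> sG cG x hx; have [y [Gy xy]] := projection_theorem sG cG x.
have oxy : orthocomp G (x - y) by move=> z /xy.
suff /eqP : x - y = 0 by rewrite subr_eq0 => /eqP ->.
apply: dot_self_eq0; by rewrite dotBl hx // sub0r dot_cj (xy _ Gy) cj0 oppr0.
Qed.

Lemma riesz (phi : H -> R[i]) :
  (forall u v, phi (u + v) = phi u + phi v) -> (forall c u, phi (c *: u) = c * phi u) ->
  (exists2 C : R, 0 <= C & forall u, nrm (phi u) <= C * nrm u) ->
  exists w, forall u, phi u = dot u w.
Proof.
move=> pD pZ [C C0 pC].
have p0 : phi 0 = 0 by rewrite -(scale0r 0) pZ mul0r.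
have pN u : phi (- u) = - phi u by rewrite -scaleN1r pZ mulN1r.
pose G := [set u | phi u = 0].
have sG : subsp G.
  by split=> [|x y|c x]; rewrite /G /= ?pD ?pZ //; [move=> -> ->; rewrite addr0|move=> ->; rewrite mulr0].
have cG : closedE G.
  move=> x h; apply: nrm_eps0 => e e0.
  have C1 : 0 < C + 1 by rewrite ltr_wpDl.
  have [|y yG xy] := h (e / (C + 1)); first by rewrite divr_gt0.
  have -> : phi x = phi (x - y) by rewrite pD pN yG subr0.
  apply: le_trans (pC _) _; apply: le_trans (ler_wpM2l C0 xy) _.
  by rewrite mulrCA ler_piMr ?ltW // ltr_pdivrMr // mul1r ltrDl.
have [allG|] := pselect (forall u, phi u = 0).
  by exists 0 => u; rewrite allG dot0r.
move=> /existsNP[u0 /eqP pu0].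
have [y [Gy hy]] := projection_theorem sG cG u0.
pose z := u0 - y; have pz : phi z = phi u0 by rewrite pD pN Gy subr0.
have z0 : z != 0 by apply: contraNneq pu0 => z0; rewrite -pz z0 p0.
have zz : dot z z != 0 by apply: contraNneq z0 => h; apply/eqP/dot_self_eq0.
exists (cj (phi z / dot z z) *: z) => u; rewrite dotZr cjK.
have : dot (phi z *: u - phi u *: z) z = 0.
  by rewrite dot_cj hy ?cj0 //= /G /= pD pN !pZ mulrC subrr.
rewrite dotBl !dotZl => /eqP; rewrite subr_eq0 => /eqP h.
by rewrite mulrAC h mulfK.
Qed.

Lemma adjoint_ex (K : H -> H) : (forall u v, K (u + v) = K u + K v) ->
  (forall c u, K (c *: u) = c *: K u) -> bounded_op K ->
  exists K' : {linear H -> H}, forall u v, dot (K u) v = dot u (K' v).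
Proof.
move=> KD KZ [C C0 KC].
have [| | | |K' hK'] := @linear_choice R H H (fun v w => forall u, dot (K u) v = dot u w).
- move=> v; have [| | |w hw] := @riesz (fun u => dot (K u) v).
  + by move=> u u'; rewrite KD dotDl.
  + by move=> c u; rewrite KZ dotZl.
  + exists (C * nrm v); first by rewrite mulr_ge0 ?nrm_ge0.
    move=> u; apply: le_trans (CauchySchwarz _ _) _.
    by rewrite mulrAC ler_wpM2r ?nrm_ge0.
  + by exists w.
- by move=> x y y' h h'; apply: dot_eq_r => u; rewrite -h h'.
- by move=> x x' y y' h h' u; rewrite !dotDr h h'.
- by move=> c x y h u; rewrite !dotZr h.
by exists K' => u v; apply: hK'.
Qed.

Definition orthonormal (M : nat) (x : nat -> H) :=
  forall i j, (i < M)%N -> (j < M)%N -> dot (x i) (x j) = (i == j)%:R.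

Lemma bessel (M : nat) (x : nat -> H) u : orthonormal M x ->
  \sum_(i < M) nrm (dot u (x i)) ^+ 2 <= nrm u ^+ 2.
Proof.
move=> ox; pose p := \sum_(i < M) dot u (x i) *: x i.
have pp (v : H) : dot v p = \sum_(i < M) cj (dot u (x i)) * dot v (x i).
  by rewrite dot_sumr; apply: eq_bigr => i _; rewrite dotZr.
have up : dot u p = (\sum_(i < M) nrm (dot u (x i)) ^+ 2)%:C.
  by rewrite pp rmorph_sum /=; apply: eq_bigr => i _; rewrite mulrC mulcJ.
have ppE : dot p p = dot u p.
  rewrite !pp; apply: eq_bigr => i _; congr (_ * _).
  rewrite dot_suml (bigD1 i) //= dotZl ox ?eqxx ?mulr1 // big1 ?addr0 // => j ji.
  by rewrite dotZl ox // val_eqE (negPf ji) mulr0.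
have np : nrm p ^+ 2 = \sum_(i < M) nrm (dot u (x i)) ^+ 2.
  by apply: complexI; rewrite -up -ppE dot_self.
have := sqr_ge0 (nrm (u - p)); rewrite nrm_sqrB np up /= mulr2n.
by move: (\sum_(_ < _) _) (nrm u ^+ 2) => a b; lra.
Qed.
End Hilbert.

(* Linear identities in a Hilbert space are checked by [ring] after pairing
   both sides with an arbitrary vector. *)
Ltac hring := apply: dot_eq_l => ?; rewrite ?(dotDl, dotNl, dotZl, dot0l); ring.

Section PlainLinear.
Variables (R : realType) (U V : lmodType R[i]) (f : {linear U -> V}).

Lemma lD x y : f (x + y) = f x + f y.
Proof. exact: linearD. Qed.

Lemma lZ c x : f (c *: x) = c *: f x.
Proof. exact: linearZ. Qed.

Lemma lN x : f (- x) = - f x.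
Proof. exact: linearN. Qed.

Lemma lB x y : f (x - y) = f x - f y.
Proof. exact: linearB. Qed.
End PlainLinear.

Section LinearIter.
Variables (R : realType) (V : lmodType R[i]) (f : {linear V -> V}).

Lemma iter_linD l x y : iter l f (x + y) = iter l f x + iter l f y.
Proof. by elim: l => //= l ->; rewrite linearD. Qed.

Lemma iter_linZ l c x : iter l f (c *: x) = c *: iter l f x.
Proof. by elim: l => //= l ->; rewrite linearZ. Qed.

Lemma iter_lin0 l : iter l f 0 = 0.
Proof. by elim: l => //= l ->; rewrite linear0. Qed.

Lemma iter_linB l x y : iter l f (x - y) = iter l f x - iter l f y.
Proof. by rewrite iter_linD -scaleN1r iter_linZ scaleN1r. Qed.

Lemma iter_lin_sum l (I : Type) (r : seq I) (P : pred I) (F : I -> V) :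
  iter l f (\sum_(i <- r | P i) F i) = \sum_(i <- r | P i) iter l f (F i).
Proof. by elim/big_rec2: _ => [|i y x _ <-]; rewrite ?iter_lin0 ?iter_linD. Qed.

Lemma iter_commute (g : V -> V) : (forall x, f (g x) = g (f x)) ->
  forall l x, iter l f (g x) = g (iter l f x).
Proof. by move=> h; elim=> //= l ih x; rewrite ih h. Qed.
End LinearIter.

Lemma bounded_op_comp (R : realType) (U V W : normedModType R[i]) (g : V -> W) (f : U -> V) :
  bounded_op g -> bounded_op f -> bounded_op (fun x => g (f x)).
Proof.
move=> [C C0 hC] [D D0 hD]; exists (C * D); first exact: mulr_ge0.
by move=> x; apply: le_trans (hC _) _; rewrite -mulrA ler_wpM2l.
Qed.

Lemma bounded_opD (R : realType) (U V : normedModType R[i]) (g f : U -> V) :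
  bounded_op g -> bounded_op f -> bounded_op (fun x => g x + f x).
Proof.
move=> [C C0 hC] [D D0 hD]; exists (C + D); first exact: addr_ge0.
by move=> x; apply: le_trans (nrmD _ _) _; rewrite mulrDl lerD.
Qed.

Lemma bounded_opZ (R : realType) (U V : normedModType R[i]) (c : R[i]) (f : U -> V) :
  bounded_op f -> bounded_op (fun x => c *: f x).
Proof.
move=> [C C0 hC]; exists (nrm c * C); first by rewrite mulr_ge0 ?nrm_ge0.
by move=> x; rewrite nrmZ -mulrA ler_wpM2l ?nrm_ge0.
Qed.

Lemma bounded_op_id (R : realType) (U : normedModType R[i]) : bounded_op (fun x : U => x).
Proof. by exists 1 => // x; rewrite mul1r. Qed.

Lemma bounded_opB (R : realType) (U V : normedModType R[i]) (g f : U -> V) :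
  bounded_op g -> bounded_op f -> bounded_op (fun x => g x - f x).
Proof.
move=> bg /(bounded_opZ (-1)) /(bounded_opD bg) [C C0 hC]; exists C => // x.
by have := hC x; rewrite scaleN1r.
Qed.

Lemma bounded_op_iter (R : realType) (U : normedModType R[i]) (f : U -> U) l :
  bounded_op f -> bounded_op (fun x => iter l f x).
Proof.
by move=> bf; elim: l => [|l ih] /=; [exact: bounded_op_id|exact: bounded_op_comp].
Qed.

(** * Operators bounded below on closed subspaces *)

Section BoundedBelow.
Variables (R : realType) (H : hilbertType R).

Definition bounded_below (G : set H) (f : H -> H) :=
  exists2 D : R, 0 <= D & forall x, G x -> nrm x <= D * nrm (f x).

Variable L : {linear H -> H}.
Hypothesis bL : bounded_op L.

(** Preimages of an approximating sequence are Cauchy by the lower bound, and their limit stays in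
    [G]. *)
Lemma closed_image (G : set H) : subsp G -> closedE G -> bounded_below G L -> closedE (L @` G).
Proof.
move=> sG cG [D D0 hD] y hy; have [C C0 hC] := bL.
have /choice[x xP] (k : nat) : exists x, G x /\ nrm (y - L x) <= 1 / k.+1%:R.
  have k0 : 0 < 1 / k.+1%:R :> R by rewrite divr_gt0.
  by have [_ [x Gx <-] h] := hy _ k0; exists x.
have [e e0|l hl] := @complete_seq R H x.
  have [N hN] := pos_choice_nat (2 * D) e0.
  exists N => p q Np Nq; have [Gp hp] := xP p; have [Gq hq] := xP q.
  apply: le_lt_trans (hD _ (subspB sG Gp Gq)) _; apply: le_lt_trans (hN N (leqnn _)).
  suff h : nrm (L (x p - x q)) <= 2 * (1 / N.+1%:R).
    by apply: le_trans (ler_wpM2l D0 h) _; rewrite div1r mulrCA mulrA.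
  rewrite linearB /=; have := nrm_tri (L (x p)) y (L (x q)); rewrite (nrmBC _ y).
  have le1 r : (N <= r)%N -> 1 / r.+1%:R <= 1 / N.+1%:R :> R.
    by move=> Nr; rewrite !div1r lef_pV2 ?posrE // ler_nat.
  have := le1 _ Np; have := le1 _ Nq.
  move: hp hq; move: (1 / N.+1%:R) (1 / p.+1%:R) (1 / q.+1%:R); clear; move=> *; lra.
have Gl : G l.
  by apply: cG => e /hl[N /(_ _ (leqnn _)) h]; exists (x N); [case: (xP N)|exact: ltW].
exists l => //; apply/eqP; rewrite eq_sym -subr_eq0; apply/eqP; apply: nrm_eps0 => e e0.
have C1 : 0 < C + 1 by rewrite ltr_wpDl.
have e1 : 0 < e / 2 / (C + 1) by rewrite !divr_gt0.
have e2 : 0 < e / 2 by rewrite divr_gt0.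
have [N1 h1] := hl _ e1; have [N2 h2] := pos_choice_nat 1 e2.
pose p := maxn N1 N2; have [_ hp] := xP p.
have h3 := h1 p (leq_maxl _ _); have h4 := h2 p (leq_maxr _ _).
have := nrm_tri y (L (x p)) (L l); rewrite -linearB /= => h5.
have h6 : nrm (L (x p - l)) <= e / 2.
  apply: le_trans (hC _) _; rewrite nrmBC.
  apply: le_trans (ler_wpM2l C0 (ltW h3)) _.
  by rewrite mulrCA ler_piMr ?divr_ge0 ?ltW // ltr_pdivrMr // mul1r ltrDl.
by move: h5 h6 hp h4; clear; move: (1 / _) => *; lra.
Qed.

(** Removes one orthogonality condition. A vector w of [G] with [dot w f = 1] has [L w] at positive
    distance d from the closed image of the hyperplane section, by injectivity; hence the component
    of u along w is at most [nrm (L u) / d]. *)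
Lemma bounded_below_codim1 (G : set H) (f : H) : subsp G -> closedE G ->
  (forall x, G x -> L x = 0 -> x = 0) ->
  bounded_below (G `&` [set x | dot x f = 0]) L -> bounded_below G L.
Proof.
move=> sG cG iG bG; have [G0 GD GZ] := sG; set G1 := G `&` _ in bG.
have [GG1|] := pselect (forall x, G x -> dot x f = 0).
  by case: bG => D D0 hD; exists D => // x Gx; apply: hD; split=> //; apply: GG1.
move=> /existsNP[w1 /not_implyP[Gw1 /eqP w1f]].
pose w := (dot w1 f)^-1 *: w1; have Gw : G w by apply: GZ.
have wf : dot w f = 1 by rewrite dotZl mulVf.
clearbody w.
have cLG : closedE (L @` G1).
  apply: closed_image => //; first exact: subspI (subsp_dot0 f).
  exact: closedEI (@closedE_dot0 _ _ f).
have [d d0 hd] : exists2 d : R, 0 < d & forall x, G1 x -> d <= nrm (L w - L x).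
  have nLw : ~ (L @` G1) (L w).
    move=> [x [Gx /= xf] xw]; have : w - x = 0.
      by apply: iG; [exact: subspB|rewrite linearB /= xw subrr].
    by move=> /eqP; rewrite subr_eq0 => /eqP wx; move: wf; rewrite wx xf => /eqP; rewrite eq_sym oner_eq0.
  apply: contrapT => h; apply: nLw; apply: cLG => e e0.
  apply: contrapT => h'; apply: h; exists e => // x G1x; rewrite leNgt; apply/negP => xe.
  by apply: h'; exists (L x); [exists x|exact: ltW].
case: bG => D D0 hD; exists (D * (1 + nrm (L w) / d) + nrm w / d).
  by rewrite addr_ge0 ?mulr_ge0 ?addr_ge0 ?mulr_ge0 ?invr_ge0 ?nrm_ge0 // ltW.
move=> u Gu; pose c := dot u f; pose u0 := u - c *: w.
have G1u0 : G1 u0.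
  by split; [apply: subspB => //; exact: GZ|rewrite /= dotBl dotZl wf mulr1 subrr].
have cu : nrm c <= nrm (L u) / d.
  rewrite ler_pdivlMr //; have [->|c0] := eqVneq c 0; first by rewrite nrm0 mul0r nrm_ge0.
  have -> : L u = c *: (L w - L ((- c^-1) *: u0)).
    by rewrite linearZ /= scalerBr scalerA mulrN mulfV // scaleN1r opprK -linearZ -linearD /= addrC subrK.
  rewrite nrmZ ler_wpM2l ?nrm_ge0 // hd //.
  by case: (subspI sG (subsp_dot0 f)) => _ _; apply.
have h0 : nrm u0 <= D * (nrm (L u) * (1 + nrm (L w) / d)).
  apply: le_trans (hD _ G1u0) _; rewrite ler_wpM2l // linearB linearZ /=.
  apply: le_trans (nrmB _ _) _; rewrite nrmZ mulrDr mulr1 lerD2l.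
  by rewrite mulrCA [X in X <= _]mulrC ler_wpM2l ?nrm_ge0.
have -> : u = u0 + c *: w by rewrite subrK.
apply: le_trans (nrmD _ _) _; rewrite nrmZ.
have -> : u0 + c *: w = u by rewrite subrK.
rewrite mulrDl lerD //.
  by rewrite -mulrA [_ * nrm (L u)]mulrC.
by rewrite mulrAC -mulrA [nrm w * _]mulrC ler_wpM2r ?nrm_ge0.
Qed.

End BoundedBelow.

(** * Riesz-Schauder theory *)

Section RieszSchauder.
Variables (R : realType) (H : hilbertType R).

(** Compactness as approximation by finite rank: up to e, [K u] is recovered from its coefficients
    against a fixed finite list. Truncated Fourier series provide exactly this form. *)
Definition compact_op (K : H -> H) := forall e : R, 0 < e -> exists s : seq H,
  forall u, nrm (K u - \sum_(x <- s) dot (K u) x *: x) <= e * nrm u.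

Variables (K K' L : {linear H -> H}) (mu : R[i]).
Hypotheses (bK : bounded_op K) (cK : compact_op K)
  (adjK : forall u v, dot (K u) v = dot u (K' v))
  (mu0 : mu != 0) (LE : forall u, L u = K u - mu *: u).

Lemma L_bounded : bounded_op L.
Proof.
have [C C0 hC] : bounded_op (fun u => K u - mu *: u).
  by apply: bounded_opB => //; apply/bounded_opZ/bounded_op_id.
by exists C => // u; rewrite LE.
Qed.

(* By Bessel's inequality a compact operator can have only boundedly many
   diagonal entries equal to mu with respect to an orthonormal family. *)
Lemma compact_count : exists C : nat, forall M (x : nat -> H), orthonormal M x ->
  (forall i, (i < M)%N -> dot (K (x i)) (x i) = mu) -> (M <= C)%N.
Proof.
have m0 := nrm_gt0 mu0; have e0 : 0 < nrm mu / 2 by rewrite divr_gt0.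
have [s hs] := cK e0.
pose B := \sum_(y <- s) (nrm (K' y) ^+ 2 + nrm y ^+ 2).
exists (Num.truncn (B / (nrm mu / 2))) => M x ox hx.
have nx i : (i < M)%N -> nrm (x i) = 1.
  move=> iM; have := ox i i iM iM; rewrite eqxx dot_self => /complexI/eqP.
  by rewrite sqrp_eq1 ?nrm_ge0 // => /eqP.
(* Replacing [K (x i)] by its finite-rank approximation costs at most half of |mu|; what is left is
   a sum of products, each bounded by two squares that Bessel's inequality sums over i. *)
have h1 (i : 'I_M) : nrm mu / 2 <= \sum_(y <- s) (nrm (dot (K' y) (x i)) ^+ 2 + nrm (dot y (x i)) ^+ 2).
  have iM := ltn_ord i; pose F := \sum_(y <- s) dot (K (x i)) y *: y.
  have h2 : nrm mu <= nrm mu / 2 + nrm (dot F (x i)).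
    rewrite -{1}(hx i iM); have -> : K (x i) = (K (x i) - F) + F by rewrite subrK.
    rewrite dotDl; apply: le_trans (nrmD _ _) _; rewrite lerD2r.
    apply: le_trans (CauchySchwarz _ _) _; rewrite nx // mulr1.
    by have := hs (x i); rewrite nx // mulr1.
  have : nrm mu / 2 <= nrm (dot F (x i)) by move: h2; clear; move: (nrm _) (nrm _) => *; lra.
  move=> /le_trans; apply; rewrite dot_suml; apply: le_trans (nrm_sum _ _ _) _.
  apply: ler_sum => y _; rewrite dotZl nrmM adjK dot_cj nrmJ.
  move: (nrm_ge0 (dot (K' y) (x i))) (nrm_ge0 (dot y (x i))).
  move: (nrm _) (nrm _) => a b a0 b0; have := sqr_ge0 (a - b); rewrite sqrrB.
  have := mulr_ge0 a0 b0; rewrite mulr2n; lra.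
have h2 : M%:R * (nrm mu / 2) <= B.
  rewrite mulr_natl -[X in _ *+ X]card_ord -sumr_const.
  apply: le_trans (ler_sum _ (fun i _ => h1 i)) _; rewrite exchange_big /=.
  by apply: ler_sum => y _; rewrite big_split /= lerD // bessel.
have B0 : 0 <= B / (nrm mu / 2).
  by rewrite divr_ge0 ?(ltW e0) // sumr_ge0 // => y _; rewrite addr_ge0 ?sqr_ge0.
by rewrite truncn_ge_nat // ler_pdivlMr.
Qed.

(** Schur form: L is strictly triangular in an orthonormal family, so every diagonal entry of
    [K = L + mu] is mu, and [compact_count] bounds the length of the family. *)
Let triangular M (x : nat -> H) := orthonormal M x /\
  forall i, (i < M)%N -> exists c : nat -> R[i], L (x i) = \sum_(j < i) c j *: x j.

Let spanx M (x : nat -> H) := [set u : H | exists c : nat -> R[i], u = \sum_(j < M) c j *: x j].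

Lemma spanx_subsp M x : subsp (spanx M x).
Proof.
split=> [|u v [c ->] [d ->]|a u [c ->]].
- by exists (fun=> 0); rewrite big1 // => i _; rewrite scale0r.
- by exists (fun j => c j + d j); rewrite -big_split; apply: eq_bigr => i _; rewrite scalerDl.
by exists (fun j => a * c j); rewrite scaler_sumr; apply: eq_bigr => i _; rewrite scalerA.
Qed.

Lemma spanx_mem M x i : (i < M)%N -> spanx M x (x i).
Proof.
move=> iM; exists (fun j => (j == i)%:R); rewrite (bigD1 (Ordinal iM)) //= eqxx scale1r.
by rewrite big1 ?addr0 // => j ji; rewrite (_ : (_ == i) = false) ?scale0r //; apply: negPf.
Qed.

Lemma spanx_sum M x i (c : nat -> R[i]) : (i <= M)%N -> spanx M x (\sum_(j < i) c j *: x j).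
Proof.
case: (spanx_subsp M x) => s0 sD sZ; elim: i => [|i ih] iM; first by rewrite big_ord0.
by rewrite big_ord_recr /=; apply: sD; [apply: ih; exact: ltnW|apply/sZ/spanx_mem].
Qed.

Lemma orthonormal_coef M (x : nat -> H) (c : nat -> R[i]) i : orthonormal M x -> (i < M)%N ->
  dot (\sum_(j < M) c j *: x j) (x i) = c i.
Proof.
move=> ox iM; rewrite dot_suml (bigD1 (Ordinal iM)) //= dotZl ox // eqxx mulr1.
by rewrite big1 ?addr0 // => j ji; rewrite dotZl ox // (_ : (_ == i) = false) ?mulr0 //; apply: negPf.
Qed.

(** Gram-Schmidt: the span is stable under L, so subtracting from w its projection keeps the image
    under L in the span. *)
Lemma triangular_extend M x w : triangular M x -> ~ spanx M x w -> spanx M x (L w) ->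
  exists x', triangular M.+1 x'.
Proof.
move=> [ox tx] nw Lw; have sp := spanx_subsp M x; have [s0 sD sZ] := sp.
pose p := \sum_(j < M) dot w (x j) *: x j.
have sp_p : spanx M x p by exists (fun j => dot w (x j)).
pose w' := w - p.
have w'0 : w' != 0 by apply: contra_not_neq nw => /eqP; rewrite subr_eq0 => /eqP ->.
have wx i : (i < M)%N -> dot w' (x i) = 0.
  by move=> iM; rewrite dotBl (@orthonormal_coef M x (fun j => dot w (x j))) // subrr.
pose z := ((nrm w')^-1)%:C *: w'.
have zx i : (i < M)%N -> dot z (x i) = 0 by move=> iM; rewrite dotZl wx // mulr0.
have zz : dot z z = 1.
  rewrite dotZl dotZr cjR dot_self -!rmorphM /= mulrA -expr2 -exprMn mulVf ?expr1n //.
  by rewrite gt_eqF ?nrm_gt0.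
pose x' i := if i == M then z else x i.
have x'E i : (i < M)%N -> x' i = x i by move=> iM; rewrite /x' ltn_eqF.
have x'M : x' M = z by rewrite /x' eqxx.
exists x'; split.
  have caseM i : (i < M.+1)%N -> i = M \/ (i < M)%N.
    by rewrite ltnS leq_eqVlt => /predU1P.
  move=> i j /caseM[->|iM] /caseM[->|jM].
  - by rewrite eqxx x'M zz.
  - by rewrite x'M (x'E _ jM) (zx _ jM) (gtn_eqF jM).
  - by rewrite x'M (x'E _ iM) dot_cj (zx _ iM) cj0 (ltn_eqF iM).
  - by rewrite (x'E _ iM) (x'E _ jM) (ox _ _ iM jM).
have x'S (c : nat -> R[i]) i : (i <= M)%N -> \sum_(j < i) c j *: x' j = \sum_(j < i) c j *: x j.
  by move=> iM; apply: eq_bigr => j _; rewrite x'E // (leq_trans (ltn_ord j)).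
move=> i; rewrite ltnS leq_eqVlt => /predU1P[->|iM]; last first.
  by have [c hc] := tx i iM; exists c; rewrite x'E // hc x'S // ltnW.
have [c hc] : spanx M x (L z).
  rewrite linearZ; apply: (sZ); rewrite linearB; apply: subspB => //.
  rewrite linear_sum /=; elim/big_ind: _ => // j _; rewrite linearZ; apply: sZ.
  by have [c ->] := tx j (ltn_ord j); apply: spanx_sum; apply: ltnW.
by exists c; rewrite x'M x'S.
Qed.

(** Take a triangular family of maximal length M. By induction on l, [L u] lies in its span, and if
    u did not, u would extend the family. Strict triangularity makes [L^M] vanish on the span. *)
Lemma gen_kernel_finite : exists (M : nat) (b : 'I_M -> H),
  [/\ forall u, (exists l, iter l L u = 0) <-> exists c : 'I_M -> R[i], u = \sum_(i < M) c i *: b i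
    & forall u l, iter l L u = 0 -> iter M L u = 0].
Proof.
have [C hC] := compact_count.
pose P M := `[< exists x, triangular M x >].
have exP : exists M, P M by exists 0%N; apply/asboolP; exists (fun=> 0); split.
have bP M : P M -> (M <= C)%N.
  move=> /asboolP[x [ox tx]]; apply: (hC M x ox) => i iM.
  have -> : K (x i) = L (x i) + mu *: x i by rewrite LE subrK.
  have [c ->] := tx i iM; rewrite dotDl dotZl ox // eqxx mulr1 dot_suml big1 ?add0r // => j _.
  by rewrite dotZl ox ?(ltn_trans (ltn_ord j)) // ltn_eqF // mulr0.
case: (ex_maxnP exP bP) => M /asboolP[x [ox tx]] maxM.
have ker_span l : forall u, iter l L u = 0 -> spanx M x u.
  elim: l => [u /= ->|l ih u]; first by case: (spanx_subsp M x).
  rewrite iterSr => /ih hu; apply: contrapT => nu.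
  have [x' tx'] := triangular_extend (conj ox tx) nu hu.
  by have /maxM : P M.+1; [apply/asboolP; exists x'|rewrite ltnn].
have Lx i : (i < M)%N -> iter i.+1 L (x i) = 0.
  elim/ltn_ind: i => i ih iM; rewrite iterSr; have [c ->] := tx i iM.
  rewrite iter_lin_sum big1 // => j _; rewrite iter_linZ.
  have -> : iter i L (x j) = iter (i - j.+1) L (iter j.+1 L (x j)) by rewrite -iterD subnK.
  have hj : iter j.+1 L (x j) = 0 by apply: ih => //; exact: ltn_trans iM.
  by rewrite hj iter_lin0 scaler0.
have span_ker u : spanx M x u -> iter M L u = 0.
  move=> [c ->]; rewrite iter_lin_sum big1 // => j _; rewrite iter_linZ.
  have -> : iter M L (x j) = iter (M - j.+1) L (iter j.+1 L (x j)) by rewrite -iterD subnK.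
  by rewrite Lx // iter_lin0 scaler0.
exists M, (fun i => x i); split=> [u|u l /ker_span/span_ker//]; split=> [[l /ker_span[c ->]]|[c ->]].
  by exists (fun i => c i).
exists M; apply: span_ker; elim/big_ind: _; [by case: (spanx_subsp M x)|by case: (spanx_subsp M x)|].
by move=> i _; case: (spanx_subsp M x) => _ _; apply; apply: spanx_mem.
Qed.

(** Orthogonality to the finitely many [K' y] makes [K x] at most half as large as [mu x], so L is
    bounded below there; the conditions are then dropped one at a time by [bounded_below_codim1]. *)
Lemma injective_bounded_below (G : set H) : subsp G -> closedE G ->
  (forall x, G x -> L x = 0 -> x = 0) -> bounded_below G L.
Proof.
move=> sG cG iG; have m0 := nrm_gt0 mu0.
have e0 : 0 < nrm mu / 2 by rewrite divr_gt0.
have [s hs] := cK e0.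
have base : bounded_below (G `&` [set x | forall y, y \in s -> dot x (K' y) = 0]) L.
  exists (2 / nrm mu); first by rewrite divr_ge0 ?nrm_ge0.
  move=> x [Gx /= hx].
  have : nrm (K x) <= nrm mu / 2 * nrm x.
    have := hs x; rewrite big_seq big1 ?subr0 // => y ys.
    by rewrite adjK hx // scale0r.
  have := nrm_lebD (mu *: x) (K x); rewrite (nrmBC (mu *: x)) -LE nrmZ.
  rewrite mulrAC => h1 h2; rewrite mulrAC ler_pdivlMr // mulrC.
  by move: h1 h2; move: (nrm mu * nrm x) => *; lra.
elim: s {hs} G sG cG iG base => [|y s ih] G sG cG iG base.
  by case: base => D D0 hD; exists D => // x Gx; apply: hD.
apply: (@bounded_below_codim1 _ _ _ L_bounded G (K' y)) => //; apply: ih.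
- exact: subspI (subsp_dot0 _).
- exact: closedEI (@closedE_dot0 _ _ _).
- by move=> x [Gx _]; apply: iG.
case: base => D D0 hD; exists D => // x [[Gx /= xy] hx]; apply: hD; split=> //= z.
by rewrite in_cons => /predU1P[->|/hx].
Qed.

(** The kernel of L in [G] is removed by passing to its orthogonal complement in [G], where L is
    injective with the same image. *)
Lemma closed_image_subsp (G : set H) : subsp G -> closedE G -> closedE (L @` G).
Proof.
move=> sG cG; pose N := G `&` [set x | L x = 0].
have sL : subsp [set x | L x = 0].
  by split=> /= [|x y hx hy|c x hx]; rewrite ?linear0 ?linearD ?linearZ /= ?hx ?hy ?addr0 ?scaler0.
have cL : closedE [set x | L x = 0].
  have [C C0 hC] := L_bounded; move=> x h /=; apply: nrm_eps0 => e e0.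
  have C1 : 0 < C + 1 by rewrite ltr_wpDl.
  have [|y /= yG xy] := h (e / (C + 1)); first by rewrite divr_gt0.
  have -> : L x = L (x - y) by rewrite linearB /= yG subr0.
  apply: le_trans (hC _) _; apply: le_trans (ler_wpM2l C0 xy) _.
  by rewrite mulrCA ler_piMr ?ltW // ltr_pdivrMr // mul1r ltrDl.
have sN : subsp N := subspI sG sL; have cN : closedE N := closedEI cG cL.
pose G1 := G `&` orthocomp N.
have -> : L @` G = L @` G1.
  rewrite eqEsubset; split=> _ [x Gx <-]; last by case: Gx => Gx _; exists x.
  have [y [[Gy /= Ly] hy]] := projection_theorem sN cN x.
  by exists (x - y); [split; [exact: subspB|]|rewrite linearB /= Ly subr0].
have sG1 : subsp G1 := subspI sG (subsp_orthocomp N).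
have cG1 : closedE G1 := closedEI cG (@closedE_orthocomp _ _ N).
apply: (closed_image L_bounded) => //; apply: injective_bounded_below => //.
by move=> x [Gx Nx] Lx; apply: dot_self_eq0; apply: Nx.
Qed.

Let ran l := range (iter l L).

Lemma ranS l : ran l.+1 = L @` ran l.
Proof.
rewrite eqEsubset; split=> [_ [x _ <-]|_ [_ [x _ <-] <-]]; last by exists x.
by exists (iter l L x) => //; exists x.
Qed.

Lemma ran_subsp l : subsp (ran l).
Proof.
split=> [|_ _ [x _ <-] [y _ <-]|c _ [x _ <-]].
- by exists 0 => //; rewrite iter_lin0.
- by exists (x + y) => //; rewrite iter_linD.
by exists (c *: x) => //; rewrite iter_linZ.
Qed.

Lemma ran_closed l : closedE (ran l).
Proof.
elim: l => [x _|l ih]; first by exists x.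
by rewrite ranS; apply: closed_image_subsp => //; apply: ran_subsp.
Qed.

Lemma ran_decr k l : (k <= l)%N -> ran l `<=` ran k.
Proof. by move=> kl _ [x _ <-]; exists (iter (l - k) L x) => //; rewrite -iterD subnKC. Qed.

(** If the ranges decreased strictly for ever, unit vectors of [ran l] orthogonal to [ran l.+1]
    would be orthonormal with diagonal entries mu, against [compact_count]. *)
Lemma ran_stable : exists p, forall l, ran p `<=` ran (p + l).
Proof.
have [C hC] := compact_count.
have [p hp] : exists p, ran p `<=` ran p.+1.
  apply: contrapT => /forallNP h.
  have /choice[x xP] (l : nat) : exists x, [/\ ran l x, dot x x = 1 & forall z, ran l.+1 z -> dot x z = 0].
    have /existsNP[u /not_implyP[ul nu]] := h l.
    have [y [yl hy]] := projection_theorem (ran_subsp l.+1) (@ran_closed l.+1) u.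
    pose w := u - y.
    have w0 : w != 0 by apply: contra_not_neq nu => /eqP; rewrite subr_eq0 => /eqP ->.
    exists (((nrm w)^-1)%:C *: w); split.
    - case: (ran_subsp l) => _ _; apply; apply: subspB => //; first exact: ran_subsp.
      exact: ran_decr yl.
    - rewrite dotZl dotZr cjR dot_self -!rmorphM /= mulrA -expr2 -exprMn mulVf ?expr1n //.
      by rewrite gt_eqF ?nrm_gt0.
    - by move=> z /hy hz; rewrite dotZl hz mulr0.
  suff : (C.+1 <= C)%N by rewrite ltnn.
  have oij i j : (i < j)%N -> dot (x i) (x j) = 0.
    move=> ij; have [_ _] := xP i; apply; have [xj _ _] := xP j; exact: ran_decr xj.
  apply: (hC _ x) => [i j _ _|i _].
    have [ij|ji|->] := ltngtP i j; last by case: (xP j).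
      exact: oij.
    by rewrite dot_cj oij // cj0.
  have -> : K (x i) = L (x i) + mu *: x i by rewrite LE subrK.
  have [xi x1 hx] := xP i; rewrite dotDl dotZl x1 mulr1 dot_cj hx ?cj0 ?add0r //.
  by rewrite ranS; exists (x i).
exists p; elim=> [|l ih]; first by rewrite addn0.
apply: (subset_trans ih); elim: l {ih} => [|l ih]; first by rewrite addn0 addn1.
by rewrite addnS (addnS _ l.+1) !ranS; apply: image_subset.
Qed.

(** [Pi] projects onto the kernel of [L^p] along the range of [L^p], for p past the stabilization of
    both; [J] inverts L on that range and vanishes on the kernel. *)
Lemma riesz_decomposition : exists (p : nat) (Pi J : {linear H -> H}), (0 < p)%N /\
  [/\ bounded_op Pi, bounded_op J,
      (forall u, iter p L (Pi u) = 0), (forall u l, iter l L u = 0 -> Pi u = u)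
    & [/\ forall u, L (J u) = u - Pi u, forall u, J (L u) = u - Pi u,
      forall u, K (Pi u) = Pi (K u), forall u, Pi (J u) = 0 & forall u, J (Pi u) = 0]].
Proof.
have [p1 hp1] := ran_stable; have [M [b [_ hM]]] := gen_kernel_finite.
(* The successor makes p positive, as required of the order nu and by the leading term of the
   singular part. *)
pose p := (maxn p1 M).+1.
have ker_p u l : iter l L u = 0 -> iter p L u = 0.
  move=> /hM h; have -> : iter p L u = iter (p - M) L (iter M L u).
    by rewrite -iterD subnK // ltnW // ltnS leq_maxr.
  by rewrite h iter_lin0.
have ran_p l : ran p `<=` ran (p + l).
  have pE : (p = p1 + (p - p1))%N by rewrite subnKC // ltnW // ltnS leq_maxl.
  have s1 : ran p `<=` ran p1 by rewrite pE; apply: ran_decr; exact: leq_addr.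
  by apply: (subset_trans s1); rewrite pE -addnA; apply: hp1.
have inj_ran x : ran p x -> L x = 0 -> x = 0.
  move=> [y _ <-] hL; apply: (ker_p y p.+1); exact: hL.
have inj_ran' l x : ran p x -> iter l L x = 0 -> x = 0.
  by move=> [y _ <-] hL; apply: (ker_p y (l + p)); rewrite iterD.
have ran_L x : ran p x -> ran p (L x).
  by move=> [y _ <-]; exists (L y) => //; rewrite -iterSr.
have dec u : exists v, iter p L v = 0 /\ ran p (u - v).
  have [|y _ hy] := ran_p p (iter p L u); first by exists u.
  exists (u - iter p L y); split; last by rewrite subKr; exists y.
  by rewrite iter_linB -iterD hy subrr.
have [sp0 spD spZ] := ran_subsp p.
have [|u v v' [v0 hv] [v'0 hv']|u u' v v' [v0 hv] [v'0 hv']|c u v [v0 hv]|Pi PiP] :=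
  @linear_choice R H H (fun u v => iter p L v = 0 /\ ran p (u - v)).
- exact: dec.
- apply/eqP; rewrite -subr_eq0; apply/eqP; apply: (inj_ran' p); last by rewrite iter_linB v0 v'0 subrr.
  by have := subspB (ran_subsp p) hv' hv; rewrite opprB addrC subrKA.
- by split; [rewrite iter_linD v0 v'0 addr0|rewrite opprD addrACA; exact: spD].
- by split; [rewrite iter_linZ v0 scaler0|rewrite -scalerBr; exact: spZ].
have Pi_uniq u v : iter p L v = 0 -> ran p (u - v) -> Pi u = v.
  move=> v0 hv; have [w0 hw] := PiP u.
  apply/eqP; rewrite -subr_eq0; apply/eqP; apply: (inj_ran' p); last by rewrite iter_linB v0 w0 subrr.
  by have := subspB (ran_subsp p) hv hw; rewrite opprB addrC subrKA.
have Pi_ran u : ran p u -> Pi u = 0 by move=> hu; apply: Pi_uniq; rewrite ?iter_lin0 ?subr0.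
have Pi_ker u l : iter l L u = 0 -> Pi u = u.
  by move=> /ker_p hu; apply: Pi_uniq; rewrite ?subrr.
have surj u : ran p u -> exists v, ran p v /\ L v = u.
  move=> /(ran_p 1%N); rewrite addn1 ranS => -[v hv <-]; by exists v.
have [|u v v' [hv Lv] [hv' Lv']|u u' v v' [hv Lv] [hv' Lv']|c u v [hv Lv]|J JP] :=
  @linear_choice R H H (fun u v => ran p v /\ L v = u - Pi u).
- by move=> u; apply: surj; case: (PiP u).
- apply/eqP; rewrite -subr_eq0; apply/eqP; apply: inj_ran; first exact: subspB (ran_subsp p) _ _.
  by rewrite linearB /= Lv Lv' subrr.
- by split; [exact: spD|rewrite linearD /= Lv Lv' linearD opprD addrACA].
- by split; [exact: spZ|rewrite linearZ /= Lv linearZ -scalerBr].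
have LPi u : L (Pi u) = Pi (L u).
  symmetry; apply: Pi_uniq; first by rewrite -iterSr iterS; case: (PiP u) => -> _; rewrite linear0.
  by rewrite -linearB; apply: ran_L; case: (PiP u).
exists p, Pi, J; split=> //.
have [D D0 hD] := injective_bounded_below (ran_subsp p) (@ran_closed p) inj_ran.
have [C C0 hC] := L_bounded.
have bPi : bounded_op Pi.
  (* [Pi] is bounded because L is bounded below on the range: [u - Pi u] is controlled by
     [L^p (u - Pi u) = L^p u]. *)
  have hDl l x : ran p x -> nrm x <= D ^+ l * nrm (iter l L x).
    move=> hx; elim: l => [|l ih]; first by rewrite expr0 mul1r.
    apply: le_trans ih _; rewrite exprSr -mulrA ler_wpM2l ?exprn_ge0 //=.
    apply: hD; elim: l => //= l ih; exact: ran_L.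
  have [Cp Cp0 hCp] := bounded_op_iter p L_bounded.
  have [E E0 hE] : bounded_op (fun u => u - (u - Pi u)).
    apply: bounded_opB; first exact: bounded_op_id.
    exists (D ^+ p * Cp); first by rewrite mulr_ge0 ?exprn_ge0.
    move=> u; have [v0 hv] := PiP u; apply: le_trans (hDl p _ hv) _.
    by rewrite iter_linB v0 subr0 -mulrA ler_wpM2l ?exprn_ge0.
  by exists E => // u; have := hE u; rewrite subKr.
split=> //.
- have [E E0 hE] : bounded_op (fun u => u - Pi u) by apply: bounded_opB => //; exact: bounded_op_id.
  exists (D * E); first exact: mulr_ge0.
  move=> u; have [v0 hv] := JP u; apply: le_trans (hD _ v0) _.
  by rewrite hv -mulrA ler_wpM2l.
- by move=> u; case: (PiP u).
split=> [u|u|u|u|u].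
- by case: (JP u).
- have [h1 h2] := JP (L u); apply/eqP; rewrite -subr_eq0; apply/eqP; apply: inj_ran.
    by apply: (subspB (ran_subsp p) h1); case: (PiP u).
  by rewrite linearB /= h2 -LPi -linearB subrr.
- have KE v : K v = L v + mu *: v by rewrite LE subrK.
  by rewrite !KE LPi linearD linearZ.
- by apply: Pi_ran; case: (JP u).
- have [h1 h2] := JP (Pi u); apply: inj_ran => //; rewrite h2.
  by rewrite (Pi_ker (Pi u) p) ?subrr //; case: (PiP u).
Qed.

End RieszSchauder.

(** * Contour integrals and spectral radius *)

Section RealLipschitz.
Variable R : realType.

Lemma derive_lipschitz (f df : R -> R) (a b M : R) :
  (forall x, Num.min a b <= x <= Num.max a b -> is_derive x 1 f (df x) /\ `|df x| <= M) ->
  `|f b - f a| <= M * `|b - a|.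
Proof.
wlog ab : a b / a <= b => [hw h|].
  have [ab|/ltW ba] := leP a b; first exact: hw.
  by rewrite distrC (distrC b); apply: hw => // x; rewrite minC maxC; apply: h.
rewrite (min_idPl ab) (max_idPr ab) => h.
have [x xab|x|c cab ->] := @MVT_segment R f df a b ab.
- by case: (h x) => //; rewrite !ltW ?(itvP xab).
- apply: continuous_in_subspaceT => {}x; rewrite inE /= in_itv /= => /h[dx _].
  by apply: differentiable_continuous; apply/derivable1_diffP; case: dx.
by rewrite normrM ler_wpM2r //; have [] := h c; rewrite ?(itvP cab).
Qed.

Lemma sin_lipschitz (x : R) : `|sin x| <= `|x|.
Proof.
have := @derive_lipschitz (@sin R) (@cos R) 0 x 1; rewrite sin0 !subr0 mul1r; apply.
by move=> y _; split; [exact: is_derive_sin|exact: cos_max].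
Qed.

Lemma cos_lipschitz (x : R) : `|cos x - 1| <= `|x|.
Proof.
have := @derive_lipschitz (@cos R) (fun y => - sin y) 0 x 1; rewrite cos0 !subr0 mul1r; apply.
by move=> y _; split; [exact: is_derive_cos|rewrite normrN; exact: sin_max].
Qed.

Lemma between0 (x y : R) : Num.min 0 x <= y <= Num.max 0 x -> `|y| <= `|x|.
Proof.
have [x0|/ltW x0] := leP 0 x; move=> /andP[y0 yx]; first by rewrite !ger0_norm.
by rewrite !ler0_norm // lerN2.
Qed.

Lemma cos_quadratic (x : R) : `|cos x - 1| <= x ^+ 2.
Proof.
have := @derive_lipschitz (@cos R) (fun y => - sin y) 0 x `|x|; rewrite cos0 !subr0.
rewrite -expr2 real_normK ?num_real //; apply=> y /between0 yx; split; first exact: is_derive_cos.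
by rewrite normrN; apply: le_trans (sin_lipschitz _) yx.
Qed.

Lemma sin_quadratic (x : R) : `|sin x - x| <= x ^+ 2.
Proof.
have := @derive_lipschitz (fun y => sin y - y) (fun y => cos y - 1) 0 x `|x|; rewrite sin0 !subr0.
rewrite -expr2 real_normK ?num_real //; apply=> y /between0 yx; split; last first.
  exact: le_trans (cos_lipschitz _) yx.
by apply: is_deriveB.
Qed.

End RealLipschitz.

Section CircleSums.
Variable R : realType.

Definition eit (t : R) : R[i] := cexp (0 +i* t).

Lemma eitE t : eit t = cos t +i* sin t.
Proof. by rewrite /eit /cexp /= expR0 mul1r. Qed.

Lemma eitD s t : eit (s + t) = eit s * eit t.
Proof. by rewrite !eitE cosD sinD; simpc; congr (_ +i* _); rewrite addrC. Qed.

Lemma eit0 : eit 0 = 1.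
Proof. by rewrite eitE cos0 sin0. Qed.

Lemma nrm_eit t : nrm (eit t) = 1.
Proof.
apply/eqP; rewrite -sqrp_eq1 ?nrm_ge0 // nrmC_sqr eitE /=; apply/eqP; exact: cos2Dsin2.
Qed.

Lemma eit_neq0 t : eit t != 0.
Proof. by apply: contra_eq_neq (nrm_eit t) => ->; rewrite nrm0 eq_sym oner_neq0. Qed.

Lemma eitN t : eit (- t) = (eit t)^-1.
Proof. by apply: (mulfI (eit_neq0 t)); rewrite -eitD subrr eit0 mulfV ?eit_neq0. Qed.

Lemma eitX t k : eit t ^+ k = eit (k%:R * t).
Proof.
elim: k => [|k ih]; first by rewrite mul0r eit0.
by rewrite exprS ih -eitD -[in LHS](mul1r t) mulrA mulr1 -mulrDl -natr1 addrC.
Qed.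

Lemma eit_2pi : eit (2 * pi) = 1.
Proof. by rewrite mulr_natl eitE cos2pi sin2pi. Qed.

Lemma eit_pi : eit pi = -1.
Proof. by rewrite eitE cospi sinpi; apply/eqP; rewrite eq_complex /= oppr0 !eqxx. Qed.

Lemma eit_taylor (x : R) : nrm (eit x - 1 - x *i) <= 2 * x ^+ 2.
Proof.
rewrite eitE; apply: le_trans (nrm_le_ReIm _) _ => /=.
by rewrite !subr0 mulr_natl mulr2n lerD ?cos_quadratic ?sin_quadratic.
Qed.

Variables (N : nat) (t s : nat -> R) (d : R).
Hypotheses (t0 : t 0%N = 0) (tN : t N = 2 * pi).
Hypothesis ts : forall j, (j < N)%N -> [/\ t j <= s j, s j <= t j.+1 & t j.+1 - t j < d].

Lemma arc_sum : \sum_(j < N) (t j.+1 - t j) = 2 * pi.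
Proof. by rewrite -(big_mkord xpredT (fun j => t j.+1 - t j)) telescope_sumr // t0 tN subr0. Qed.

Lemma arc_ge0 j : (j < N)%N -> 0 <= t j.+1 - t j.
Proof. by move=> /ts[h1 h2 _]; rewrite subr_ge0 (le_trans h1). Qed.

Lemma arc_eit (B : R) j : (j < N)%N ->
  nrm (eit (B * (t j.+1 - s j)) - eit (B * (t j - s j)) - (B * (t j.+1 - t j)) *i)
  <= 2 * B ^+ 2 * d * (t j.+1 - t j).
Proof.
move=> jN; have [h1 h2 h3] := ts jN.
pose p := t j - s j; pose q := t j.+1 - s j.
have -> : eit (B * q) - eit (B * p) - (B * (t j.+1 - t j)) *i =
   (eit (B * q) - 1 - (B * q) *i) - (eit (B * p) - 1 - (B * p) *i).
  have -> : (B * (t j.+1 - t j)) *i = (B * q) *i - (B * p) *i :> R[i].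
    by apply/eqP; rewrite eq_complex /= subrr eqxx /= -mulrBr /q /p; apply/eqP; ring.
  by ring.
apply: le_trans (nrmB _ _) _; apply: le_trans (lerD (eit_taylor _) (eit_taylor _)) _.
have -> : 2 * (B * q) ^+ 2 + 2 * (B * p) ^+ 2 = 2 * B ^+ 2 * (q ^+ 2 + p ^+ 2) by ring.
rewrite -(mulrA (2 * B ^+ 2) d) ler_wpM2l ?(mulr_ge0 (ler0n _ 2) (sqr_ge0 B)) //.
have p0 : p <= 0 by rewrite subr_le0.
have q0 : 0 <= q by rewrite subr_ge0.
have -> : t j.+1 - t j = q - p by rewrite /q /p; ring.
have qd : q - p < d by have -> : q - p = t j.+1 - t j by rewrite /q /p; ring.
by clearbody p q; nra.
Qed.

(** These are the Riemann sums of [zeta^(B-1) d zeta] on the unit circle. For B nonzero each term is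
    close to [1/B] times an increment of [eit (B t)], and the increments telescope to 0; for B = 0
    the arcs add up to 2 pi. *)
Lemma riemann_eit (B : R) : eit (B * (2 * pi)) = 1 ->
  nrm (\sum_(j < N) (eit (t j.+1) - eit (t j)) * eit ((B - 1) * s j)
       - (if B == 0 then 2 * pi *i else 0)) <= (2 + 2 * `|B|) * d * (2 * pi).
Proof.
move=> eB.
have [N0|N0] := posnP N.
  have : 0 < 2 * pi :> R by rewrite mulr_gt0 ?pi_gt0.
  by rewrite -tN N0 t0 ltxx.
have d0 : 0 <= d by apply: ltW; have [h1 h2] := ts N0; apply: le_lt_trans; exact: arc_ge0.
pose A j := (eit (t j.+1) - eit (t j)) * eit ((B - 1) * s j).
have AE j : A j = eit (B * s j) * (eit (1 * (t j.+1 - s j)) - eit (1 * (t j - s j))).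
  rewrite /A; have -> : (B - 1) * s j = B * s j - s j by ring.
  rewrite !mul1r !eitD !eitN; field; exact: eit_neq0.
pose C j := eit (B * s j) * (t j.+1 - t j)%:C * 'i.
have iE (x : R) : x *i = x%:C * 'i :> R[i] by simpc.
have AC (j : 'I_N) : nrm (A j - C j) <= 2 * d * (t j.+1 - t j).
  rewrite AE /C -mulrA -mulrBr nrmM nrm_eit mul1r -iE.
  by have := arc_eit 1 (ltn_ord j); rewrite expr1n mulr1 (mul1r (t j.+1 - t j)).
pose D := \sum_(j < N) C j.
have hAD : nrm (\sum_(j < N) A j - D) <= 2 * d * (2 * pi).
  rewrite /D -sumrB; apply: le_trans (nrm_sum _ _ _) _.
  by apply: le_trans (ler_sum _ (fun j _ => AC j)) _; rewrite -mulr_sumr arc_sum.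
suff hD : nrm (D - (if B == 0 then 2 * pi *i else 0)) <= 2 * `|B| * d * (2 * pi).
  apply: le_trans (nrm_tri _ D _) _; apply: le_trans (lerD hAD hD) _.
  by rewrite le_eqVlt; apply/orP; left; apply/eqP; ring.
have [B0|B0] := eqVneq B 0.
  rewrite (_ : D = 2 * pi *i) ?subrr ?nrm0 ?B0 ?normr0 ?mulr0 ?mul0r //.
  have -> : D = \sum_(j < N) (t j.+1 - t j)%:C * 'i.
    by apply: eq_bigr => j _; rewrite /C B0 mul0r eit0 mul1r.
  rewrite -mulr_suml -rmorph_sum /= arc_sum -iE.
  by apply/eqP; rewrite eq_complex /=; apply/andP; split; apply/eqP; ring.
rewrite subr0.
have tel : \sum_(j < N) (eit (B * t j.+1) - eit (B * t j)) = 0.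
  rewrite -(big_mkord xpredT (fun j => eit (B * t j.+1) - eit (B * t j))).
  by rewrite telescope_sumr // t0 tN mulr0 eit0 eB subrr.
have DE : D = - (B%:C)^-1 * \sum_(j < N) (eit (B * t j.+1) - eit (B * t j) - B%:C * C j).
  have B0' : B%:C != 0 :> R[i] by apply: contra_neq B0 => /complexI.
  by rewrite sumrB tel sub0r -mulr_sumr mulrNN mulKf.
rewrite DE nrmM nrmN nrmV nrmR -mulrA ler_pdivrMl ?normr_gt0 //.
apply: le_trans (nrm_sum _ _ _) _.
have -> : `|B| * (2 * `|B| * (d * (2 * pi))) = \sum_(j < N) 2 * B ^+ 2 * d * (t j.+1 - t j).
  by rewrite -mulr_sumr arc_sum -(real_normK (num_real B)); ring.
apply: ler_sum => j _; apply: le_trans (arc_eit B (ltn_ord j)).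
have -> : eit (B * t j.+1) - eit (B * t j) - B%:C * C j = eit (B * s j) *
   (eit (B * (t j.+1 - s j)) - eit (B * (t j - s j)) - (B * (t j.+1 - t j)) *i).
  have e x : eit (B * (x - s j)) = eit (B * x) / eit (B * s j) by rewrite mulrBr eitD eitN.
  by rewrite /C !e iE rmorphM /=; field; exact: eit_neq0.
by rewrite nrmM nrm_eit mul1r.
Qed.

Lemma chord_sum (r : R) : 0 <= r -> 
  \sum_(j < N) nrm (r%:C * (eit (t j.+1) - eit (t j))) <= r * (2 + 4 * d) * (2 * pi).
Proof.
move=> r0; apply: le_trans (_ : \sum_(j < N) r * (2 + 4 * d) * (t j.+1 - t j) <= _); last first.
  by rewrite -mulr_sumr arc_sum.
apply: ler_sum => j _; rewrite nrmM nrmR ger0_norm // -mulrA ler_wpM2l //.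
have [h1 h2 h3] := ts (ltn_ord j).
have d0 : 0 <= d by apply: ltW; apply: le_lt_trans h3; exact: arc_ge0.
have -> : eit (t j.+1) - eit (t j) = eit (t j) * (eit (t j.+1 - t j) - 1).
  by rewrite mulrBr -eitD mulr1 subrKC.
rewrite nrmM nrm_eit mul1r; set x := t j.+1 - t j.
have x0 : 0 <= x by exact: arc_ge0.
apply: le_trans (nrm_lebD _ (x *i)) _.
have -> : nrm (x *i : R[i]) = x.
  by apply/eqP; rewrite -(@eqrXn2 _ 2) ?nrm_ge0 // nrmC_sqr /= expr0n add0r.
apply: le_trans (lerD (eit_taylor x) (lexx _)) _.
have h3' : x < d by []. 
by clearbody x; nra.
Qed.

End CircleSums.

(** * The spectral radius formula by real-variable means *)

Section Rickart.
Variables (R : realType) (H : hilbertType R) (B : {linear H -> H}) (r : R).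
Hypotheses (bB : bounded_op B) (r0 : 0 <= r).
Hypothesis inv_surj : forall z : R[i], nrm z <= r -> forall f, exists x, x - z *: B x = f.
Hypothesis inv_bound : forall z : R[i], nrm z <= r ->
  exists2 b : R, 0 <= b & forall x, nrm x <= b * nrm (x - z *: B x).

(** A bound on the inverse persists, up to a factor, under small changes of z; compactness of a
    square containing the disc makes it uniform. *)
Lemma uniform_inverse_bound : exists2 b : R, 0 <= b &
  forall z : R[i], nrm z <= r -> forall x, nrm x <= b * nrm (x - z *: B x).
Proof.
have [C C0 hC] := bB.
pose P (b : R) (xy : R * R) := nrm (xy.1 +i* xy.2 : R[i]) <= r ->
  0 <= b /\ forall x, nrm x <= b * nrm (x - (xy.1 +i* xy.2) *: B x).
have distP (z z' : R * R) : nrm ((z.1 +i* z.2) - (z'.1 +i* z'.2) : R[i]) <= `|z.1 - z'.1| + `|z.2 - z'.2|.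
  by apply: le_trans (nrm_le_ReIm _) _; case: z z' => [a b] [a' b'].
have ballE (p q : R * R) (e : R) : ball p e q -> `|p.1 - q.1| < e /\ `|p.2 - q.2| < e by [].
have /compact_near_coveringP cov : compact (`[-r, r]%classic `*` `[-r, r]%classic : set (R * R)).
  by apply: compact_setX; exact: segment_compact.
have : \forall b \near +oo, (`[-r, r]%classic `*` `[-r, r]%classic : set (R * R)) `<=` P b.
  apply: cov => p _; pose z : R[i] := p.1 +i* p.2.
  have [zr|zr] := leP (nrm z) r; last first.
    have e0 : 0 < (nrm z - r) / 2 by rewrite divr_gt0 // subr_gt0.
    exists (ball p ((nrm z - r) / 2), setT); first by split; [exact: nbhsx_ballx|exact: filterT].
    move=> [q b] [/= /ballE[h1 h2] _] /= qr; exfalso.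
    have := distP p q; have := nrm_lebD z (q.1 +i* q.2); rewrite -/z.
    by move: qr h1 h2; move: (nrm _) (nrm _) (nrm _) => *; lra.
  have [b b0 hb] := inv_bound zr.
  (* Each coordinate moves by less than [1/(4(bC+1))], so z moves by at most [1/(2(bC+1))] and the
     bound at most doubles. *)
  have bC : 0 < 4 * (b * C + 1) by rewrite mulr_gt0 // ltr_wpDl // mulr_ge0.
  exists (ball p (4 * (b * C + 1))^-1, [set c | 2 * b <= c]).
    by split=> /=; [apply: nbhsx_ballx; rewrite invr_gt0|apply: nbhs_pinfty_ge; exact: num_real].
  move=> [q c] [/= /ballE[h1 h2] hc] qr; split; first by apply: le_trans hc; rewrite mulr_ge0.
  move=> x; pose w : R[i] := q.1 +i* q.2; rewrite -/w.
  have zw : nrm (w - z) <= (2 * (b * C + 1))^-1.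
    have := distP p q; rewrite -/z -/w nrmBC => /le_trans; apply.
    have := ltW (ltrD h1 h2) => /le_trans; apply.
    have y0 : b * C + 1 != 0 by rewrite gt_eqF // ltr_wpDl // mulr_ge0.
    by rewrite le_eqVlt; apply/orP; left; apply/eqP; field.
  have h3 : nrm (x - z *: B x) <= nrm (x - w *: B x) + nrm (w - z) * (C * nrm x).
    have -> : x - z *: B x = (x - w *: B x) + (w - z) *: B x by rewrite scalerBl addrA subrK.
    by apply: le_trans (nrmD _ _) _; rewrite lerD2l nrmZ ler_wpM2l ?nrm_ge0.
  have h4 : b * (nrm (w - z) * (C * nrm x)) <= nrm x / 2.
    have -> : b * (nrm (w - z) * (C * nrm x)) = (b * C) * nrm (w - z) * nrm x by ring.
    rewrite mulrC ler_wpM2l ?nrm_ge0 //.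
    apply: le_trans (ler_wpM2l (mulr_ge0 b0 C0) zw) _.
    rewrite invfM mulrCA ler_piMr ?invr_ge0 // ler_pdivrMr ?ltr_wpDl ?mulr_ge0 // mul1r lerDl //.
  have h5 := hb x; have h6 := ler_wpM2l b0 h3.
  apply: le_trans (_ : 2 * b * nrm (x - w *: B x) <= _); last by rewrite ler_wpM2r ?nrm_ge0.
  rewrite mulrDr in h6; rewrite -mulrA; move: h4 h5 h6; move: (b * _) (b * _) (b * _) => *; lra.
move=> /filter_ex[b hb]; exists (Num.max b 0); first by rewrite le_max lexx orbT.
move=> z zr x; have [||b0 h] := hb (complex.Re z, complex.Im z).
- split; rewrite /= in_itv /= -ler_norml; first exact: le_trans (Re_le_nrm _) zr.
  exact: le_trans (Im_le_nrm _) zr.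
- by case: z zr.
by rewrite (max_idPl b0); case: z zr h => z1 z2 _; apply.
Qed.

(* With X = z^(2^k) B^(2^k), the identity (1 - X^2)^-1 = ((1 - X)^-1 + (1 + X)^-1)/2
   yields inverses of 1 - z^(2^k) B^(2^k) obeying bounds independent of k. *)
Lemma averaged_inverses : exists2 b : R, 0 <= b & exists2 l : R, 0 <= l &
  forall k, exists Y : R[i] -> H -> H, forall z, nrm z <= r -> forall u,
    [/\ Y z u - z ^+ (2 ^ k) *: iter (2 ^ k) B (Y z u) = u,
        Y z (u - z ^+ (2 ^ k) *: iter (2 ^ k) B u) = u,
        nrm (Y z u) <= b * nrm u
      & forall z', nrm z' <= r -> nrm (Y z u - Y z' u) <= l * nrm (z - z') * nrm u].
Proof.
have [b b0 hb] := uniform_inverse_bound; have [C C0 hC] := bB.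
(* The Lipschitz constant comes from the resolvent identity [Y z - Y z' = (z - z') Y z B Y z'] at k
   = 0; averaging preserves both constants. *)
exists b => //; exists (b * (C * b)); first by rewrite !mulr_ge0.
elim=> [|k [Y hY]].
  have /choice[Y hY] (zu : R[i] * H) : exists x, nrm zu.1 <= r -> x - zu.1 *: B x = zu.2.
    have [zr|zr] := pselect (nrm zu.1 <= r); last by exists 0.
    by have [x hx] := inv_surj zr zu.2; exists x.
  exists (fun z u => Y (z, u)) => z zr u; rewrite expn0 expr1 /=.
  have E z' u' : nrm z' <= r -> Y (z', u') - z' *: B (Y (z', u')) = u' by move=> h; apply: (hY (z', u')).
  have inj x y : x - z *: B x = y - z *: B y -> x = y.
    move=> xy; apply/eqP; rewrite -subr_eq0; apply/eqP/nrm_le0.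
    apply: le_trans (hb _ zr _) _.
    have -> : x - y - z *: B (x - y) = (x - z *: B x) - (y - z *: B y) by rewrite linearB; hring.
    by rewrite xy subrr nrm0 mulr0.
  have bY z' u' : nrm z' <= r -> nrm (Y (z', u')) <= b * nrm u'.
    by move=> h; rewrite -[in X in _ <= X](E z' u' h); apply: hb.
  split; [exact: E|by apply: inj; rewrite E|exact: bY|].
  move=> z' zr'; have := hb _ zr (Y (z, u) - Y (z', u)) => /le_trans; apply.
  apply: le_trans (_ : b * (nrm (z - z') * (C * (b * nrm u))) <= _); last first.
    by rewrite le_eqVlt; apply/orP; left; apply/eqP; ring.
  rewrite ler_wpM2l //.
  have -> : Y (z, u) - Y (z', u) - z *: B (Y (z, u) - Y (z', u)) = (z - z') *: B (Y (z', u)).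
    rewrite linearB; have h1 := E z u zr; have h2 := E z' u zr'.
    transitivity ((Y (z, u) - z *: B (Y (z, u))) - (Y (z', u) - z' *: B (Y (z', u)))
      + (z - z') *: B (Y (z', u))); last by rewrite h1 h2 subrr add0r.
    by hring.
  rewrite nrmZ ler_wpM2l ?nrm_ge0 //; apply: le_trans (hC _) _; rewrite ler_wpM2l //.
  exact: bY.
(* Multiplication by w preserves the disc and changes the sign of [X = z^(2^k) B^(2^k)], so
   [Y (w z)] inverts [1 + X]. *)
pose w := eit (pi / (2 ^ k)%:R) : R[i].
have wk : w ^+ (2 ^ k) = -1.
  by rewrite eitX mulrCA mulfV ?mulr1 ?eit_pi // pnatr_eq0 expn_eq0.
have w1 z : nrm (w * z) = nrm z by rewrite nrmM nrm_eit mul1r.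
exists (fun z u => (1 / 2) *: (Y z u + Y (w * z) u)) => z zr u.
have wzr : nrm (w * z) <= r by rewrite w1.
have n2 : nrm (1 / 2 : R[i]) = 1 / 2.
  by rewrite !div1r nrmV; congr (_^-1); rewrite -[2 in LHS](rmorph_nat (real_complex R)) nrmR normr_nat.
pose X := iter (2 ^ k) B; pose c := z ^+ (2 ^ k).
have cw : (w * z) ^+ (2 ^ k) = - c by rewrite exprMn wk mulN1r.
have XX v : iter (2 ^ k.+1) B v = X (X v) by rewrite /X -iterD addnn -mul2n expnS.
have cc : z ^+ (2 ^ k.+1) = c * c by rewrite /c -exprD addnn -mul2n expnS.
have XD x y : X (x + y) = X x + X y by rewrite /X iter_linD.
have XZ a x : X (a *: x) = a *: X x by rewrite /X iter_linZ.
have XN x : X (- x) = - X x by rewrite -scaleN1r XZ scaleN1r.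
have h1 v := hY z zr v; have h2 v := hY _ wzr v; rewrite cw -/X -/c in h1 h2.
have half (x : H) : (1 / 2) *: (x + x) = x.
  by rewrite -mulr2n -(scaler_nat 2 x) scalerA div1r mulVf ?scale1r // pnatr_eq0.
rewrite !XX cc; split.
- have [e1 _ _ _] := h1 u; have [e2 _ _ _] := h2 u.
  rewrite !(XD, XZ); set y1 := Y z u in e1 *; set y2 := Y (w * z) u in e2 *.
  have e1' : y1 - (c * c) *: X (X y1) = u + c *: X u.
    by rewrite -e1 XD XN XZ; hring.
  have e2' : y2 - (c * c) *: X (X y2) = u - c *: X u.
    by rewrite -e2 XD XN XZ; hring.
  transitivity ((1 / 2) *: ((y1 - (c * c) *: X (X y1)) + (y2 - (c * c) *: X (X y2)))).
    by hring.
  by rewrite e1' e2' -[RHS]half; congr (_ *: _); hring.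
- have E1 : u - (c * c) *: X (X u) = (u + c *: X u) - c *: X (u + c *: X u).
    by rewrite XD XZ; hring.
  have E2 : u - (c * c) *: X (X u) = (u - c *: X u) - (- c) *: X (u - c *: X u).
    by rewrite XD XN XZ; hring.
  have [_ e1 _ _] := h1 (u + c *: X u); have [_ e2 _ _] := h2 (u - c *: X u).
  by rewrite {1}E1 E2 e1 e2 -[RHS]half; congr (_ *: _); hring.
- rewrite nrmZ n2; have [_ _ e1 _] := h1 u; have [_ _ e2 _] := h2 u.
  rewrite mul1r ler_pdivrMl //; apply: le_trans (nrmD _ _) _.
  by rewrite mulr_natl mulr2n lerD.
- move=> z' zr'; have wzr' : nrm (w * z') <= r by rewrite w1.
  have [_ _ _ e1] := h1 u; have [_ _ _ e2] := h2 u.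
  have := e1 _ zr'; have := e2 _ wzr'; rewrite -mulrBr w1 => e3 e4.
  rewrite -scalerBr nrmZ n2 mul1r ler_pdivrMl // opprD addrACA.
  by apply: le_trans (nrmD _ _) _; rewrite mulr_natl mulr2n lerD.
Qed.

(** Exponents that are powers of two suffice: the Laurent expansion will be truncated at a single
    such exponent. *)
Let vanishing (s : R) := forall e : R, 0 < e -> exists k0, forall k, (k0 <= k)%N ->
  forall u, s ^+ (2 ^ k) * nrm (iter (2 ^ k) B u) <= e * nrm u.

(** Write X and X' for [s^(2^k) B^(2^k)] and [s'^(2^k) B^(2^k)]. Smallness of X puts [(1 - X)^-1]
    near 1; the Lipschitz bound, uniform in k, carries this over to [(1 - X')^-1], and so X' is
    small. *)
Lemma vanishing_step : exists2 l : R, 0 <= l & forall s s' e : R,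
  0 <= s -> s <= s' -> s' <= r -> vanishing s -> 0 < e -> l * (s' - s) <= e -> e <= 1 / 4 ->
  exists k0, forall k, (k0 <= k)%N -> forall u, s' ^+ (2 ^ k) * nrm (iter (2 ^ k) B u) <= 4 * e * nrm u.
Proof.
have [b b0 [l l0 hY]] := averaged_inverses; exists l => // s s' e s0 ss' s'r van e0 hle e4.
have b1 : 0 < b + 1 by rewrite ltr_wpDl.
have [k0 hk0] := van _ (divr_gt0 e0 b1); exists k0 => k /hk0 hk u.
have s'0 : 0 <= s' by apply: le_trans ss'.
have [Y hYk] := hY k.
have nC (x : R) : 0 <= x -> nrm (x%:C : R[i]) = x by move=> x0; rewrite nrmR ger0_norm.
have sr : nrm (s%:C : R[i]) <= r by rewrite nC // (le_trans ss').
have s'r' : nrm (s'%:C : R[i]) <= r by rewrite nC.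
pose X := iter (2 ^ k) B u; set c' := s'%:C ^+ (2 ^ k).
have nc' : nrm c' = s' ^+ (2 ^ k) by rewrite nrmX nC.
pose v := u - c' *: X.
have [_ Yv _ _] := hYk _ s'r' u; rewrite -/c' -/X -/v in Yv.
have [Es _ bs ls] := hYk _ sr v.
have h1 : nrm (Y s%:C v - v) <= e * nrm v.
  have -> : Y s%:C v - v = s%:C ^+ (2 ^ k) *: iter (2 ^ k) B (Y s%:C v).
    by rewrite -{2}Es subKr.
  rewrite nrmZ nrmX nC //; apply: le_trans (hk _) _.
  apply: le_trans (ler_wpM2l _ bs) _; first by rewrite divr_ge0 ?ltW.
  rewrite mulrA ler_wpM2r ?nrm_ge0 // -mulrA ler_piMr ?(ltW e0) //.
  by rewrite mulrC ler_pdivrMr // mul1r lerDl.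
have h2 := ls _ s'r'; rewrite Yv -rmorphB nrmR distrC ger0_norm ?subr_ge0 // in h2.
have h3 : nrm (Y s%:C v - u) <= e * nrm v.
  by apply: le_trans h2 _; rewrite ler_wpM2r ?nrm_ge0.
have h4 : nrm (c' *: X) <= 2 * e * nrm v.
  have -> : c' *: X = (Y s%:C v - v) - (Y s%:C v - u) by rewrite /v; hring.
  apply: le_trans (nrmB _ _) _; apply: le_trans (lerD h1 h3) _.
  by rewrite le_eqVlt; apply/orP; left; apply/eqP; ring.
have h5 : nrm v <= nrm u + nrm (c' *: X) by exact: nrmB.
rewrite -nc' -nrmZ -/X; move: h4 h5 (nrm_ge0 v) (nrm_ge0 u) (nrm_ge0 (c' *: X)) e0 e4.
by move: (nrm v) (nrm u) (nrm (c' *: X)) => a1 a2 a3; clear; move=> *; nra.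
Qed.

Lemma pow2_vanish (q : R) (e : R) : 0 <= q -> q < 1 -> 0 < e -> exists k0, forall k, (k0 <= k)%N ->
  q ^+ (2 ^ k) <= e.
Proof.
move=> q0 q1 e0; have : (fun k => q ^+ k) @ \oo --> (0 : R) by apply: cvg_expr; rewrite ger0_norm.
move=> /cvgrPdist_lt /(_ _ e0)[k0 _ hk0]; exists k0 => k kk0.
have := hk0 (2 ^ k)%N (leq_trans kk0 (ltnW (ltn_expl _ _))).
by rewrite sub0r normrN ger0_norm ?exprn_ge0 // => /(_ isT)/ltW.
Qed.

(** At any s smaller than [s'] the bound acquires the factor [(s/s')^(2^k)], which tends to 0. *)
Lemma vanishing_below s s' e : 0 <= s -> 0 < e ->
  (exists k0, forall k, (k0 <= k)%N -> forall u, s' ^+ (2 ^ k) * nrm (iter (2 ^ k) B u) <= e * nrm u) ->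
  s < s' -> vanishing s.
Proof.
move=> s0 e0 [k0 h] ss' e' e'0.
have s'0 : 0 < s' by apply: le_lt_trans ss'.
have q1 : s / s' < 1 by rewrite ltr_pdivrMr // mul1r.
have q0 : 0 <= s / s' by rewrite divr_ge0 // ltW.
have [k1 h1] := pow2_vanish q0 q1 (divr_gt0 e'0 e0).
exists (maxn k0 k1) => k; rewrite geq_max => /andP[k0k k1k] u.
have -> : s ^+ (2 ^ k) = (s / s') ^+ (2 ^ k) * s' ^+ (2 ^ k).
  by rewrite -exprMn divfK // gt_eqF.
rewrite -mulrA; apply: le_trans (ler_wpM2l _ (h k k0k u)) _; first by rewrite exprn_ge0.
rewrite mulrA ler_wpM2r ?nrm_ge0 //.
by have := h1 k k1k; rewrite ler_pdivlMr.
Qed.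

(** Vanishing is propagated from 0 towards r: [vanishing_step] with e = 1/4 yields boundedness a
    step ahead, and [vanishing_below] turns it into vanishing short of that point. The step length
    depends only on the Lipschitz constant, so finitely many steps reach any s < r. *)
Theorem spectral_radius_vanish : vanishing r.
Proof.
have [l l0 step] := vanishing_step.
have v0 : vanishing 0.
  by move=> e e0; exists 0%N => k _ u; rewrite expr0n expn_eq0 /= mul0r mulr_ge0 ?nrm_ge0 ?ltW.
pose h := 1 / (4 * (l + 1)).
have l1 : 0 < l + 1 by rewrite ltr_wpDl.
have h0 : 0 < h by rewrite divr_gt0 ?mulr_gt0.
have lh : l * h <= 1 / 4.
  rewrite /h div1r ler_pdivrMr ?mulr_gt0 //; lra.
have van s : 0 <= s -> s < r -> vanishing s.
  move=> s0 sr; have [n ns] : exists n : nat, s < n%:R * (h / 2).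
    have h2 : 0 < h / 2 by rewrite divr_gt0.
    by exists (Num.truncn (s / (h / 2))).+1; rewrite -ltr_pdivrMr // truncnS_gt.
  elim: n s s0 sr ns => [s s0 _|n ih s s0 sr ns]; first by rewrite mul0r ltNge s0.
  pose s1 := Num.max 0 (s - h / 2).
  have s10 : 0 <= s1 by rewrite le_max lexx.
  have [->//|sn0] := eqVneq s 0.
  have s1s : s1 < s.
    by rewrite gt_max lt0r sn0 s0 /= ltrBlDr ltrDl divr_gt0.
  have van1 : vanishing s1.
    have [h2|h2] := leP (s - h / 2) 0; first by rewrite /s1 (max_idPl h2).
    apply: ih => //; first exact: lt_trans sr.
    rewrite /s1 (max_idPr (ltW h2)) ltrBlDr; apply: lt_le_trans ns _.
    by rewrite -natr1 mulrDl mul1r.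
  pose s2 := Num.min r (s1 + h).
  have ss2 : s < s2.
    rewrite lt_min sr /=; apply: le_lt_trans (_ : s1 + h / 2 < _); last first.
      by rewrite ltrD2l ltr_pdivrMr // ltr_pMr // ltr1n.
    by rewrite -lerBlDr le_max lexx orbT.
  have s2r : s2 <= r by rewrite ge_min lexx.
  have e4 : 0 < 1 / 4 :> R by rewrite divr_gt0.
  have hl : l * (s2 - s1) <= 1 / 4.
    by apply: le_trans lh; rewrite ler_wpM2l // lerBlDl ge_min lexx orbT.
  have := step s1 s2 (1 / 4) s10 (ltW (lt_trans s1s ss2)) s2r van1 e4 hl (lexx _).
  by move=> /vanishing_below; apply; rewrite ?mulr_gt0.
move=> e e0.
have [r00|rn0] := eqVneq r 0; first by rewrite r00; apply: v0.
have rp : 0 < r by rewrite lt0r rn0.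
(* At the endpoint r there is no room to step back: the last step starts so close to r that it gives
   the bound [4 e' <= e] directly. *)
pose e' := Num.min (e / 4) (1 / 4).
have e'0 : 0 < e' by rewrite lt_min !divr_gt0.
pose s := Num.max 0 (r - e' / (l + 1)).
have s0 : 0 <= s by rewrite le_max lexx.
have sr : s < r by rewrite gt_max rp /= ltrBlDr ltrDl divr_gt0.
have hl : l * (r - s) <= e'.
  apply: le_trans (_ : l * (e' / (l + 1)) <= _).
    by rewrite ler_wpM2l // lerBlDr -lerBlDl le_max lexx orbT.
  by rewrite mulrCA ler_piMr ?(ltW e'0) // ler_pdivrMr // mul1r lerDl.
have e'4 : e' <= 1 / 4 by rewrite ge_min lexx orbT.
have [k0 hk0] := step s r e' s0 (ltW sr) (lexx _) (van _ s0 sr) e'0 hl e'4.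
exists k0 => k kk0 u; apply: le_trans (hk0 k kk0 u) _; rewrite ler_wpM2r ?nrm_ge0 //.
by rewrite -ler_pdivlMl // mulrC ge_min lexx.
Qed.

End Rickart.

(** * The Riesz projection *)

Section ResolventGraph.
Variables (R : realType) (H : hilbertType R) (T : set (H * H)%type) (K L : {linear H -> H}) (z0 lam : R[i]).
Hypothesis TE : forall u v, T (u, v) <-> u = K (z0 *: u - v).
Hypothesis lz : lam != z0.
Let mu := (z0 - lam)^-1.
Hypothesis LE : forall u, L u = K u - mu *: u.

Lemma mu_neq0 : mu != 0.
Proof. by rewrite invr_eq0 subr_eq0 eq_sym. Qed.

Lemma LK_commute u : L (K u) = K (L u).
Proof. by rewrite !LE (lB K) (lZ K). Qed.

Lemma KL_iter l u : iter l L (K u) = K (iter l L u).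
Proof. by rewrite (iter_commute LK_commute). Qed.

Lemma LK_iter k u : L (iter k K u) = iter k K (L u).
Proof. by rewrite (iter_commute (fun x => esym (LK_commute x))). Qed.

(** Being an equivalence, it also decides membership in the domain: if [L u = mu K v], then u lies
    in the domain of T and [(T - lam) u = v]. *)
Lemma shiftE u v : op_shift T lam (u, v) <-> L u = mu *: K v.
Proof.
have c0 : z0 - lam != 0 by rewrite subr_eq0 eq_sym.
have E : L u - mu *: K v = mu *: (K (z0 *: u - (v + lam *: u)) - u).
  rewrite LE -[K u in LHS]scale1r -(mulVf c0) -/mu.
  by rewrite (lB K) (lD K) !(lZ K); hring.
rewrite /op_shift /= TE; split=> h.
  by apply/eqP; rewrite -subr_eq0 E -h subrr scaler0.
move: E; rewrite h subrr => /esym/eqP; rewrite scaler_eq0 (negPf mu_neq0) /= subr_eq0.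
by move=> /eqP.
Qed.

(** K is invertible on the kernel of [L^l]: if [L x = K y'], then [x = mu^-1 K (x - y')]. The norm
    bound is what later makes the nilpotent part bounded. *)
Lemma kernel_preimage (bL : bounded_op L) l : exists2 C : R, 0 <= C &
  forall x, iter l L x = 0 -> exists y, [/\ x = K y, iter l L y = 0 & nrm y <= C * nrm x].
Proof.
have [CL CL0 hL] := bL; elim: l => [|l [C C0 ih]].
  by exists 0 => // x /= ->; exists 0; rewrite linear0 nrm0 mul0r.
exists ((nrm mu)^-1 * (1 + C * CL)).
  by rewrite mulr_ge0 ?invr_ge0 ?nrm_ge0 // addr_ge0 ?mulr_ge0.
move=> x; rewrite iterSr => /[dup] hx /ih[y' [Ly y'0 ny']].
have m0 := mu_neq0; exists (mu^-1 *: (x - y')); split.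
- rewrite (lZ K) (lB K) -Ly LE opprB addrCA subrr addr0.
  by rewrite scalerA mulVf // scale1r.
- by rewrite iter_linZ iter_linB iterSr hx iterS y'0 linear0 subrr scaler0.
rewrite nrmZ nrmV -mulrA ler_wpM2l ?invr_ge0 ?nrm_ge0 //.
apply: le_trans (nrmB _ _) _; rewrite mulrDl mul1r lerD2l.
by apply: le_trans ny' _; rewrite -mulrA ler_wpM2l.
Qed.

Lemma op_pow_iter l u v : op_pow (op_shift T lam) l (u, v) -> iter l L u = mu ^+ l *: iter l K v.
Proof.
elim: l v => [v /= ->|l ih v /= [w [hu /shiftE hw]]]; first by rewrite expr0 scale1r.
rewrite (ih _ hu) (lZ L) exprSr -scalerA; congr (_ *: _).
by rewrite LK_iter hw iter_linZ -iterSr.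
Qed.

(** One direction applies [K^l]. For the other, the successive images under [T - lam] have to be
    found inside the domain; [kernel_preimage] supplies each of them. *)
Lemma op_ker_iter (bL : bounded_op L) l u :
  op_ker (op_pow (op_shift T lam) l) u <-> iter l L u = 0.
Proof.
split=> [/op_pow_iter ->|hu]; first by rewrite iter_lin0 scaler0.
suff h : forall m k, iter (k + m) L u = 0 ->
    exists w, op_pow (op_shift T lam) k (u, w) /\ iter m L w = 0.
  by have [|w [hw /= w0]] := h 0%N l; [rewrite addn0|rewrite /op_ker /= -w0].
move=> m k; elim: k m => [m hm|k ih m hm] /=; first by exists u.
have [|w [huw hw]] := ih m.+1; first by rewrite -addSnnS.
have [C C0 hC] := kernel_preimage bL m; rewrite iterSr in hw.
have [y [Ly y0 _]] := hC _ hw; exists (mu^-1 *: y); split; last by rewrite iter_linZ y0 scaler0.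
by exists w; split=> //; apply/shiftE; rewrite (lZ K) scalerA mulfV ?mu_neq0 // scale1r.
Qed.

Lemma gen_eigenspaceE (bL : bounded_op L) u :
  gen_eigenspace T lam u <-> exists l, iter l L u = 0.
Proof.
split=> [[l _ /(op_ker_iter bL)]|[l hl]]; first by exists l.
by exists l.+1 => //; apply/(op_ker_iter bL); rewrite iterS hl linear0.
Qed.

End ResolventGraph.

Lemma linearized_op (R : realType) (V : lmodType R[i]) (K : {linear V -> V}) (mu : R[i]) :
  exists L : {linear V -> V}, forall u, L u = K u - mu *: u.
Proof.
have [x y|c x|L LE] := @mklin R V V (fun u => K u - mu *: u).
- by rewrite (lD K) scalerDr opprD addrACA.
- by rewrite (lZ K) scalerBr !scalerA mulrC.
by exists L.
Qed.

Lemma bounded_norm_sum (R : realType) (V W : normedModType R[i]) n (f : nat -> V -> W) (c : nat -> R) :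
  (forall i, bounded_op (f i)) -> (forall i, 0 <= c i) ->
  exists2 D : R, 0 <= D & forall x, \sum_(i < n) c i * nrm (f i x) <= D * nrm x.
Proof.
move=> bf c0; elim: n => [|n [C C0 hC]].
  by exists 0 => // x; rewrite big_ord0 mul0r.
have [D D0 hD] := bf n; exists (C + c n * D); first by rewrite addr_ge0 ?mulr_ge0.
by move=> x; rewrite big_ord_recr /= mulrDl lerD // -mulrA ler_wpM2l.
Qed.

(** * Laurent expansion of the resolvent at a point lam and its contour integral *)

Section SpectralPoint.
Variables (R : realType) (H : hilbertType R) (T : set (H * H)%type) (K L Pi J : {linear H -> H})
  (z0 lam : R[i]) (p : nat).
Hypothesis TE : forall u v, T (u, v) <-> u = K (z0 *: u - v).
Hypothesis Kinj : forall w, K w = 0 -> w = 0.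
Hypothesis bK : bounded_op K.
Hypothesis lz : lam != z0.
Let mu := (z0 - lam)^-1.
Hypothesis LE : forall u, L u = K u - mu *: u.
Hypotheses (bL : bounded_op L) (p0 : (0 < p)%N) (bPi : bounded_op Pi) (bJ : bounded_op J).
Hypothesis PiK : forall u, iter p L (Pi u) = 0.
Hypothesis Pi_id : forall u l, iter l L u = 0 -> Pi u = u.
Hypothesis LJ : forall u, L (J u) = u - Pi u.
Hypothesis JL : forall u, J (L u) = u - Pi u.
Hypothesis KPi : forall u, K (Pi u) = Pi (K u).
Hypothesis PiJ : forall u, Pi (J u) = 0.
Hypothesis JPi : forall u, J (Pi u) = 0.

Let m0 : mu != 0 := mu_neq0 lz.
Let shiftP u v := @shiftE R H T K L z0 lam TE lz LE u v.

Lemma PiPi u : Pi (Pi u) = Pi u.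
Proof. exact: (Pi_id (PiK u)). Qed.

Lemma LPi u : L (Pi u) = Pi (L u).
Proof. by rewrite !LE KPi (lB Pi) (lZ Pi). Qed.

(** The inverse of [lam - T] on the kernel of [Pi], extended by 0 on the range of [Pi]: the constant
    term of the Laurent expansion of the resolvent at lam. *)
Definition reduced_resolvent u := (- mu) *: J (K u).
Local Notation G := reduced_resolvent.

Lemma GD u v : G (u + v) = G u + G v.
Proof. by rewrite /G (lD K) (lD J) scalerDr. Qed.

Lemma GZ c u : G (c *: u) = c *: G u.
Proof. by rewrite /G (lZ K) (lZ J) !scalerA mulrC. Qed.

Lemma GB u v : G (u - v) = G u - G v.
Proof. by rewrite GD -scaleN1r GZ scaleN1r. Qed.

Lemma bG : bounded_op G.
Proof. by apply: bounded_opZ; exact: bounded_op_comp. Qed.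

Lemma GPi u : G (Pi u) = 0.
Proof. by rewrite /G KPi JPi scaler0. Qed.

Lemma PiG u : Pi (G u) = 0.
Proof. by rewrite /G (lZ Pi) PiJ scaler0. Qed.

Lemma shift_G f : op_shift T lam (G f, - (f - Pi f)).
Proof.
by apply/shiftP; rewrite /G (lZ L) LJ (lN K) (lB K) scalerN scaleNr KPi.
Qed.

Lemma shift_inv u v : op_shift T lam (u, v) -> u - Pi u = - G v.
Proof. by move=> /shiftP h; rewrite -JL h (lZ J) /G scaleNr opprK. Qed.

Lemma shift_Pi u v : op_shift T lam (u, v) -> op_shift T lam (Pi u, Pi v).
Proof. by move=> /shiftP h; apply/shiftP; rewrite LPi h (lZ Pi) KPi. Qed.

Lemma T_shift z x v : T (x, z *: x - v) -> op_shift T lam (x, (z - lam) *: x - v).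
Proof. by rewrite /op_shift /=; congr (T (_, _)); hring. Qed.

Lemma shift_T z x v : op_shift T lam (x, (z - lam) *: x - v) -> T (x, z *: x - v).
Proof. by rewrite /op_shift /=; congr (T (_, _)); hring. Qed.

(** On [Pi u], L acts as [mu (z - lam) K]; its p-th power vanishes there, while the scalar is
    nonzero and K is injective. *)
Lemma eigen_in_kernel z u : z != lam -> T (u, z *: u) -> Pi u = 0.
Proof.
move=> zl hT; have : op_shift T lam (u, (z - lam) *: u - 0).
  by apply: T_shift; rewrite subr0.
rewrite subr0 => /shift_Pi; rewrite (lZ Pi) => hs.
have LPiu : L (Pi u) = (mu * (z - lam)) *: K (Pi u).
  by move/shiftP: hs => ->; rewrite (lZ K) scalerA.
have : forall k, iter k L (Pi u) = (mu * (z - lam)) ^+ k *: iter k K (Pi u).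
  elim=> [|k ih]; first by rewrite expr0 scale1r.
  rewrite /= ih (lZ L) exprSr -scalerA; congr (_ *: _).
  have -> : L (iter k K (Pi u)) = iter k K (L (Pi u)).
    exact: (LK_iter LE).
  by rewrite LPiu iter_linZ -iterSr.
move=> /(_ p); rewrite PiK => /esym/eqP; rewrite scaler_eq0 expf_eq0 mulf_eq0 (negPf m0) /=.
rewrite subr_eq0 (negPf zl) andbF /= => /eqP; elim: p => //= k ih /Kinj; exact: ih.
Qed.

(** An eigenvector u for z different from lam has [Pi u = 0], hence [u = - (z - lam) G u], which is
    impossible when [|z - lam|] is small against the norm of [G]. *)
Lemma isolating_exists : exists r, isolating_radius T lam r.
Proof.
have [C C0 hC] := bG; have C1 : 0 < 2 * (C + 1) by rewrite mulr_gt0 // ltr_wpDl.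
exists (2 * (C + 1))^-1; split; first by rewrite invr_gt0.
move=> z [u [u0 hT]]; rewrite nrm_norm_le => zr; apply/eqP; apply: contraNT u0 => zl.
have Pu := eigen_in_kernel zl hT.
have : op_shift T lam (u, (z - lam) *: u - 0) by apply: T_shift; rewrite subr0.
move=> /shift_inv; rewrite Pu !subr0 GZ => uE.
apply/eqP/nrm_le0; have : nrm u <= (2 * (C + 1))^-1 * (C * nrm u).
  rewrite {1}uE nrmN nrmZ; apply: le_trans (ler_wpM2r (nrm_ge0 _) zr) _.
  by rewrite ler_wpM2l // invr_ge0 ltW.
rewrite ler_pdivlMl // mulrDr mulr1 => h.
have := nrm_ge0 u; have := mulr_ge0 C0 (nrm_ge0 u); lra.
Qed.

Section Resolvent.
Variables (z : R[i]) (S : {linear H -> H}).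
Hypotheses (zl : z != lam) (resS : is_resolvent T z S).

Lemma resolvent_regular f : S f - Pi (S f) = G f - (z - lam) *: G (S f - Pi (S f)).
Proof.
case: resS => _ /(_ f)/T_shift/shift_inv h _.
by rewrite GB GPi subr0 h GB GZ; hring.
Qed.

(** [N] is [(T - lam) Pi], the nilpotent part at lam; applying [mu K] expresses this without
    mentioning the domain. *)
Variable N : {linear H -> H}.
Hypothesis NE : forall u, mu *: K (N u) = L (Pi u).

Lemma N_Pi u : Pi u = u -> Pi (N u) = N u.
Proof.
move=> Pu; apply: (Pi_id (l := p)); apply: Kinj.
have /eqP : mu *: K (iter p L (N u)) = 0.
  by rewrite -(KL_iter LE) -iter_linZ NE Pu -iterSr iterS -{1}Pu PiK linear0.
by rewrite scaler_eq0 (negPf m0) /= => /eqP.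
Qed.

Lemma N_iterPi j u : Pi u = u -> Pi (iter j N u) = iter j N u.
Proof. by move=> Pu; elim: j => //= j ih; apply: N_Pi. Qed.

Lemma N_nilpotent u : Pi u = u -> iter p N u = 0.
Proof.
move=> Pu; suff h j : (j <= p)%N -> iter (p - j) L (iter j N u) = 0 by have := h p (leqnn _); rewrite subnn.
elim: j => [_|j ih jp]; first by rewrite subn0 /= -Pu PiK.
apply: Kinj; have /eqP : mu *: K (iter (p - j.+1) L (iter j.+1 N u)) = 0.
  rewrite -(KL_iter LE) -iter_linZ /= NE N_iterPi // -iterSr -subSn // subSS.
  exact: ih (ltnW jp).
by rewrite scaler_eq0 (negPf m0) /= => /eqP.
Qed.

Lemma resolvent_singular f : N (Pi (S f)) = (z - lam) *: Pi (S f) - Pi f.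
Proof.
case: resS => _ /(_ f)/T_shift/shift_Pi/shiftP h _; rewrite (lB Pi) (lZ Pi) in h.
apply/eqP; rewrite -subr_eq0; apply/eqP/Kinj; rewrite (lB K).
apply: (scalerI m0); rewrite scaler0 scalerBr NE PiPi h -/mu subrr //.
Qed.

(** Iterates [(z - lam) Pi S = Pi + N Pi S]; since [N^p = 0] on the range of [Pi], the remainder
    disappears at j = p. *)
Lemma singular_expansion f j : let a := (z - lam)^-1 in
  Pi (S f) = \sum_(i < j) a ^+ i.+1 *: iter i N (Pi f) + a ^+ j *: iter j N (Pi (S f)).
Proof.
move=> a; have c0 : z - lam != 0 by rewrite subr_eq0.
elim: j => [|j ih]; first by rewrite big_ord0 add0r expr0 scale1r.
rewrite big_ord_recr /= [LHS]ih -addrA; congr (_ + _).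
have -> : N (iter j N (Pi (S f))) = (z - lam) *: iter j N (Pi (S f)) - iter j N (Pi f).
  by rewrite -iterS iterSr resolvent_singular iter_linB iter_linZ.
by rewrite scalerBr scalerA exprSr -mulrA mulVf // mulr1 addrC subrK.
Qed.

Lemma singular_part f : let a := (z - lam)^-1 in
  Pi (S f) = \sum_(i < p) a ^+ i.+1 *: iter i N (Pi f).
Proof. by move=> a; rewrite (singular_expansion f p) N_nilpotent ?PiPi // scaler0 addr0. Qed.

Lemma iterGB j x y : iter j G (x - y) = iter j G x - iter j G y.
Proof. by elim: j => //= j ->; rewrite GB. Qed.

Lemma iterGZ j c x : iter j G (c *: x) = c *: iter j G x.
Proof. by elim: j => //= j ->; rewrite GZ. Qed.

(** A Neumann expansion in [- (z - lam) G] kept with its exact remainder, so that writing it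
    requires no convergence. *)
Lemma regular_part f M : let c := - (z - lam) in let w := S f - Pi (S f) in
  w = \sum_(k < M) c ^+ k *: iter k.+1 G f + c ^+ M *: iter M G w.
Proof.
move=> c w; elim: M => [|M ih]; first by rewrite big_ord0 add0r expr0 scale1r.
rewrite big_ord_recr /= [LHS]ih -addrA; congr (_ + _).
have e : w = G f - (z - lam) *: G w by exact: resolvent_regular.
transitivity (c ^+ M *: (iter M G (G f) - (z - lam) *: iter M G (G w))).
  by congr (_ *: _); rewrite -iterGZ -iterGB -e.
have Sr x : G (iter M G x) = iter M G (G x) by rewrite -[RHS]iterSr.
by rewrite !Sr exprSr -scalerA scalerBr /c scaleNr scalerN.
Qed.

End Resolvent.

(** The bound comes from [kernel_preimage], as [L (Pi u)] lies in the kernel of [L^p]. *)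
Lemma nilpotent_part : exists N : {linear H -> H}, bounded_op N /\ forall u, mu *: K (N u) = L (Pi u).
Proof.
have [C C0 hC] := kernel_preimage lz LE bL p.
have uniq u v v' : mu *: K v = L (Pi u) -> mu *: K v' = L (Pi u) -> v = v'.
  move=> h h'; apply/eqP; rewrite -subr_eq0; apply/eqP/Kinj; apply: (scalerI m0).
  by rewrite scaler0 (lB K) scalerBr h h' subrr.
have ex u : exists v, mu *: K v = L (Pi u) /\ nrm v <= nrm mu^-1 * (C * nrm (L (Pi u))).
  have [|y [Ly _ ny]] := hC (L (Pi u)); first by rewrite -iterSr iterS PiK linear0.
  exists (mu^-1 *: y); split; first by rewrite (lZ K) scalerA mulfV // scale1r.
  by rewrite nrmZ ler_wpM2l ?nrm_ge0.
have [u|u v v'|u u' v v'|c u v|N hN] := @linear_choice R H H (fun u v => mu *: K v = L (Pi u)).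
- by have [v [hv _]] := ex u; exists v.
- exact: uniq.
- by move=> h h'; rewrite (lD K) (lD Pi) (lD L) scalerDr h h'.
- by move=> h; rewrite (lZ K) (lZ Pi) (lZ L) -h !scalerA mulrC.
exists N; split=> //; have [D D0 hD] := bounded_op_comp bL bPi.
exists (nrm mu^-1 * (C * D)); first by rewrite !mulr_ge0 ?nrm_ge0.
move=> u; have [v [hv nv]] := ex u; rewrite (uniq _ _ _ (hN u) hv); apply: le_trans nv _.
by rewrite -!mulrA ler_wpM2l ?nrm_ge0 // ler_wpM2l.
Qed.

(** The resolvent is expanded at every sample point. Among the finitely many powers of [zeta - lam],
    only the exponent -1, with coefficient [Pi], has a nonzero integral; the remainder is at most
    the length of the inscribed polygon times a quantity proportional to [r^M |G^M|]. *)
Lemma circle_riesz (r : R) (Res : R[i] -> {linear H -> H}) (N : {linear H -> H}) (b : R) :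
  0 < r -> bounded_op N -> (forall u, mu *: K (N u) = L (Pi u)) ->
  (forall z, `|z - lam| = r%:C -> is_resolvent T z (Res z)) ->
  0 <= b -> (forall c, nrm c <= r -> forall x, nrm x <= b * nrm (x - c *: G x)) ->
  (forall e : R, 0 < e -> exists M, forall u, r ^+ M * nrm (iter M G u) <= e * nrm u) ->
  is_circle_integral lam r Res (fun u => (2 * pi *i) *: Pi u).
Proof.
move=> r0 bN NE resP b0 hb van eps eps0.
have [CG CG0 hG] := bG.
have pi0 : 0 < 2 * pi :> R by rewrite mulr_gt0 ?pi_gt0.
have bC : 0 < b * CG + 1 by rewrite ltr_wpDl ?mulr_ge0.
have eps2 : 0 < eps / 2 by rewrite divr_gt0.
(* [r * 6 * (2 * pi)] bounds the length of the polygon when the mesh is at most 1, and [b * CG]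
   bounds the regular part of the resolvent on the circle. *)
pose e1 := eps / 2 / (r * 6 * (2 * pi) * (b * CG + 1)).
have e10 : 0 < e1 by rewrite divr_gt0 // !mulr_gt0 ?pi_gt0.
have e1E : e1 * (r * 6 * (2 * pi) * (b * CG + 1)) = eps / 2.
  by rewrite divfK // gt_eqF // !mulr_gt0 ?pi_gt0.
clearbody e1; have [M hM] := van _ e10.
pose fA i f := iter i N (Pi f); pose fB k f := iter k.+1 G f.
have bGi l : bounded_op (fun x => iter l G x).
  by elim: l => [|l ih] /=; [exact: bounded_op_id|exact: (bounded_op_comp bG ih)].
have ri0 i : 0 <= r^-1 ^+ i by rewrite exprn_ge0 // invr_ge0 ltW.
have rk0 i : 0 <= r ^+ i by rewrite exprn_ge0 // ltW.
have [DA DA0 hDA] := @bounded_norm_sum _ _ _ p fA (fun i => (2 + 2 * i%:R) * r^-1 ^+ i)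
  (fun i => bounded_op_comp (bounded_op_iter i bN) bPi) (fun i => mulr_ge0 (addr_ge0 (ler0n _ 2) (mulr_ge0 (ler0n _ 2) (ler0n _ i))) (ri0 i)).
have [DB DB0 hDB] := @bounded_norm_sum _ _ _ M fB (fun k => (2 + 2 * k.+1%:R) * r ^+ k.+1)
  (fun k => bGi k.+1) (fun i => mulr_ge0 (addr_ge0 (ler0n _ 2) (mulr_ge0 (ler0n _ 2) (ler0n _ i.+1))) (rk0 i.+1)).
have D1 : 0 < DA + DB + 1 by rewrite ltr_wpDl // addr_ge0.
(* The other half of eps goes to the Riemann-sum errors, which are linear in the mesh. *)
pose dq := eps / 2 / ((DA + DB + 1) * (2 * pi)).
have dq0 : 0 < dq by rewrite divr_gt0 // !mulr_gt0 ?pi_gt0.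
exists (Num.min 1 dq); split; first by rewrite lt_min ltr01.
set d := Num.min _ _ => n t s t0 tn ts u; rewrite (nrmE u) -rmorphM nrm_norm_le.
have d1 : d <= 1 by rewrite /d ge_min lexx.
have d0 : 0 <= d by rewrite /d le_min ler01 /= ltW.
have dD : d * (2 * pi) * (DA + DB) <= eps / 2.
  have : d <= dq by rewrite /d ge_min lexx orbT.
  rewrite ler_pdivlMr ?(mulr_gt0 D1 pi0) // => h.
  apply: le_trans h; rewrite -mulrA ler_wpM2l // mulrC ler_wpM2r ?(ltW pi0) // lerDl //.
pose RS (B : R) := \sum_(j < n) (eit (t j.+1) - eit (t j)) * eit ((B - 1) * s j).
pose corr (B : R) : R[i] := if B == 0 then 2 * pi *i else 0.
have hRS (B : R) : eit (B * (2 * pi)) = 1 -> nrm (RS B - corr B) <= (2 + 2 * `|B|) * d * (2 * pi).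
  exact: riemann_eit.
have eitn k : eit (k%:R * (2 * pi)) = 1 :> R[i] by rewrite -eitX eit_2pi expr1n.
have eitNn k : eit (- k%:R * (2 * pi)) = 1 :> R[i] by rewrite mulNr eitN eitn invr1.
pose c j := r%:C * eit (s j); pose dz j := r%:C * (eit (t j.+1) - eit (t j)).
pose z j := circle_pt lam r (s j).
have zE j : z j - lam = c j by rewrite /z /circle_pt addrC addKr.
have r0' : r%:C != 0 :> R[i] by apply: contraTneq r0 => /complexI ->; rewrite ltxx.
have c0 j : c j != 0 by rewrite mulf_neq0 ?eit_neq0.
have nc j : nrm (c j) = r by rewrite nrmM nrmR gtr0_norm // nrm_eit mulr1.
have zl j : z j != lam by rewrite -subr_eq0 zE.
have resz j : is_resolvent T (z j) (Res (z j)) by apply: resP; rewrite zE nrmE nc.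
pose w j := Res (z j) u - Pi (Res (z j) u).
have nw j : nrm (w j) <= b * CG * nrm u.
  have := resolvent_regular (resz j) u; rewrite -/(w j) zE => e.
  have := hb (- c j) _ (w j); rewrite nrmN nc => /(_ (lexx _)) /le_trans; apply.
  have -> : w j - - c j *: G (w j) = G u by rewrite {1}e; hring.
  by rewrite -mulrA ler_wpM2l.
pose rem j := (dz j * (- c j) ^+ M) *: iter M G (w j).
(* In the notation of [riemann_eit], the power [(zeta - lam)^(-i-1)] has B = -i and [(zeta - lam)^k]
   has B = k + 1. *)
have term j : dz j *: Res (z j) u =
    \sum_(i < p) (r%:C^-1 ^+ i * ((eit (t j.+1) - eit (t j)) * eit ((- i%:R - 1) * s j))) *: fA i u
  + \sum_(k < M) ((-1) ^+ k * r%:C ^+ k.+1 * ((eit (t j.+1) - eit (t j)) * eit ((k.+1%:R - 1) * s j))) *: fB k u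
  + rem j.
  have -> : Res (z j) u = Pi (Res (z j) u) + w j by rewrite /w addrC subrK.
  have /= er := regular_part (resz j) u M; rewrite -/(w j) zE in er.
  rewrite (singular_part (zl j) (resz j) NE) {1}er zE.
  rewrite !scalerDr addrA; congr (_ + _ + _); last by rewrite scalerA.
    rewrite scaler_sumr; apply: eq_bigr => i _; rewrite scalerA; congr (_ *: _).
    have -> : (- i%:R - 1) * s j = - (i.+1%:R * s j) by rewrite -natr1; ring.
    rewrite eitN -eitX /dz /c exprVn exprVn exprMn exprS; field.
    by rewrite !expf_neq0 ?eit_neq0 ?r0'.
  rewrite scaler_sumr; apply: eq_bigr => k _; rewrite scalerA; congr (_ *: _).
  have -> : (k.+1%:R - 1) * s j = k%:R * s j by rewrite -natr1; ring.
  rewrite -eitX /dz /c (exprNn (r%:C * eit (s j))) [(r%:C * eit (s j)) ^+ k]exprMn exprS.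
  by move: ((-1) ^+ k) (r%:C ^+ k) (eit (s j) ^+ k) => x1 x2 x3; ring.
have main : \sum_(j < n) (circle_pt lam r (t j.+1) - circle_pt lam r (t j)) *: Res (z j) u =
    \sum_(i < p) (r%:C^-1 ^+ i * RS (- i%:R)) *: fA i u
  + \sum_(k < M) ((-1) ^+ k * r%:C ^+ k.+1 * RS k.+1%:R) *: fB k u
  + \sum_(j < n) rem j.
  transitivity (\sum_(j < n) dz j *: Res (z j) u).
    by apply: eq_bigr => j _; congr (_ *: _); rewrite /circle_pt /dz mulrBr opprD addrACA subrr add0r.
  under eq_bigr do rewrite term.
  rewrite !big_split /=; congr (_ + _ + _).
    rewrite exchange_big; apply: eq_bigr => i _.
    by rewrite -scaler_suml -mulr_sumr.
  rewrite exchange_big; apply: eq_bigr => i _.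
  by rewrite -scaler_suml -mulr_sumr.
(* Only i = 0 gives B = 0, and that term is present because p is positive. *)
have corrA : (2 * pi *i) *: Pi u = \sum_(i < p) (r%:C^-1 ^+ i * corr (- i%:R)) *: fA i u.
  rewrite -(prednK p0) big_ord_recl /= expr0 mul1r /corr oppr0 eqxx big1 ?addr0 // => i _.
  by rewrite oppr_eq0 pnatr_eq0 mulr0 scale0r.
rewrite main corrA.
set SA := \sum_(i < p) _; set SB := \sum_(k < M) _; set SC := \sum_(j < n) _; set SD := \sum_(i < p) _.
have -> : SA + SB + SC - SD = (SA - SD) + SB + SC by hring.
have hA : nrm (SA - SD) <= d * (2 * pi) * DA * nrm u.
  rewrite /SA /SD -sumrB; apply: le_trans (nrm_sum _ _ _) _.
  apply: le_trans (_ : \sum_(i < p) d * (2 * pi) * ((2 + 2 * i%:R) * r^-1 ^+ i * nrm (fA i u)) <= _); last first.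
    by rewrite -mulr_sumr -(mulrA _ DA) ler_wpM2l // mulr_ge0 ?(ltW pi0).
  apply: ler_sum => i _; rewrite -scalerBl -mulrBr nrmZ nrmM nrmX nrmV nrmR gtr0_norm //.
  have := hRS _ (eitNn i); rewrite normrN normr_nat => h.
  rewrite [X in X <= _](_ : _ = r^-1 ^+ i * nrm (fA i u) * nrm (RS (- i%:R) - corr (- i%:R))); last by ring.
  rewrite [X in _ <= X](_ : _ = r^-1 ^+ i * nrm (fA i u) * ((2 + 2 * i%:R) * d * (2 * pi))); last by ring.
  by rewrite ler_wpM2l // mulr_ge0 ?nrm_ge0.
have hB : nrm SB <= d * (2 * pi) * DB * nrm u.
  apply: le_trans (nrm_sum _ _ _) _.
  apply: le_trans (_ : \sum_(k < M) d * (2 * pi) * ((2 + 2 * k.+1%:R) * r ^+ k.+1 * nrm (fB k u)) <= _); last first.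
    by rewrite -mulr_sumr -(mulrA _ DB) ler_wpM2l // mulr_ge0 ?(ltW pi0).
  apply: ler_sum => k _; rewrite nrmZ !nrmM nrmX nrmX nrmN nrm1 expr1n mul1r nrmR gtr0_norm //.
  have := hRS _ (eitn k.+1); rewrite normr_nat /corr pnatr_eq0 subr0 => h.
  rewrite [X in X <= _](_ : _ = r ^+ k.+1 * nrm (fB k u) * nrm (RS k.+1%:R)); last by ring.
  rewrite [X in _ <= X](_ : _ = r ^+ k.+1 * nrm (fB k u) * ((2 + 2 * k.+1%:R) * d * (2 * pi))); last by ring.
  by rewrite ler_wpM2l // mulr_ge0 ?nrm_ge0.
have hC : nrm SC <= eps / 2 * nrm u.
  apply: le_trans (nrm_sum _ _ _) _.
  apply: le_trans (_ : \sum_(j < n) nrm (dz j) * (e1 * (b * CG * nrm u)) <= _).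
    apply: ler_sum => j _; rewrite nrmZ nrmM nrmX nrmN nc -mulrA ler_wpM2l ?nrm_ge0 //.
    by apply: le_trans (hM _) _; rewrite ler_wpM2l // ltW.
  rewrite -mulr_suml; have := chord_sum t0 tn ts (ltW r0); rewrite -/(dz _) => hch.
  have h6 : \sum_(j < n) nrm (dz j) <= r * 6 * (2 * pi).
    apply: le_trans hch _; rewrite ler_wpM2r ?(ltW pi0) // ler_wpM2l ?(ltW r0) //.
    by move: d1; lra.
  have r6 : 0 <= r * 6 * (2 * pi) by rewrite mulr_ge0 ?(ltW pi0) // mulr_ge0 ?(ltW r0).
  apply: le_trans (ler_wpM2r _ h6) _.
    by rewrite mulr_ge0 ?(ltW e10) // mulr_ge0 ?nrm_ge0 // mulr_ge0.
  rewrite !mulrA ler_wpM2r ?nrm_ge0 //.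
  rewrite [X in X <= _](_ : _ = e1 * (r * 6 * (2 * pi) * (b * CG))); last by ring.
  apply: le_trans (_ : e1 * (r * 6 * (2 * pi) * (b * CG + 1)) <= _).
    by rewrite ler_wpM2l ?(ltW e10) // ler_wpM2l ?lerDl.
  by rewrite e1E.
apply: le_trans (nrmD _ _) _; apply: le_trans (lerD (le_trans (nrmD _ _) (lerD hA hB)) hC) _.
rewrite -mulrDl -mulrDr -mulrDl ler_wpM2r ?nrm_ge0 //; move: dD; lra.
Qed.

(** The inverse of [1 - c G] is [1 + c w], where w is the regular part of the resolvent at
    [lam - c]; a vector with [v = c G v] would be an eigenvector for [lam - c]. *)
Lemma reduced_inverse (c : R[i]) (S : {linear H -> H}) : c != 0 -> is_resolvent T (lam - c) S ->
  (forall u, T (u, (lam - c) *: u) -> u = 0) ->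
  (forall f, exists x, x - c *: G x = f) /\
  (exists2 b : R, 0 <= b & forall x, nrm x <= b * nrm (x - c *: G x)).
Proof.
move=> c0 resS noev.
have zl : lam - c != lam by rewrite -subr_eq0 addrC addKr oppr_eq0.
pose w f := S f - Pi (S f).
have wE f : w f = G f + c *: G (w f).
  by rewrite /w {1}(resolvent_regular resS); hring.
have inj v : v - c *: G v = 0 -> v = 0.
  move=> /eqP; rewrite subr_eq0 => /eqP vE; apply: noev.
  have Pv : Pi v = 0 by rewrite vE (lZ Pi) PiG scaler0.
  suff h : op_shift T lam (v, (lam - c - lam) *: v - 0) by have := shift_T h; rewrite subr0.
  apply/shiftP; rewrite subr0 (lZ K) {1}vE /G !(lZ L) LJ -KPi Pv linear0 subr0 -/mu; hring.
have sol f : f + c *: w f - c *: G (f + c *: w f) = f.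
  by rewrite GD GZ {1}wE; hring.
split=> [f|]; first by exists (f + c *: w f).
case: resS => /continuous_bounded_op bS _ _.
have [C C0 hC] : bounded_op (fun f => f + c *: w f).
  apply: bounded_opD; first exact: bounded_op_id.
  by apply: bounded_opZ; apply: bounded_opB => //; exact: bounded_op_comp bPi bS.
exists C => // x; set g := x - c *: G x.
suff -> : x = g + c *: w g by have := hC g; rewrite -/(w g).
apply/eqP; rewrite -subr_eq0; apply/eqP/inj.
have -> : x - (g + c *: w g) - c *: G (x - (g + c *: w g)) =
  (x - c *: G x) - (g + c *: w g - c *: G (g + c *: w g)) by rewrite GB; hring.
by rewrite sol subrr.
Qed.

(** For every nonzero c with |c| <= r, [lam - c] is not an eigenvalue, so it has a resolvent and
    [1 - c G] is invertible. This is the input of the spectral radius argument, the boundary circle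
    included. *)
Lemma riesz_projectionP :
  (forall z, (forall u, T (u, z *: u) -> u = 0) -> exists S : {linear H -> H}, is_resolvent T z S) ->
  is_riesz_projection T lam Pi.
Proof.
move=> res_ex; split; [exact: bounded_op_continuous|exact: isolating_exists|].
move=> r [r0 isor].
have noev z : nrm (z - lam) <= r -> z != lam -> forall u, T (u, z *: u) -> u = 0.
  move=> zr zl u hT; apply/eqP; apply: contraNT zl => u0; apply/eqP.
  by apply: isor; [exists u|rewrite nrm_norm_le].
have /choice[Res hRes] (z : R[i]) : exists S : {linear H -> H}, `|z - lam| = r%:C -> is_resolvent T z S.
  (* [K] is a default value for points off the circle. *)
  have [zr|] := pselect (`|z - lam| = r%:C); last by move=> h; exists K.
  have zr' : nrm (z - lam) = r by apply: complexI; rewrite -nrmE.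
  have zl : z != lam by apply: contraTneq r0 => zl; rewrite -zr' zl subrr nrm0 ltxx.
  have zr1 : nrm (z - lam) <= r by rewrite zr'.
  by have [S hS] := res_ex z (noev z zr1 zl); exists S.
exists Res; split=> //.
have [gl glE] := @mklin R H H G GD GZ.
have iglE k u : iter k gl u = iter k G u by elim: k => //= k ->.
have bgl : bounded_op gl by have [C C0 hC] := bG; exists C => // x; rewrite glE.
have inv c : nrm c <= r -> (forall f, exists x, x - c *: G x = f) /\
  (exists2 b : R, 0 <= b & forall x, nrm x <= b * nrm (x - c *: G x)).
  move=> cr; have [->|c0] := eqVneq c 0.
    split=> [f|]; first by exists f; rewrite scale0r subr0.
    by exists 1 => // x; rewrite scale0r subr0 mul1r.
  have nv : forall u, T (u, (lam - c) *: u) -> u = 0.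
    apply: noev; first by rewrite addrC addKr nrmN.
    by rewrite -subr_eq0 addrC addKr oppr_eq0.
  have [S hS] := res_ex _ nv; exact: reduced_inverse hS nv.
have surj c : nrm c <= r -> forall f, exists x, x - c *: gl x = f.
  by move=> /inv[h _] f; have [x hx] := h f; exists x; rewrite glE.
have bnd c : nrm c <= r -> exists2 b : R, 0 <= b & forall x, nrm x <= b * nrm (x - c *: gl x).
  by move=> /inv[_ [b b0 hb]]; exists b => // x; rewrite glE.
have [b b0 hb] := uniform_inverse_bound bgl bnd.
have van := spectral_radius_vanish bgl (ltW r0) surj bnd.
have [N [bN NE]] := nilpotent_part.
apply: (circle_riesz r0 bN NE hRes b0).
  by move=> c cr x; have := hb c cr x; rewrite glE.
move=> e e0; have [k0 hk0] := van e e0; exists (2 ^ k0)%N => u.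
by have := hk0 k0 (leqnn _) u; rewrite iglE.
Qed.

End SpectralPoint.

(** * Spectral decomposition of an operator with compact resolvent *)

Lemma adjoint_bounded (R : realType) (H : hilbertType R) (K K' : {linear H -> H}) :
  bounded_op K -> (forall u v, dot (K u) v = dot u (K' v)) -> bounded_op K'.
Proof.
move=> [C C0 hC] adj; exists C => // v.
have [->|v0] := eqVneq (K' v) 0; first by rewrite nrm0 mulr_ge0 ?nrm_ge0.
have n0 := nrm_gt0 v0; rewrite -(ler_pM2l n0) -expr2.
have -> : nrm (K' v) ^+ 2 = nrm (dot (K (K' v)) v).
  by rewrite adj dot_self nrmR ger0_norm ?sqr_ge0.
apply: le_trans (CauchySchwarz _ _) _; rewrite mulrA ler_wpM2r ?nrm_ge0 //.
by rewrite mulrC hC.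
Qed.

Section OperatorTheorem.
Variables (R : realType) (H : hilbertType R) (T : set (H * H)%type) (K : {linear H -> H}) (z0 : R[i]).
Hypothesis TE : forall u v, T (u, v) <-> u = K (z0 *: u - v).
Hypothesis Kinj : forall w, K w = 0 -> w = 0.
Hypotheses (bK : bounded_op K) (cK : compact_op K).

Lemma resolvent_z0 : is_resolvent T z0 K.
Proof.
split=> [|u|u v /TE <- //]; first exact: bounded_op_continuous.
by apply/TE; rewrite subKr.
Qed.

(** Fredholm alternative: without eigenvectors L is injective, so [Pi = 0] because its range is
    killed by [L^p], and the reduced resolvent is the full one. *)
Lemma resolvent_exists z : (forall u, T (u, z *: u) -> u = 0) ->
  exists S : {linear H -> H}, is_resolvent T z S.
Proof.
move=> noev; have [->|zz] := eqVneq z z0; first by exists K; exact: resolvent_z0.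
have [K' adjK] := adjoint_ex (lD K) (lZ K) bK.
have [L LE] := linearized_op K (z0 - z)^-1.
have m0 := mu_neq0 zz.
have [p [Pi [J [p0 [bPi bJ PiK Pi_id [LJ JL KPi PiJ JPi]]]]]] :=
  riesz_decomposition bK cK adjK m0 LE.
have kerL u : L u = 0 -> u = 0.
  move=> Lu; apply: noev; have : op_shift T z (u, 0).
    by apply/(shiftE TE zz LE); rewrite Lu linear0 scaler0.
  by rewrite /op_shift /= add0r.
have Pi0 u : Pi u = 0.
  by move: (PiK u); elim: p {p0 PiK} => //= k ih /kerL /ih.
have [x y|c x|S SE] := @mklin R H H (reduced_resolvent K J z0 z).
- exact: GD.
- exact: GZ.
exists S; have bS : bounded_op S.
  by have [C C0 hC] := @bG _ _ K J z0 z bK bJ; exists C => // x; rewrite SE.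
split=> [|u|u v huv]; first exact: bounded_op_continuous.
  have h := shift_G TE zz LE LJ KPi u; rewrite -SE Pi0 subr0 in h.
  by have := h; rewrite /op_shift /= addrC.
have h := shift_inv TE zz LE JL (u := u) (v := v - z *: u); rewrite Pi0 subr0 -SE in h.
have -> : z *: u - v = - (v - z *: u) by rewrite opprB.
by rewrite (lN S) -h // /op_shift /= subrK.
Qed.

Lemma spectrum_eigen z : spectrum T z -> z != z0 /\ exists u, u != 0 /\ T (u, z *: u).
Proof.
move=> sz; split.
  by apply: contra_notN sz => /eqP ->; exists K; exact: resolvent_z0.
apply: contrapT => h; apply: sz; apply: resolvent_exists => u hu.
by apply/eqP; apply: contra_notT h => u0; exists u.
Qed.

(** The adjoint has the same description with [K'] and the conjugate of [z0], so the lemmas on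
    generalized kernels apply to it unchanged. *)
Lemma op_adjointE (K' : {linear H -> H}) : (forall u v, dot (K u) v = dot u (K' v)) ->
  forall v w, op_adjoint T (v, w) <-> v = K' (cj z0 *: v - w).
Proof.
move=> adj v w; split=> [h|h u u' /TE hu] /=.
  apply: dot_eq_r => f; rewrite -adj dotBr dotZr cjK.
  have := h (K f) (z0 *: K f - f); rewrite /= dotBl dotZl => <-; first by rewrite opprB addrC subrK.
  by apply/TE; rewrite subKr.
have : dot (z0 *: u - u') v = dot u (cj z0 *: v - w) by rewrite {1}h -adj -hu.
by rewrite dotBl dotZl dotBr dotZr cjK => /addrI/oppr_inj.
Qed.

(** The last clause, that the projection at lam kills the generalized eigenspaces at other points,
    yields both the independence of these spaces and their inclusion in the kernel. *)
Lemma spectral_package lam : lam != z0 -> exists Pi : {linear H -> H},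
  let E := gen_eigenspace T in
  let E' := orthocomp (gen_eigenspace (op_adjoint T) (cj lam)) in
  [/\ finite_dim_subspace (E lam),
      exists nu : nat, (1 <= nu)%N /\ E lam = op_ker (op_pow (op_shift T lam) nu),
      is_riesz_projection T lam Pi,
      projection_onto_along Pi (E lam) E'
    & forall z u, z != lam -> z != z0 -> E z u -> Pi u = 0].
Proof.
move=> lz; have [K' adjK] := adjoint_ex (lD K) (lZ K) bK.
have bK' := adjoint_bounded bK adjK.
have [L LE] := linearized_op K (z0 - lam)^-1.
have m0 := mu_neq0 lz.
have [p [Pi [J [p0 [bPi bJ PiK Pi_id [LJ JL KPi PiJ JPi]]]]]] :=
  riesz_decomposition bK cK adjK m0 LE.
have bL := L_bounded bK LE.
have EP := gen_eigenspaceE TE lz LE bL.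
have [M [b [hM _]]] := gen_kernel_finite cK adjK m0 LE.
have PiPi' u : Pi (Pi u) = Pi u by exact: (Pi_id _ _ (PiK u)).
have EPi u : gen_eigenspace T lam u <-> Pi u = u.
  split=> [/EP[l /Pi_id]//|<-]; apply/EP; by exists p.
exists Pi => E E'; split.
- exists M, b => u; rewrite -hM; exact: EP.
- exists p; split=> //; rewrite predeqE => u; split=> [/EPi <-|h].
    by apply/(op_ker_iter TE lz LE bL).
  by exists p.
- exact: (riesz_projectionP TE Kinj bK lz LE bL p0 bPi bJ PiK Pi_id LJ JL KPi PiJ JPi resolvent_exists).
- split=> //.
    by rewrite eqEsubset; split=> [_ [u _ <-]|u /EPi <-]; [apply/EPi|exists u].
  have lz' : cj lam != cj z0 by apply: contra_neq lz => h; rewrite -(cjK lam) h cjK.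
  have TE' := op_adjointE adjK.
  have [L' LE'] := linearized_op K' (cj z0 - cj lam)^-1.
  have bL' := L_bounded bK' LE'.
  have E'P := gen_eigenspaceE TE' lz' LE' bL'.
  have adjL u v : dot (L u) v = dot u (L' v).
    rewrite LE LE' dotBl dotZl dotBr dotZr adjK; congr (_ - _ * _).
    by rewrite cjV cjD cjN !cjK.
  have adjLi l u v : dot (iter l L u) v = dot u (iter l L' v).
    by elim: l u v => //= l ih u v; rewrite adjL ih -iterSr.
  rewrite eqEsubset; split=> u /=.
    move=> Pu v /E'P[l hl].
    (* On the kernel of [Pi], [J^k] is a right inverse of [L^k]; so u lies in the range of every
       power of L, which is orthogonal to the kernel of the same power of [L']. *)
    have JJ k : iter k L (iter k J u) = u.
      elim: k => // k ih; rewrite iterSr /= LJ (_ : Pi _ = 0) ?subr0 //.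
      by case: k {ih} => //= k; rewrite PiJ.
    by rewrite -(JJ l) adjLi hl dot0r.
  move=> hu; have sR : subsp [set x | Pi x = 0].
    split=> /= [|x y hx hy|c x hx]; first exact: linear0.
      by rewrite (lD Pi) hx hy addr0.
    by rewrite (lZ Pi) hx scaler0.
  have cR : closedE [set x | Pi x = 0].
    have [C C0 hC] := bPi; move=> x h /=; apply: nrm_eps0 => e e0.
    have C1 : 0 < C + 1 by rewrite ltr_wpDl.
    have [|y /= yG xy] := h (e / (C + 1)); first by rewrite divr_gt0.
    have -> : Pi x = Pi (x - y) by rewrite (lB Pi) yG subr0.
    apply: le_trans (hC _) _; apply: le_trans (ler_wpM2l C0 xy) _.
    by rewrite mulrCA ler_piMr ?(ltW e0) // ler_pdivrMr // mul1r lerDl.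
  (* Conversely, the kernel of [Pi] is closed and contains the range of [L^p], so a vector v
     orthogonal to it satisfies [L'^p v = 0], and u is orthogonal to all such v. *)
  apply: (orthocompK sR cR) => v hv; apply: hu; apply/E'P; exists p.
  apply: dot_eq_r => x; rewrite -adjLi dot0r dot_cj hv ?cj0 //=.
  by rewrite -(iter_commute (LPi LE KPi)) PiK.
(* A power of [Lz] kills [Pi u]; the last nonzero image would be an eigenvector for z fixed by [Pi],
   against [eigen_in_kernel]. *)
- move=> z u zl zz; have [Lz LzE] := linearized_op K (z0 - z)^-1.
  have bLz := L_bounded bK LzE.
  move=> /(gen_eigenspaceE TE zz LzE bLz)[l hl].
  have LzPi x : Lz (Pi x) = Pi (Lz x) by rewrite !LzE KPi (lB Pi) (lZ Pi).
  have : iter l Lz (Pi u) = 0 by rewrite (iter_commute LzPi) hl linear0.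
  elim: l {hl} => //= l ih hl; apply: ih.
  have PiE : Pi (iter l Lz (Pi u)) = iter l Lz (Pi u) by rewrite -(iter_commute LzPi) PiPi'.
  rewrite -PiE; apply: (eigen_in_kernel TE Kinj lz LE PiK KPi zl).
  have : op_shift T z (iter l Lz (Pi u), 0).
    by apply/(shiftE TE zz LzE); rewrite hl linear0 scaler0.
  by rewrite /op_shift /= add0r.
Qed.

Theorem spectral_decomposition lam : spectrum T lam ->
  let E := gen_eigenspace T in
  let E' := orthocomp (gen_eigenspace (op_adjoint T) (cj lam)) in
  [/\ finite_dim_subspace (E lam) /\
        exists nu : nat, (1 <= nu)%N /\ E lam = op_ker (op_pow (op_shift T lam) nu),
      (exists Pi : {linear H -> H},
          is_riesz_projection T lam Pi /\ projection_onto_along Pi (E lam) E') /\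
        direct_decomposition (E lam) E' &
      family_independent (spectrum T `\ lam) E /\ family_sum (spectrum T `\ lam) E `<=` E'].
Proof.
move=> sl E E'; have [lz _] := spectrum_eigen sl.
have [Pi [fdE nuE rP pP killP]] := spectral_package lz.
have [PP rgP kerP] := pP.
have PE u : E lam u -> Pi u = u by rewrite /E -rgP => -[x _ <-].
split=> //.
- split; first by exists Pi.
  split=> [u|u Eu E'u]; last first.
    have : [set u | Pi u = 0] u by rewrite kerP.
    by rewrite /= PE.
  exists (Pi u), (u - Pi u); split; last by rewrite addrC subrK.
    by rewrite /E -rgP; exists u.
  by rewrite /E' -kerP /= (lB Pi) PP subrr.
split.
  move=> s x us hs s0 i si; have [[Ii nil] Ei] := hs i si.
  have [iz _] := spectrum_eigen Ii.
  have [Pii [_ _ _ [PPi rgPi _] killPi]] := spectral_package iz.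
  (* The projection at i leaves only [x i] in a vanishing sum. *)
  have : Pii (\sum_(j <- s) x j) = 0 by rewrite s0 linear0.
  rewrite linear_sum (bigD1_seq i) //= big_seq_cond big1 ?addr0.
    by move: Ei; rewrite /E -rgPi => -[y _ <-]; rewrite PPi.
  move=> j /andP[sj ji]; have [[Ij _] Ej] := hs j sj; have [jz _] := spectrum_eigen Ij.
  exact: killPi Ej.
move=> u [s [x [us hs ->]]]; rewrite /E' -kerP /= linear_sum big_seq big1 // => i si.
have [[Ii nil] Ei] := hs i si; have [iz _] := spectrum_eigen Ii.
by apply: killP Ei => //; apply/eqP.
Qed.

End OperatorTheorem.

(** * Unitaries, phases and density of polynomials in the noncommutative torus *)

HB.instance Definition _ (R : realType) (A : cstarAlgType R) :=
  Monoid.isLaw.Build A aone (@amul R A) (@amulA R A) (@amul1l R A) (@amul1r R A).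

Section CStar.
Variables (R : realType) (A : cstarAlgType R).
Implicit Types a b c u v w : A.

Lemma amul0l a : 0 *c a = 0.
Proof. by apply: (addrI (0 *c a)); rewrite -amulDl !addr0. Qed.

Lemma amul0r a : a *c 0 = 0.
Proof. by apply: (addrI (a *c 0)); rewrite -amulDr !addr0. Qed.

Lemma amulNl a b : (- a) *c b = - (a *c b).
Proof. by apply/eqP; rewrite -addr_eq0 -amulDl addNr amul0l. Qed.

Lemma amulNr a b : a *c (- b) = - (a *c b).
Proof. by apply/eqP; rewrite -addr_eq0 -amulDr addNr amul0r. Qed.

Lemma amulBl a b c : (a - b) *c c = a *c c - b *c c.
Proof. by rewrite amulDl amulNl. Qed.

Lemma amulBr a b c : a *c (b - c) = a *c b - a *c c.
Proof. by rewrite amulDr amulNr. Qed.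

Lemma star0 : star (0 : A) = 0.
Proof. by apply: (addrI (star 0)); rewrite -starD !addr0. Qed.

Lemma starN a : star (- a) = - star a.
Proof. by apply/eqP; rewrite -addr_eq0 -starD addNr star0. Qed.

Lemma starB a b : star (a - b) = star a - star b.
Proof. by rewrite starD starN. Qed.

Lemma starZc (c : R[i]) a : star (c *: a) = cj c *: star a.
Proof. exact: starZ. Qed.

Lemma star1 : star (aone : A) = aone.
Proof. by have := starM (star aone) (aone : A); rewrite amul1r starK amul1r. Qed.

Lemma nrm_amul a b : nrm (a *c b) <= nrm a * nrm b.
Proof. by rewrite -lecR rmorphM /= -!nrmE cstar_normM. Qed.

Lemma nrm_starE a : nrm (star a *c a) = nrm a ^+ 2.
Proof. by apply: complexI; rewrite rmorphXn /= -!nrmE cstar_normE. Qed.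

Lemma nrm_star a : nrm (star a) = nrm a.
Proof.
have h b : nrm b <= nrm (star b).
  have [->|b0] := eqVneq b 0; first by rewrite nrm0 nrm_ge0.
  rewrite -(ler_pM2r (nrm_gt0 b0)) -expr2 -nrm_starE; exact: nrm_amul.
by apply/eqP; rewrite eq_le h -{2}(starK a) h.
Qed.

Lemma nrm_aone : nrm (aone : A) <= 1.
Proof.
have := nrm_starE (aone : A); rewrite star1 amul1l expr2 => /eqP.
have := nrm_ge0 (aone : A); move: (nrm _) => x x0; rewrite -{1}[x]mulr1 -subr_eq0 -mulrBr mulf_eq0.
by case/orP => [/eqP -> //|]; rewrite subr_eq0 => /eqP <-.
Qed.

Lemma nrm_unitary u : unitary u -> nrm u <= 1.
Proof.
move=> [u1 _]; rewrite -(@ler_pXn2r _ 2) ?nnegrE ?nrm_ge0 // expr1n -nrm_starE u1.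
exact: nrm_aone.
Qed.

Lemma unitaryM u v : unitary u -> unitary v -> unitary (u *c v).
Proof.
move=> [u1 u2] [v1 v2]; split; rewrite starM.
  by rewrite -amulA (amulA (star u)) u1 amul1l.
by rewrite -amulA (amulA v) v2 amul1l.
Qed.

Lemma unitary1 : unitary (aone : A).
Proof. by split; rewrite star1 amul1l. Qed.

Lemma unitary_star u : unitary u -> unitary (star u).
Proof. by move=> [u1 u2]; split; rewrite starK. Qed.

Lemma unitary_iter u k : unitary u -> unitary (iter k (amul u) aone).
Proof. by move=> uu; elim: k => [|k ih] /=; [exact: unitary1|exact: unitaryM]. Qed.

Lemma unitary_upow u z : unitary u -> unitary (upow u z).
Proof. by move=> uu; case: z => k; apply: (@unitary_iter _ k) || apply: (@unitary_iter _ k.+1); [|exact: unitary_star]. Qed.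

(** Equality up to a unimodular scalar. The cocycle of the torus is never computed: estimates see
    absolute values only, and in identities the same scalar multiplies all terms. *)
Definition phase a b := exists2 c : R[i], nrm c = 1 & a = c *: b.

Lemma phase_refl a : phase a a.
Proof. by exists 1; rewrite ?nrm1 ?scale1r. Qed.

Lemma phase_sym a b : phase a b -> phase b a.
Proof.
move=> [c c1 ->]; have c0 : c != 0 by apply: contra_eq_neq c1 => ->; rewrite nrm0 eq_sym oner_neq0.
by exists c^-1; rewrite ?nrmV ?c1 ?invr1 // scalerA mulVf // scale1r.
Qed.

Lemma phase_trans b a c : phase a b -> phase b c -> phase a c.
Proof. by move=> [x x1 ->] [y y1 ->]; exists (x * y); rewrite ?nrmM ?x1 ?y1 ?mulr1 // scalerA. Qed.

Lemma phase_mul a a' b b' : phase a a' -> phase b b' -> phase (a *c b) (a' *c b').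
Proof.
move=> [x x1 ->] [y y1 ->]; exists (x * y); first by rewrite nrmM x1 y1 mulr1.
by rewrite amulZl amulZr scalerA.
Qed.

Lemma phase_star a b : phase a b -> phase (star a) (star b).
Proof. by move=> [x x1 ->]; exists (cj x); rewrite ?nrmJ // starZc. Qed.

Definition pcomm a b := phase (a *c b) (b *c a).

Lemma pcomm_sym a b : pcomm a b -> pcomm b a.
Proof. exact: phase_sym. Qed.

Lemma pcomm1 a : pcomm a aone.
Proof. by rewrite /pcomm amul1l amul1r; exact: phase_refl. Qed.

Lemma pcommM a b c : pcomm a b -> pcomm a c -> pcomm a (b *c c).
Proof.
move=> ab ac; rewrite /pcomm amulA; apply: (phase_trans (b := (b *c a) *c c)).
  by apply: phase_mul => //; exact: phase_refl.
by rewrite -!amulA; apply: phase_mul => //; exact: phase_refl.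
Qed.

Lemma pcomm_star a u : unitary u -> pcomm a u -> pcomm a (star u).
Proof.
move=> [u1 u2] au; rewrite /pcomm.
have -> : a *c star u = star u *c (u *c a) *c star u by rewrite amulA u1 amul1l.
have -> : star u *c a = star u *c (a *c u) *c star u by rewrite -!amulA u2 amul1r.
by do 2 (apply: phase_mul; last exact: phase_refl || exact: phase_sym); exact: phase_refl.
Qed.

Lemma pcomm_iter a u k : pcomm a u -> pcomm a (iter k (amul u) aone).
Proof. by move=> au; elim: k => [|k ih] /=; [exact: pcomm1|exact: pcommM]. Qed.

Lemma pcomm_upow a u z : unitary u -> pcomm a u -> pcomm a (upow u z).
Proof.
by move=> uu au; case: z => k; [exact: pcomm_iter|apply: (@pcomm_iter _ _ k.+1); exact: pcomm_star].
Qed.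

Lemma upowS u z : unitary u -> upow u (1 + z) = u *c upow u z.
Proof.
move=> [u1 u2]; case: z => [k|[|k]] //.
- by rewrite /= amul1r u2.
have -> : (1 + Negz k.+1)%R = Negz k by rewrite !NegzE -[k.+2]addn1 PoszD opprD addrCA addrN addr0.
by rewrite /= amulA u2 amul1l.
Qed.

Lemma upowD u (z w : int) : unitary u -> upow u (z + w) = upow u z *c upow u w.
Proof.
move=> uu; have [u1 u2] := uu; elim/int_rect: z => [|k ih|k ih].
- by rewrite add0r amul1l.
- by rewrite -[k.+1]add1n PoszD -addrA !upowS // ih amulA.
have inj a b : u *c a = u *c b -> a = b.
  by move=> h; rewrite -(amul1l a) -u1 -amulA h amulA u1 amul1l.
apply: inj; rewrite amulA -!upowS // addrA.
have -> : 1 + - k.+1%:Z = - k%:Z by rewrite -[k.+1]add1n PoszD opprD addNKr.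
by rewrite ih.
Qed.

Lemma phase_prod (I : Type) (r : seq I) (f g h : I -> A) :
  (forall i, h i = f i *c g i) -> (forall i j, pcomm (g i) (f j)) ->
  phase ((\big[amul/aone]_(i <- r) f i) *c (\big[amul/aone]_(i <- r) g i)) (\big[amul/aone]_(i <- r) h i).
Proof.
move=> hE cm; elim: r => [|x r ih]; first by rewrite !big_nil amul1l; exact: phase_refl.
rewrite !big_cons hE; set F := \big[amul/aone]_(i <- r) f i; set G := \big[amul/aone]_(i <- r) g i.
have cF : pcomm (g x) F.
  by rewrite /F; elim/big_rec: _ => [|j y _]; [exact: pcomm1|exact: pcommM].
have -> : f x *c F *c (g x *c G) = f x *c (F *c g x) *c G by rewrite !amulA.
apply: (phase_trans (b := (f x *c (g x *c F)) *c G)).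
  apply: phase_mul; last exact: phase_refl.
  by apply: phase_mul; [exact: phase_refl|exact: pcomm_sym].
by rewrite !amulA -(amulA _ F); apply: phase_mul; [exact: phase_refl|exact: ih].
Qed.

End CStar.

Section TorusBasics.
Variables (R : realType) (n : nat) (theta : 'M[R]_n) (A : nctorus theta).
Implicit Types (a b u v : A) (j k l p : 'rV[int]_n).
Local Notation tau := (nct_tr A).
Local Notation U := (Uk A).
Let gen := @nct_gen R n theta A.

Lemma gen_unitary i : unitary (gen i).
Proof. by case: (nct_univ A) => -[h _] _ _; exact: h. Qed.

Lemma gen_comm (i j : 'I_n) : pcomm (gen i) (gen j).
Proof.
case: (nct_univ A) => -[_ h] _ _; rewrite /pcomm /gen h; exists (eit (2 * pi * theta j i)) => //.
exact: nrm_eit.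
Qed.

Lemma upow_comm (i j : 'I_n) (z w : int) : pcomm (upow (gen i) z) (upow (gen j) w).
Proof.
apply: (pcomm_upow _ (gen_unitary j)); apply: pcomm_sym; apply: (pcomm_upow _ (gen_unitary i)).
exact: gen_comm.
Qed.

Lemma U_unitary k : unitary (U k).
Proof.
rewrite /Uk /umonom; elim/big_rec: _ => [|i x _]; first exact: unitary1.
by apply: unitaryM; apply: unitary_upow; exact: gen_unitary.
Qed.

Lemma U_mul k l : phase (U k *c U l) (U (k + l)).
Proof.
apply: phase_prod => [i|i j]; last exact: upow_comm.
by rewrite mxE; apply: upowD; exact: gen_unitary.
Qed.

Lemma U0 : U 0 = aone.
Proof. by rewrite /Uk /umonom big1 // => i _; rewrite mxE. Qed.

Lemma U_gen i : U (delta_mx 0 i) = gen i.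
Proof.
rewrite /Uk /umonom (big_only1 i) //; first by rewrite mxE !eqxx /= amul1r.
by move=> j ji _; rewrite mxE eqxx (negPf ji).
Qed.

Lemma UUstar j k : phase (U j *c star (U k)) (U (j - k)).
Proof.
have [_ u2] := U_unitary k; apply: phase_sym.
rewrite -[U (j - k)]amul1r -u2 amulA; apply: phase_mul; last exact: phase_refl.
by have := U_mul (j - k) k; rewrite subrK.
Qed.

Lemma nrm_U k : nrm (U k) <= 1.
Proof. exact/nrm_unitary/U_unitary. Qed.

Lemma tau_le a : nrm (tau a) <= nrm a.
Proof. by case: (nct_trP A) => h _ _ _; rewrite -lecR -!nrmE. Qed.

Lemma tau_comm a b : tau (a *c b) = tau (b *c a).
Proof. by case: (nct_trP A). Qed.

Lemma tau_U k : tau (U k) = (k == 0)%:R.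
Proof. by case: (nct_trP A) => _ _ _; apply. Qed.

Lemma tauD a b : tau (a + b) = tau a + tau b. Proof. exact: linearD. Qed.
Lemma tauZ (c : R[i]) a : tau (c *: a) = c * tau a. Proof. exact: linearZ. Qed.
Lemma tauN a : tau (- a) = - tau a. Proof. exact: linearN. Qed.
Lemma tau0 : tau 0 = 0. Proof. exact: linear0. Qed.

Lemma fourierD a b k : fourier (a + b) k = fourier a k + fourier b k.
Proof. by rewrite /fourier amulDl tauD. Qed.

Lemma fourierZ (c : R[i]) a k : fourier (c *: a) k = c * fourier a k.
Proof. by rewrite /fourier amulZl tauZ. Qed.

Lemma fourierN a k : fourier (- a) k = - fourier a k.
Proof. by rewrite /fourier amulNl tauN. Qed.

Lemma fourierB a b k : fourier (a - b) k = fourier a k - fourier b k.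
Proof. by rewrite fourierD fourierN. Qed.

Lemma fourier0 k : fourier (0 : A) k = 0.
Proof. by rewrite /fourier amul0l tau0. Qed.

Lemma fourier_sum (I : Type) (r : seq I) (P : pred I) (F : I -> A) k :
  fourier (\sum_(i <- r | P i) F i) k = \sum_(i <- r | P i) fourier (F i) k.
Proof. by elim/big_rec2: _ => [|i y x _ <-]; rewrite ?fourier0 ?fourierD. Qed.

Lemma fourier_le a k : nrm (fourier a k) <= nrm a.
Proof.
apply: le_trans (tau_le _) _; apply: le_trans (nrm_amul _ _) _.
by rewrite ler_piMr ?nrm_ge0 // nrm_star nrm_U.
Qed.

Lemma fourier_U j k : fourier (U j) k = (j == k)%:R.
Proof.
rewrite /fourier; have [<-|jk] := eqVneq j k.
  by have [_ ->] := U_unitary j; rewrite -U0 tau_U eqxx.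
by have [c _ ->] := UUstar j k; rewrite tauZ tau_U subr_eq0 (negPf jk) mulr0.
Qed.

Lemma fourier_mulU k j : exists2 c : R[i], nrm c = 1 &
  forall a, fourier (a *c U k) j = c * fourier a (j - k).
Proof.
have [c c1 h] := phase_star (UUstar j k); exists c => // a.
by rewrite /fourier -amulA -tauZ -amulZr -h starM starK.
Qed.

Lemma nrm_fourier_mulU a k j : nrm (fourier (a *c U k) j) = nrm (fourier a (j - k)).
Proof. by have [c c1 ->] := fourier_mulU k j; rewrite nrmM c1 mul1r. Qed.

Lemma fourier_aone k : fourier (aone : A) k = (k == 0)%:R.
Proof. by rewrite -U0 fourier_U eq_sym. Qed.

(** [V] is the smallest closed subspace containing the monomials. The elements that, together with
    their adjoints, multiply [V] into itself form a closed selfadjoint subalgebra containing the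
    generators, hence everything; applied to the unit, they are seen to lie in [V]. *)
Lemma polynomials_dense (W : set A) : closedE W -> subsp W -> (forall k, W (U k)) -> forall a, W a.
Proof.
move=> cW sW WU.
pose V := [set a : A | forall W : set A, closedE W -> subsp W -> (forall k, W (U k)) -> W a].
suff h : forall a, V a by move=> a; exact: (h a W cW sW WU).
move=> a.
have [V0 VD VZ] : subsp V.
  split=> [W' _ [] //|x y Vx Vy W' cW' sW' WU'|c x Vx W' cW' sW' WU']; case: (sW') => _ sD sZ.
    by apply: sD; [exact: (Vx W')|exact: (Vy W')].
  by apply: sZ; exact: (Vx W').
have cV : closedE V.
  move=> x h W' cW' sW' WU'; apply: (cW') => e /h[y Vy xy]; exists y => //; exact: (Vy W').
have VU k : V (U k) by move=> W' _ _; apply.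
have Vmul g : (forall k, V (g *c U k)) -> forall b, V b -> V (g *c b).
  move=> hg b Vb W' cW' sW' WU'; have [s0 sD sZ] := sW'.
  apply: (Vb [set b | W' (g *c b)]) => [x h|| k] /=; last exact: hg.
    apply: cW' => e e0; have g1 : 0 < nrm g + 1 by rewrite ltr_wpDl ?nrm_ge0.
    have [|y /= yW xy] := h (e / (nrm g + 1)); first by rewrite divr_gt0.
    exists (g *c y) => //; rewrite -amulBr; apply: le_trans (nrm_amul _ _) _.
    apply: le_trans (ler_wpM2l (nrm_ge0 _) xy) _.
    by rewrite mulrCA ler_piMr ?(ltW e0) // ler_pdivrMr // mul1r lerDl.
  split=> /= [|x y hx hy|c x hx]; first by rewrite amul0r.
    by rewrite amulDr; apply: sD.
  by rewrite amulZr; apply: sZ.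
have Vphase x y : phase x y -> V y -> V x by move=> [c _ ->]; apply: VZ.
pose S := [set a : A | forall b, V b -> V (a *c b) /\ V (star a *c b)].
have Sgen i : S (gen i).
  move=> b Vb; split; apply: Vmul => // k.
    by rewrite -U_gen; apply: (Vphase _ _ (U_mul _ _)).
  apply: (Vphase _ (U (k - delta_mx 0 i))) => //.
  have [u1 _] := gen_unitary i; rewrite -[U (k - _)]amul1l -u1 -amulA.
  apply: phase_mul; first exact: phase_refl.
  by apply: phase_sym; rewrite -{1}U_gen -{2}(subrKC (delta_mx 0 i) k); exact: U_mul.
case: (nct_univ A) => _ /(_ S) cg _.
have SV (x : A) : S x -> V x by move=> /(_ (U 0) (VU 0))[]; rewrite U0 amul1r.
apply: SV; apply: cg => //.
- apply/closedEP => y h b Vb.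
  have b1 : 0 < nrm b + 1 by rewrite ltr_wpDl ?nrm_ge0.
  have app (e : R) (x' y' : A) : 0 < e -> nrm (x' - y') <= e / (nrm b + 1) -> nrm (x' *c b - y' *c b) <= e.
    move=> e0 xy; rewrite -amulBl; apply: le_trans (nrm_amul _ _) _.
    apply: le_trans (ler_wpM2r (nrm_ge0 _) xy) _.
    by rewrite mulrAC ler_pdivrMr // ler_wpM2l ?(ltW e0) // lerDl.
  split; apply: cV => e e0.
    have [|z Sz yz] := h (e / (nrm b + 1)); first by rewrite divr_gt0.
    by exists (z *c b); [case: (Sz b Vb)|exact: app].
  have [|z Sz yz] := h (e / (nrm b + 1)); first by rewrite divr_gt0.
  exists (star z *c b); first by case: (Sz b Vb).
  by apply: app => //; rewrite -starB nrm_star.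
- by move=> b Vb; rewrite star1 amul1l.
- by move=> y z Sy Sz b Vb; rewrite starD !amulDl; split; apply: VD; case: (Sy b Vb); case: (Sz b Vb).
- move=> y z Sy Sz b Vb; rewrite starM -!amulA; split.
    by case: (Sz b Vb) => /Sy[].
  by case: (Sy b Vb) => _ /Sz[].
- by move=> c y Sy b Vb; rewrite starZc !amulZl; split; apply: VZ; case: (Sy b Vb).
- by move=> y Sy b Vb; rewrite starK; case: (Sy b Vb).
Qed.

Definition drel (i : 'I_n) a a' := forall k, fourier a' k = (k 0 i)%:~R * fourier a k.

End TorusBasics.

(** * Fourier coefficients *)

Section FsetSums.
Variables (T : choiceType).

Lemma fsum_split (V : zmodType) (F G : {fset T}) (f : T -> V) : (F `<=` G)%fset ->
  \sum_(k <- G) f k = \sum_(k <- F) f k + \sum_(k <- (G `\` F)%fset) f k.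
Proof.
move=> /fsubsetP FG; have h : perm_eq (enum_fset G) (enum_fset F ++ enum_fset (G `\` F)%fset).
  apply: uniq_perm => [||x]; first exact: fset_uniq.
    rewrite cat_uniq !fset_uniq andbT /=; apply/hasPn => x.
    by rewrite inE => /andP[].
  rewrite mem_cat [x \in enum_fset (G `\` F)%fset]in_fsetD.
  by have [/FG ->|] := boolP (x \in F).
by rewrite (perm_big _ h) big_cat.
Qed.

Lemma fsum_le (R : numDomainType) (F G : {fset T}) (f : T -> R) : (F `<=` G)%fset ->
  (forall k, 0 <= f k) -> \sum_(k <- F) f k <= \sum_(k <- G) f k.
Proof. by move=> FG f0; rewrite (fsum_split f FG) lerDl sumr_ge0. Qed.
End FsetSums.

Section L2Basics.
Variables (R : realType) (n : nat) (theta : 'M[R]_n) (A : nctorus theta) (H : L2completion A).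
Local Notation tau := (nct_tr A).
Local Notation U := (Uk A).
Local Notation emb := (L2_emb H).
Local Notation coef := (L2_coef (H := H)).
Local Notation Z := 'rV[int]_n.
Let e (k : Z) : H := emb (U k).

Lemma dot_emb a b : dot (emb a) (emb b) = tau (a *c star b).
Proof. exact: L2_embE. Qed.

Lemma dot_ee j k : dot (e j) (e k) = (j == k)%:R.
Proof. by rewrite dot_emb; exact: fourier_U. Qed.

Lemma coef_emb a k : coef (emb a) k = fourier a k.
Proof. exact: dot_emb. Qed.

Lemma nrm_emb a : nrm (emb a) <= nrm a.
Proof.
rewrite -(@ler_pXn2r _ 2) ?nnegrE ?nrm_ge0 //.
have -> : nrm (emb a) ^+ 2 = nrm (tau (a *c star a)).
  by rewrite -dot_emb dot_self nrmR ger0_norm ?sqr_ge0.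
apply: le_trans (tau_le _) _; apply: le_trans (nrm_amul _ _) _.
by rewrite nrm_star expr2.
Qed.

Lemma coefD u v k : coef (u + v) k = coef u k + coef v k.
Proof. exact: dotDl. Qed.

Lemma coefZ c u k : coef (c *: u) k = c * coef u k.
Proof. exact: dotZl. Qed.

Lemma coefB u v k : coef (u - v) k = coef u k - coef v k.
Proof. exact: dotBl. Qed.

Definition fproj (F : {fset Z}) (u : H) : H := \sum_(k <- F) coef u k *: e k.

Lemma fprojD F u v : fproj F (u + v) = fproj F u + fproj F v.
Proof. by rewrite /fproj -big_split; apply: eq_bigr => k _; rewrite coefD scalerDl. Qed.

Lemma fprojZ F c u : fproj F (c *: u) = c *: fproj F u.
Proof. by rewrite /fproj scaler_sumr; apply: eq_bigr => k _; rewrite coefZ scalerA. Qed.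

Lemma fprojB F u v : fproj F (u - v) = fproj F u - fproj F v.
Proof. by rewrite /fproj -sumrB; apply: eq_bigr => k _; rewrite coefB scalerBl. Qed.

Lemma coef_sum (F : {fset Z}) (c : Z -> R[i]) k : coef (\sum_(j <- F) c j *: e j) k = if k \in F then c k else 0.
Proof.
rewrite /coef dot_suml; case: ifP => kF; last first.
  rewrite big_seq big1 // => j jF; rewrite dotZl dot_ee; case: eqP => [jk|]; last by rewrite mulr0.
  by rewrite -jk jF in kF.
rewrite (bigD1_seq k) ?fset_uniq //= dotZl dot_ee eqxx mulr1 big1 ?addr0 // => j jk.
by rewrite dotZl dot_ee (negPf jk) mulr0.
Qed.

Lemma coef_fproj F u k : coef (fproj F u) k = if k \in F then coef u k else 0.
Proof. exact: coef_sum. Qed.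

Lemma dot_fproj F u v : dot (fproj F u) v = \sum_(k <- F) coef u k * cj (coef v k).
Proof.
rewrite /fproj dot_suml; apply: eq_bigr => k _; rewrite dotZl; congr (_ * _); exact: dot_cj.
Qed.

Lemma nrm_fproj F u : nrm (fproj F u) ^+ 2 = \sum_(k <- F) nrm (coef u k) ^+ 2.
Proof.
apply: complexI; rewrite -dot_self dot_fproj rmorph_sum /= big_seq [RHS]big_seq.
by apply: eq_bigr => k kF; rewrite coef_fproj kF mulcJ.
Qed.

Lemma bessel_coef (F : {fset Z}) u : \sum_(k <- F) nrm (coef u k) ^+ 2 <= nrm u ^+ 2.
Proof.
have h : dot (fproj F u) u = (\sum_(k <- F) nrm (coef u k) ^+ 2)%:C.
  by rewrite dot_fproj rmorph_sum /=; apply: eq_bigr => k _; rewrite mulcJ.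
have := sqr_ge0 (nrm (u - fproj F u)); rewrite nrm_sqrB nrm_fproj dot_cj h cjR /= mulr2n.
by move: (\sum_(_ <- _) _) (nrm u ^+ 2) => x y; lra.
Qed.

Lemma nrm_fproj_le F u : nrm (fproj F u) <= nrm u.
Proof. by rewrite -(@ler_pXn2r _ 2) ?nnegrE ?nrm_ge0 // nrm_fproj bessel_coef. Qed.

Lemma nrm_coef u k : nrm (coef u k) <= nrm u.
Proof.
rewrite -(@ler_pXn2r _ 2) ?nnegrE ?nrm_ge0 //.
by have := bessel_coef [fset k]%fset u; rewrite big_seq_fset1.
Qed.

(** Vectors with this property form a closed subspace containing every [e k], hence the dense image
    of A. *)
Lemma fproj_cvg u (eps : R) : 0 < eps ->
  exists F : {fset Z}, forall G, (F `<=` G)%fset -> nrm (u - fproj G u) <= eps.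
Proof.
pose Appr := [set u : H | forall eps : R, 0 < eps ->
  exists F : {fset Z}, forall G, (F `<=` G)%fset -> nrm (u - fproj G u) <= eps].
suff h : forall u, Appr u by move: eps; exact: (h u).
have cA : closedE Appr.
  move=> x hx d d0; have d3 : 0 < d / 3 by rewrite divr_gt0.
  have [y yA xy] := hx _ d3; have [F hF] := yA _ d3; exists F => G /hF hG.
  have -> : x - fproj G x = (x - y) + (y - fproj G y) - fproj G (x - y).
    by rewrite fprojB; hring.
  apply: le_trans (nrmB _ _) _; have := nrm_fproj_le G (x - y); have := nrmD (x - y) (y - fproj G y).
  by move: xy hG; move: (nrm _) (nrm _) (nrm _) (nrm _) => *; lra.
have sA : subsp Appr.
  split=> [d d0|x y hx hy d d0|c x hx d d0].
  - exists fset0 => G _; rewrite (_ : fproj G 0 = 0) ?subr0 ?nrm0 ?ltW //.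
    by rewrite /fproj big1 // => k _; rewrite /coef dot0l scale0r.
  - have d2 : 0 < d / 2 by rewrite divr_gt0.
    have [F1 h1] := hx _ d2; have [F2 h2] := hy _ d2; exists (F1 `|` F2)%fset => G.
    rewrite fsubUset => /andP[/h1 h3 /h2 h4].
    have -> : x + y - fproj G (x + y) = (x - fproj G x) + (y - fproj G y).
      by rewrite fprojD; hring.
    by apply: le_trans (nrmD _ _) _; move: h3 h4; move: (nrm _) (nrm _) => *; lra.
  - have c1 : 0 < nrm c + 1 by rewrite ltr_wpDl ?nrm_ge0.
    have [F hF] := hx _ (divr_gt0 d0 c1); exists F => G /hF hG.
    rewrite fprojZ.
    rewrite -scalerBr nrmZ; apply: le_trans (ler_wpM2l (nrm_ge0 _) hG) _.
    by rewrite mulrCA ler_piMr ?(ltW d0) // ler_pdivrMr // mul1r lerDl.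
have eA k : Appr (e k).
  move=> d d0; exists [fset k]%fset => G; rewrite fsub1set => kG.
  rewrite /fproj (bigD1_seq k) ?fset_uniq //= /coef dot_ee eqxx scale1r big1 ?addr0 ?subrr ?nrm0 ?ltW //.
  by move=> j jk; rewrite dot_ee eq_sym (negPf jk) scale0r.
have embA a : Appr (emb a).
  apply: (@polynomials_dense _ _ _ A [set a | Appr (emb a)]) => [x hx||k]; last exact: eA.
    apply: cA => d /hx[y hy xy]; exists (emb y) => //; rewrite -linearB.
    exact: le_trans (nrm_emb _) xy.
  case: sA => s0 sD sZ; split=> /= [|x y hx hy|c x hx]; first by rewrite linear0.
    by rewrite (lD emb); apply: sD.
  by rewrite (lZ emb); apply: sZ.
move=> v; apply: cA => d d0.
have [||x [/interior_subset vx [a _ ax]]] := @L2_dense _ _ _ _ H (interior (ball v d%:C)).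
- by exists v; apply: nbhsx_ballx; rewrite ltcR.
- exact: open_interior.
by exists x; [rewrite -ax; exact: embA|apply: ltW; move: vx; rewrite -ball_normE /= nrm_norm_lt].
Qed.

Lemma coef_eq0 u : (forall k, coef u k = 0) -> u = 0.
Proof.
move=> h; apply: nrm_eps0 => d d0; have [F hF] := fproj_cvg u d0.
have := hF F (fsubset_refl _); rewrite (_ : fproj F u = 0) ?subr0 //.
by rewrite /fproj big1 // => k _; rewrite h scale0r.
Qed.

Lemma parseval u v (d : R) : 0 < d -> exists F : {fset Z}, forall G, (F `<=` G)%fset ->
  nrm (dot u v - \sum_(k <- G) coef u k * cj (coef v k)) <= d.
Proof.
move=> d0; have v1 : 0 < nrm v + 1 by rewrite ltr_wpDl ?nrm_ge0.
have [F hF] := fproj_cvg u (divr_gt0 d0 v1); exists F => G /hF hG.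
rewrite -dot_fproj -dotBl; apply: le_trans (CauchySchwarz _ _) _.
apply: le_trans (ler_wpM2r (nrm_ge0 _) hG) _.
by rewrite mulrAC ler_pdivrMr // ler_wpM2l ?(ltW d0) // lerDl.
Qed.

(** The coefficient at p of [a *c b] is the inner product of b with [star a *c U p], so Parseval's
    identity gives the convolution formula without norm convergence of Fourier series. *)
Lemma fourier_product (a b : A) p (d : R) : 0 < d -> exists F : {fset Z}, forall G, (F `<=` G)%fset ->
  nrm (fourier (a *c b) p - \sum_(l <- G) fourier b l * fourier (a *c U l) p) <= d.
Proof.
move=> d0; have [F hF] := parseval (emb b) (emb (star a *c U p)) d0; exists F => G /hF.
rewrite dot_emb starM starK amulA tau_comm amulA -[tau _]/(fourier (a *c b) p).
congr (nrm (_ - _) <= _); apply: eq_bigr => l _; rewrite coef_emb; congr (_ * _).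
by rewrite /coef -dot_cj dot_emb starM starK amulA tau_comm amulA.
Qed.

Lemma fourier_product_le (a b : A) p (B : R) :
  (forall F : {fset Z}, \sum_(l <- F) nrm (fourier b l) * nrm (fourier a (p - l)) <= B) ->
  nrm (fourier (a *c b) p) <= B.
Proof.
move=> hB; apply/ler_addgt0Pr => d d0; have [F hF] := fourier_product a b p d0.
apply: le_trans (nrm_lebD _ (\sum_(l <- F) fourier b l * fourier (a *c U l) p)) _.
rewrite addrC lerD ?hF ?fsubset_refl //; apply: le_trans (hB F).
apply: le_trans (nrm_sum _ _ _) _; apply: ler_sum => l _.
by rewrite nrmM nrm_fourier_mulU.
Qed.

(** In the convolution formula the factor [p 0 i] splits as [(p - l) 0 i + l 0 i]; the three
    convolutions are truncated at a common finite set. *)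
Lemma drelM i (a a' b b' : A) : drel i a a' -> drel i b b' -> drel i (a *c b) (a' *c b + a *c b').
Proof.
move=> ha hb p; apply/eqP; rewrite -subr_eq0; apply/eqP; apply: nrm_eps0 => d d0.
rewrite fourierD; set m : R[i] := (p 0 i)%:~R.
have m1 : 0 < 2 + nrm m by rewrite ltr_wpDr ?nrm_ge0.
have d1 := divr_gt0 d0 m1.
have [F1 h1] := fourier_product a' b p d1; have [F2 h2] := fourier_product a b' p d1.
have [F3 h3] := fourier_product a b p d1; pose F := (F1 `|` F2 `|` F3)%fset.
have {}h1 := h1 F (fsubset_trans (fsubsetUl _ _) (fsubsetUl _ _)).
have {}h2 := h2 F (fsubset_trans (fsubsetUr _ _) (fsubsetUl _ _)).
have {}h3 := h3 F (fsubsetUr _ _).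
set s1 := \sum_(_ <- _) _ in h1; set s2 := \sum_(_ <- _) _ in h2; set s3 := \sum_(_ <- _) _ in h3.
have s0 : s1 + s2 - m * s3 = 0.
  rewrite mulr_sumr -big_split -sumrB big1 // => l _ /=.
  have [c _ hc] := fourier_mulU A l p; rewrite !hc ha hb.
  by rewrite !mxE rmorphB /= -/m; ring.
have -> : fourier (a' *c b) p + fourier (a *c b') p - m * fourier (a *c b) p =
   (fourier (a' *c b) p - s1) + (fourier (a *c b') p - s2) - m * (fourier (a *c b) p - s3)
   + (s1 + s2 - m * s3) by ring.
rewrite s0 addr0; apply: le_trans (nrmB _ _) _; rewrite nrmM.
apply: le_trans (lerD (le_trans (nrmD _ _) (lerD h1 h2)) (ler_wpM2l (nrm_ge0 _) h3)) _.
suff -> : d / (2 + nrm m) + d / (2 + nrm m) + nrm m * (d / (2 + nrm m)) = d by [].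
by field; rewrite gt_eqF.
Qed.

Lemma fourier_null (a : A) : (forall k, fourier a k = 0) -> forall w, tau (a *c w) = 0.
Proof.
move=> h w; rewrite -(starK w) -dot_emb (_ : emb a = 0) ?dot0l //.
by apply: coef_eq0 => k; rewrite coef_emb.
Qed.

(** Coefficients are only known to determine an element up to null vectors of [tau], whose
    faithfulness is not part of its specification; equality of coefficients is nevertheless stable
    under multiplication. *)
Lemma fourier_eq_mull (a b b' : A) : (forall k, fourier b k = fourier b' k) ->
  forall k, fourier (a *c b) k = fourier (a *c b') k.
Proof.
move=> h k; apply/eqP; rewrite -subr_eq0 -fourierB -amulBr /fourier -amulA tau_comm -amulA.
by rewrite fourier_null // => j; rewrite fourierB h subrr.
Qed.

End L2Basics.

(** * Weights on the lattice and their summability *)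

Section Weights.
Variables (R : realType) (n : nat).
Local Notation Z := 'rV[int]_n.

(** The l^1 form of [1 + |k|]. It is submultiplicative ([wtD]), which serves as Peetre's inequality
    throughout. *)
Definition wt (k : Z) : R := 1 + \sum_(j < n) `|(k 0 j)%:~R|.

Lemma wt_ge1 k : 1 <= wt k.
Proof. by rewrite lerDl sumr_ge0. Qed.

Lemma wt_gt0 k : 0 < wt k.
Proof. exact: lt_le_trans ltr01 (wt_ge1 k). Qed.

Lemma wt_ge0 k : 0 <= wt k. Proof. exact/ltW/wt_gt0. Qed.

Lemma wtX_gt0 k N : 0 < wt k ^+ N.
Proof. by rewrite exprn_gt0 ?wt_gt0. Qed.

Lemma wt0 : wt 0 = 1.
Proof. by rewrite /wt big1 ?addr0 // => j _; rewrite mxE normr0. Qed.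

Lemma wtN k : wt (- k) = wt k.
Proof. by congr (1 + _); apply: eq_bigr => j _; rewrite mxE rmorphN normrN. Qed.

Lemma wtBC i k : wt (i - k) = wt (k - i).
Proof. by rewrite -wtN opprB. Qed.

Lemma wtD k l : wt (k + l) <= wt k * wt l.
Proof.
have h : \sum_(j < n) `|((k + l) 0 j)%:~R| <=
    \sum_(j < n) `|(k 0 j)%:~R : R| + \sum_(j < n) `|(l 0 j)%:~R|.
  by rewrite -big_split; apply: ler_sum => j _; rewrite mxE rmorphD ler_normD.
rewrite {1}/wt; apply: le_trans (_ : 1 + (\sum_(j < n) `|(k 0 j)%:~R| + \sum_(j < n) `|(l 0 j)%:~R|) <= _).
  by rewrite lerD2l.
rewrite /wt; set x := \sum_(_ < _) _; set y := \sum_(_ < _) _.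
have x0 : 0 <= x by exact: sumr_ge0.
have y0 : 0 <= y by exact: sumr_ge0.
clearbody x y; have := mulr_ge0 x0 y0; clear => xy; nra.
Qed.

Lemma wtB i k : wt i <= wt (i - k) * wt k.
Proof. by rewrite -{1}(subrK k i) wtD. Qed.

Lemma wt_coord (k : Z) (j : 'I_n) : 1 + `|(k 0 j)%:~R| <= wt k.
Proof. by rewrite lerD2l (bigD1 j) //= lerDl sumr_ge0. Qed.

Lemma enorm_ge0 (x : 'rV[R]_n) : 0 <= enorm x.
Proof. exact: sqrtr_ge0. Qed.

Lemma enorm_coord (x : 'rV[R]_n) (j : 'I_n) : `|x 0 j| <= enorm x.
Proof.
by rewrite -sqrtr_sqr ler_wsqrtr // (bigD1 j) //= lerDl sumr_ge0 // => i _; rewrite sqr_ge0.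
Qed.

Lemma enorm_le (x : 'rV[R]_n) : enorm x <= \sum_(j < n) `|x 0 j|.
Proof.
have s0 : 0 <= \sum_(j < n) `|x 0 j| by exact: sumr_ge0.
rewrite -(@ler_pXn2r _ 2) ?nnegrE ?enorm_ge0 // sqr_sqrtr; last first.
  by apply: sumr_ge0 => j _; rewrite sqr_ge0.
rewrite expr2 mulr_suml; apply: ler_sum => j _.
rewrite -(real_normK (num_real _)) expr2 ler_wpM2l // (bigD1 j) //= lerDl sumr_ge0 //.
Qed.

Lemma enorm_wt k : 1 + enorm (zvec R k) <= wt k.
Proof.
rewrite lerD2l; apply: le_trans (enorm_le _) _; apply: ler_sum => j _.
by rewrite mxE.
Qed.

Lemma sum_enorm (x : 'rV[R]_n) : \sum_(j < n) `|x 0 j| <= n%:R * enorm x.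
Proof.
apply: le_trans (_ : \sum_(j < n) enorm x <= _); first by apply: ler_sum => j _; exact: enorm_coord.
by rewrite sumr_const card_ord mulr_natl.
Qed.

Lemma wt_enorm k : wt k <= n.+1%:R * (1 + enorm (zvec R k)).
Proof.
have := sum_enorm (zvec R k); rewrite /wt.
have -> : \sum_(j < n) `|zvec R k 0 j| = \sum_(j < n) `|(k 0 j)%:~R|.
  by apply: eq_bigr => j _; rewrite mxE.
have := enorm_ge0 (zvec R k); rewrite -natr1; move: (\sum_(_ < _) _) (enorm _) (ler0n R n) => x y n0 y0 h.
by clear -n0 y0 h; nra.
Qed.

Lemma enorm_ge1 (k : Z) : k != 0 -> 1 <= enorm (zvec R k).
Proof.
move=> k0; have [j kj] : exists j, k 0 j != 0.
  apply/existsP; apply: contraNT k0; rewrite negb_exists => /forallP h; apply/eqP/rowP => j.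
  by rewrite mxE; apply/eqP; have := h j; rewrite negbK.
apply: le_trans (enorm_coord _ j); rewrite mxE -intr_norm ler1z -gtz0_ge1 normr_gt0 //.
Qed.

Lemma enorm_eq0 (x : 'rV[R]_n) : (enorm x == 0) = (x == 0).
Proof.
apply/eqP/eqP => [x0|->]; last first.
  by rewrite /enorm big1 ?sqrtr0 // => j _; rewrite mxE expr0n.
apply/rowP => j; rewrite mxE; apply/eqP; rewrite -normr_le0 -x0; exact: enorm_coord.
Qed.

Lemma enormZ t (x : 'rV[R]_n) : enorm (t *: x) = `|t| * enorm x.
Proof.
rewrite /enorm -sqrtr_sqr -sqrtrM ?sqr_ge0 //; congr Num.sqrt.
by rewrite mulr_sumr; apply: eq_bigr => j _; rewrite mxE exprMn.
Qed.

Let code (x : int) : nat := match x with Posz m => m.*2 | Negz m => m.*2.+1 end.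

Let code_inj : injective code.
Proof.
have odd_code x : odd (code x) = (if x is Posz _ then false else true).
  by case: x => m /=; rewrite odd_double.
move=> x y h; have := congr1 odd h; rewrite !odd_code.
by case: x y h => m [] k //= => [/double_inj ->|[/double_inj ->]].
Qed.

Let codeP (x : int) : (1 + `|x%:~R|) ^- 2 <= 8 * ((code x).+1%:R^-1 - (code x).+2%:R^-1) :> R.
Proof.
have h : (code x).+1%:R <= 2 * (1 + `|x%:~R|) - 1 :> R.
  case: x => m /=.
    rewrite -pmulrn ger0_norm ?ler0n // -natr1 -muln2 natrM; clear; move: (m%:R : R) => y; lra.
  rewrite NegzE rmorphN normrN /= -pmulrn ger0_norm ?ler0n // -[m.*2.+2%:R]natr1 -[m.*2.+1%:R]natr1.
  by rewrite -[m.+1%:R]natr1 -muln2 natrM; clear; move: (m%:R : R) => y; lra.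
have t0 : 0 < (code x).+1%:R :> R by rewrite ltr0n.
have a1 : 1 <= 1 + `|x%:~R : R| by rewrite lerDl.
rewrite -[(code x).+2%:R]natr1; move: h t0 a1; move: ((code x).+1%:R : R) (1 + `|x%:~R : R|) => t a h t0 a1.
have t1 : 0 < t + 1 by rewrite addr_gt0.
have -> : 8 * (t^-1 - (t + 1)^-1) = 8 / (t * (t + 1)) by field; rewrite !gt_eqF.
have a0 : 0 < a by apply: lt_le_trans a1.
rewrite -[leLHS]mul1r ler_pdivrMr ?exprn_gt0 // mulrAC ler_pdivlMr ?mulr_gt0 // mul1r.
by clear -h t0 a1; nra.
Qed.

(** [wt k ^ (2n)] dominates the product of the [(1 + |k_j|)^2]. After numbering the integers by
    [code], the inverse of each factor is at most 8 times a term of a telescoping series of sum at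
    most 1; hence the constant [8^n]. *)
Lemma wt_sum : exists2 S : R, 0 < S & forall F : {fset Z}, \sum_(k <- F) wt k ^- (2 * n) <= S.
Proof.
exists (8 ^+ n) => [|F]; first by rewrite exprn_gt0.
pose f (x : int) : R := (1 + `|x%:~R|) ^- 2.
pose b p : R := 8 * (p.+1%:R^-1 - p.+2%:R^-1).
have b0 p : 0 <= b p.
  by rewrite mulr_ge0 // subr_ge0 lef_pV2 ?posrE ?ltr0n // ler_nat.
pose M := \max_(k <- F) \max_(j < n) code ((k : Z) 0%R j).
have hM (k : Z) (j : 'I_n) : k \in F -> (code (k 0%R j) < M.+1)%N.
  move=> kF; rewrite ltnS; apply: leq_trans (leq_bigmax_seq _ kF _) => //.
  exact: (leq_bigmax j).
(* Reindexing by functions with bounded values turns the sum of products into a product of sums. *)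
pose g (k : F) : {ffun 'I_n -> 'I_M.+1} := [ffun j => inord (code (val k 0 j))].
have g_inj : injective g.
  move=> k k' /ffunP h; apply/val_inj/rowP => j; apply: code_inj.
  by have := congr1 (@nat_of_ord _) (h j); rewrite !ffunE !inordK ?hM ?fsvalP.
have step (k : F) : wt (val k) ^- (2 * n) <= \prod_(j < n) b (g k j).
  apply: le_trans (_ : \prod_(j < n) f (val k 0 j) <= _); last first.
    apply: ler_prod => j _; rewrite /f invr_ge0 exprn_ge0 ?addr_ge0 //=.
    by rewrite ffunE inordK ?hM ?fsvalP //; exact: codeP.
  rewrite /f prodfV lef_pV2 ?posrE ?wtX_gt0 //; last first.
    by apply: prodr_gt0 => j _; rewrite exprn_gt0 // ltr_pwDl.
  have -> : wt (val k) ^+ (2 * n) = \prod_(j < n) wt (val k) ^+ 2.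
    by rewrite prodr_const card_ord -exprM.
  apply: ler_prod => j _; rewrite exprn_ge0 ?addr_ge0 //=.
  by apply: lerXn2r; rewrite ?nnegrE ?wt_ge0 ?addr_ge0 //; exact: wt_coord.
rewrite big_seq_fsetE /=; apply: le_trans (ler_sum _ (fun k _ => step k)) _.
apply: le_trans (_ : \sum_(h : {ffun 'I_n -> 'I_M.+1}) \prod_(j < n) b (h j) <= _).
  rewrite -(big_imset (fun h : {ffun 'I_n -> 'I_M.+1} => \prod_(j < n) b (h j))) /=; last by move=> k k' _ _; exact: g_inj.
  set I := (X in \sum_(_ in X) _); rewrite [leRHS](bigID (mem I)) /= lerDl.
  by apply: sumr_ge0 => h _; apply: prodr_ge0.
rewrite -(bigA_distr_bigA (fun (j : 'I_n) (p : 'I_M.+1) => b p)) prodr_const card_ord.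
rewrite lerXn2r ?nnegrE ?sumr_ge0 // -mulr_sumr ler_piMr //.
suff -> : forall m, \sum_(i < m) (i.+1%:R^-1 - i.+2%:R^-1 : R) = 1 - m.+1%:R^-1 by rewrite gerBl invr_ge0.
by elim=> [|m ih]; rewrite ?big_ord0 ?invr1 ?subrr // big_ord_recr ih /= addrA subrK.
Qed.

Lemma wt_sum_shift : exists2 S : R, 0 < S &
  forall (i : Z) (F : {fset Z}), \sum_(k <- F) wt (i - k) ^- (2 * n) <= S.
Proof.
have [S S0 hS] := wt_sum; exists S => // i F; apply: le_trans (hS [fset i - k | k in F]%fset).
rewrite big_imfset //= => k l _ _ /(congr1 (fun x => i - x)).
by rewrite !subKr.
Qed.

End Weights.

(** [F] is a finite set whose sum is within d of the supremum of all finite sums. *)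
Lemma fsum_tail (R : realType) (T : choiceType) (f : T -> R) (B : R) :
  (forall k, 0 <= f k) -> (forall F : {fset T}, \sum_(k <- F) f k <= B) ->
  forall d : R, 0 < d -> exists F : {fset T}, forall G, (F `<=` G)%fset ->
    \sum_(k <- (G `\` F)%fset) f k <= d.
Proof.
move=> f0 fB d d0; pose E := [set x : R | exists F : {fset T}, x = \sum_(k <- F) f k].
have sE : has_sup E.
  by split; [exists (\sum_(k <- fset0) f k); exists fset0|exists B => _ [F ->]].
have [_ [F ->] hF] := sup_adherent d0 sE; exists F => G FG.
have := ub_le_sup sE.2 (ex_intro _ G erefl : E _); rewrite (fsum_split f FG).
by move: hF; move: (\sum_(_ <- _) _) (\sum_(_ <- _) _) (sup E) => x y z; lra.
Qed.

#[local] Existing Instance totally_filter.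

(** * Smooth elements as sums of rapidly decaying series *)

Section SmoothElements.
Variables (R : realType) (n : nat) (theta : 'M[R]_n) (A : nctorus theta).
Local Notation U := (Uk A).
Local Notation Z := 'rV[int]_n.
Local Notation wt := (wt R).
Implicit Types (c : Z -> R[i]) (u w : A).

Definition tsum c (F : {fset Z}) : A := \sum_(k <- F) c k *: U k.

Lemma partial_tsum c : partial_sum (fun k => c k *: U k) = tsum c.
Proof. by apply/funext => F; rewrite /partial_sum /tsum big_seq_fsetE. Qed.

Lemma fourier_tsum c F k : fourier (tsum c F) k = if k \in F then c k else 0.
Proof.
rewrite /tsum fourier_sum; case: ifP => kF.
  rewrite (bigD1_seq k) ?fset_uniq //= fourierZ fourier_U eqxx mulr1 big1 ?addr0 // => j jk.
  by rewrite fourierZ fourier_U (negPf jk) mulr0.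
rewrite big_seq big1 // => j jF; rewrite fourierZ fourier_U.
case: eqP => [jk|]; last by rewrite mulr0.
by rewrite -jk jF in kF.
Qed.

Lemma tsum_cvgP c u : tsum c @ totally --> u <->
  forall d : R, 0 < d -> exists F : {fset Z}, forall G, (F `<=` G)%fset -> nrm (u - tsum c G) < d.
Proof.
rewrite cvg_nrmP; split=> h d d0; have := h d d0.
  by case=> F _ hF; exists F => G /hF.
by case=> F hF; exists F => //= G; exact: hF.
Qed.

Lemma tsum_fourier c u : tsum c @ totally --> u -> fourier u = c.
Proof.
move=> /tsum_cvgP h; apply/funext => k; apply/eqP; rewrite -subr_eq0; apply/eqP.
apply: nrm_eps0 => d /h[F hF]; have := hF (k |` F)%fset (fsubsetU1 _ _) => /ltW; apply: le_trans.
by apply: le_trans (fourier_le _ k); rewrite fourierB fourier_tsum fset1U1.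
Qed.

Lemma tsum_summable c (f : Z -> R) B : (forall k, nrm (c k) <= f k) ->
  (forall F : {fset Z}, \sum_(k <- F) f k <= B) -> exists u, tsum c @ totally --> u.
Proof.
move=> cf fB; have f0 k : 0 <= f k by apply: le_trans (cf k); exact: nrm_ge0.
apply: complete_net => d d0; have d3 : 0 < d / 3 by rewrite divr_gt0.
have [F hF] := fsum_tail f0 fB d3; exists [set G | (F `<=` G)%fset]; first by exists F.
have h G : (F `<=` G)%fset -> nrm (tsum c G - tsum c F) <= d / 3.
  move=> FG; rewrite /tsum (fsum_split _ FG) addrC addKr; apply: le_trans (nrm_sum _ _ _) _.
  apply: le_trans (hF G FG); apply: ler_sum => k _; rewrite nrmZ.
  by apply: le_trans (cf k); rewrite ler_piMr ?nrm_ge0 ?nrm_U.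
move=> p r /= /h hp /h hr; apply: le_lt_trans (nrm_tri _ (tsum c F) _) _.
rewrite [X in _ + X]nrmBC; move: hp hr; move: (nrm _) (nrm _) => x y; lra.
Qed.

Definition decay c := forall N, exists2 C : R, 0 <= C & forall k, wt k ^+ N * nrm (c k) <= C.

Lemma decayP c : rapidly_decaying c <-> decay c.
Proof.
split=> h N; have [C] := h N.
  move=> hC; exists (n.+1%:R ^+ N * `|C|) => [|k]; first by rewrite mulr_ge0 ?exprn_ge0.
  apply: le_trans (_ : (n.+1%:R * (1 + enorm (zvec R k))) ^+ N * nrm (c k) <= _).
    apply: ler_wpM2r; first exact: nrm_ge0.
    by apply: lerXn2r; rewrite ?nnegrE ?wt_ge0 ?mulr_ge0 ?addr_ge0 ?enorm_ge0 //; exact: wt_enorm.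
  rewrite exprMn -mulrA ler_wpM2l ?exprn_ge0 //; apply: le_trans (ler_norm C).
  by have := hC k; rewrite nrmE -rmorphM /= lecR.
move=> C0 hC; exists C => k; rewrite nrmE -rmorphM /= lecR; apply: le_trans (hC k).
apply: ler_wpM2r; first exact: nrm_ge0.
by apply: lerXn2r; rewrite ?nnegrE ?wt_ge0 ?addr_ge0 ?enorm_ge0 //; exact: enorm_wt.
Qed.

Lemma decay_cvg c : decay c -> exists u, tsum c @ totally --> u.
Proof.
move=> h; have [C C0 hC] := h (2 * n)%N; have [S S0 hS] := wt_sum R n.
apply: (@tsum_summable c (fun k => C * wt k ^- (2 * n)) (C * S)) => [k|F].
  by rewrite ler_pdivlMr ?wtX_gt0 // mulrC hC.
by rewrite -mulr_sumr ler_wpM2l.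
Qed.

Lemma smoothP u : smooth A u <-> decay (fourier u) /\ tsum (fourier u) @ totally --> u.
Proof.
split=> [[c [/decayP cd]]|[h1 h2]].
  by rewrite partial_tsum => cu; rewrite (tsum_fourier cu).
by exists (fourier u); rewrite partial_tsum; split=> //; exact/decayP.
Qed.

Lemma decay_smooth c : decay c -> exists u, [/\ smooth A u, fourier u = c & tsum c @ totally --> u].
Proof.
move=> cd; have [u hu] := decay_cvg cd; have uc := tsum_fourier hu.
by exists u; split=> //; apply/smoothP; rewrite uc.
Qed.

Lemma tsum_lim c u : tsum c @ totally --> u -> summability.sum (fun k => c k *: U k) = u.
Proof. by move=> h; rewrite /summability.sum partial_tsum; apply: cvg_lim h; exact: norm_hausdorff. Qed.

Lemma wt_intr (k : Z) (j : 'I_n) : nrm ((k 0 j)%:~R : R[i]) <= wt k.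
Proof.
have -> : (k 0 j)%:~R = (((k 0 j)%:~R : R)%:C)%C :> R[i] by rewrite rmorph_int.
by rewrite nrmR; apply: le_trans (wt_coord R k j); rewrite lerDr.
Qed.

Lemma decay_delta c (j : 'I_n) : decay c -> decay (fun k => (k 0 j)%:~R * c k).
Proof.
move=> h N; have [C C0 hC] := h N.+1; exists C => // k; apply: le_trans (hC k).
rewrite nrmM exprSr -mulrA ler_wpM2l ?exprn_ge0 ?wt_ge0 //.
by rewrite ler_wpM2r ?nrm_ge0 ?wt_intr.
Qed.

Lemma delta_smooth j u : smooth A u -> smooth A (delta j u) /\ drel j u (delta j u).
Proof.
move=> /smoothP[ud _]; have [w [ws wc wt]] := decay_smooth (decay_delta j ud).
have -> : delta j u = w by exact: tsum_lim.
by split=> // k; rewrite wc.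
Qed.

Lemma decayB c c' : decay c -> decay c' -> decay (fun k => c k - c' k).
Proof.
move=> h h' N; have [C C0 hC] := h N; have [C' C0' hC'] := h' N.
exists (C + C') => [|k]; first exact: addr_ge0.
apply: le_trans (ler_wpM2l (ltW (wtX_gt0 _ _ _)) (nrmB _ _)) _.
by rewrite mulrDr lerD.
Qed.

Lemma smoothB u w : smooth A u -> smooth A w -> smooth A (u - w).
Proof.
move=> /smoothP[ud uc] /smoothP[wd wc]; apply/smoothP.
have -> : fourier (u - w) = (fun k => fourier u k - fourier w k) by apply/funext => k; rewrite fourierB.
split; first exact: decayB.
have -> : tsum (fun k => fourier u k - fourier w k) = (fun F => tsum (fourier u) F - tsum (fourier w) F).
  by apply/funext => F; rewrite /tsum -sumrB; apply: eq_bigr => k _; rewrite scalerBl.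
exact: cvgB.
Qed.

Lemma tsum_cst c (F : {fset Z}) : (forall k, k \notin F -> c k = 0) -> tsum c @ totally --> tsum c F.
Proof.
move=> h; apply/tsum_cvgP => d d0; exists F => G FG.
rewrite /tsum (fsum_split _ FG) opprD addrA subrr add0r nrmN big_seq big1 ?nrm0 //.
by move=> k; rewrite in_fsetD => /andP[/h -> _]; rewrite scale0r.
Qed.

Lemma tsum_smooth c (F : {fset Z}) : smooth A (tsum c F).
Proof.
pose c' k := if k \in F then c k else 0.
have -> : tsum c F = tsum c' F.
  by rewrite /tsum big_seq [RHS]big_seq; apply: eq_bigr => k kF; rewrite /c' kF.
apply/smoothP; have -> : fourier (tsum c' F) = c'.
  apply/funext => k; rewrite fourier_tsum /c'.
  by case: (k \in F).
split; last by apply: tsum_cst => k /negPf kF; rewrite /c' kF.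
move=> N; exists (\sum_(k <- F) wt k ^+ N * nrm (c k)) => [|k].
  by apply: sumr_ge0 => k _; rewrite mulr_ge0 ?nrm_ge0 ?exprn_ge0 ?wt_ge0.
rewrite /c'; case: ifP => kF; last first.
  by rewrite nrm0 mulr0 sumr_ge0 // => l _; rewrite mulr_ge0 ?nrm_ge0 ?exprn_ge0 ?wt_ge0.
rewrite (bigD1_seq k) ?fset_uniq //= lerDl sumr_ge0 // => l _.
by rewrite mulr_ge0 ?nrm_ge0 ?exprn_ge0 ?wt_ge0.
Qed.

Lemma smooth0 : smooth A 0.
Proof. by have := tsum_smooth (fun=> 0) fset0; rewrite /tsum big_seq_fset0. Qed.

End SmoothElements.

Section MultiIter.
Variables (n : nat) (X : Type) (D : 'I_n -> X -> X).

Lemma multi_iter0 x : multi_iter D (fun=> 0%N) x = x.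
Proof. by rewrite /multi_iter; elim: (enum _) => //= j s ->. Qed.

Lemma multi_iter1 (j : 'I_n) x : multi_iter D (fun i => (i == j) : nat) x = D j x.
Proof.
rewrite /multi_iter; have := mem_enum 'I_n j; rewrite inE; have := enum_uniq 'I_n.
have h s : j \notin s -> foldr (fun i y => iter (i == j) (D i) y) x s = x.
  elim: s => //= i s ih; rewrite inE negb_or eq_sym => /andP[/negPf -> /ih] /=.
  by [].
elim: (enum _) => //= i s ih /andP[si us]; rewrite inE.
case E: (j == i) => /=; last by rewrite eq_sym E /= => js; exact: ih.
by move/eqP: E => E _; subst i; rewrite eqxx /= h.
Qed.
End MultiIter.

(** * Families of elements with uniformly controlled derivatives and coefficients *)

Section Families.
Variables (R : realType) (n : nat) (theta : 'M[R]_n) (A : nctorus theta) (H : L2completion A).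
Local Notation U := (Uk A).
Local Notation Z := 'rV[int]_n.
Local Notation wt := (wt R).

Lemma deltas_smooth (beta : 'I_n -> nat) (u : A) : smooth A u -> smooth A (deltas beta u) /\
  forall k, fourier (deltas beta u) k = (\prod_(j < n) (k 0 j)%:~R ^+ beta j) * fourier u k.
Proof.
move=> us; rewrite /deltas /multi_iter.
suff h s : smooth A (foldr (fun j y => iter (beta j) (delta j) y) u s) /\ forall k,
    fourier (foldr (fun j y => iter (beta j) (delta j) y) u s) k =
    (\prod_(j <- s) (k 0 j)%:~R ^+ beta j) * fourier u k.
  by have [h1 h2] := h (enum 'I_n); split=> // k; rewrite h2 big_enum.
elim: s => [|j s [ih1 ih2]] /=; first by split=> // k; rewrite big_nil mul1r.
set w := foldr _ _ _ in ih1 ih2 *.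
have h m : smooth A (iter m (delta j) w) /\ forall k,
   fourier (iter m (delta j) w) k = (k 0 j)%:~R ^+ m * fourier w k.
  elim: m => [|m [jh1 jh2]] /=; first by split=> // k; rewrite mul1r.
  have [d1 d2] := delta_smooth j jh1; split=> // k.
  by rewrite d2 jh2 exprS mulrA.
have [h1 h2] := h (beta j); split=> // k; by rewrite h2 ih2 big_cons mulrA.
Qed.

Lemma deltas0 (u : A) : deltas (fun=> 0%N) u = u.
Proof. exact: multi_iter0. Qed.

Lemma deltas_step (beta : 'I_n -> nat) (j : 'I_n) (u : A) : smooth A u ->
  drel j (deltas beta u) (deltas (fun i => (i == j) + beta i)%N u).
Proof.
move=> us k; have [_ ->] := deltas_smooth beta us.
have [_ ->] := deltas_smooth (fun i => (i == j) + beta i)%N us.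
rewrite (bigD1 j) //= eqxx exprS [in RHS](bigD1 j) //= -!mulrA; congr (_ * (_ * _)); congr (_ * _).
by apply: eq_bigr => i /negPf ->.
Qed.

(* Families with N derivatives, in the sense of [drel], of norm O(g). The       *)
(* derivatives need not be the elements [delta j (c x)]: only Fourier           *)
(* coefficients matter, which spares us any closure property of [smooth].       *)
Fixpoint dbound (X : Type) (g : X -> R) (N : nat) (c : X -> A) : Prop :=
  (exists2 C : R, 0 <= C & forall x, nrm (c x) <= C * g x) /\
  if N is N'.+1 then
    forall j, exists2 c', dbound g N' c' & forall x, drel j (c x) (c' x)
  else True.

Lemma dboundW (X : Type) (g : X -> R) N c : dbound g N.+1 c -> dbound g N c.
Proof.
elim: N c => [|N ih] c [hC h]; split=> // j.
by have [c' /ih ? ?] := h j; exists c'.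
Qed.

Lemma dbound_deltas (X : Type) (g : X -> R) (c : X -> A) : (forall x, smooth A (c x)) ->
  (forall beta, exists2 C : R, 0 <= C & forall x, nrm (deltas beta (c x)) <= C * g x) ->
  forall N, dbound g N c.
Proof.
move=> cs h N; suff hb beta : dbound g N (fun x => deltas beta (c x)).
  have := hb (fun=> 0%N); congr dbound; apply/funext => x; exact: deltas0.
elim: N beta => [|N ih] beta; split=> //; move=> j.
exists (fun x => deltas (fun i => (i == j) + beta i)%N (c x)); first exact: ih.
by move=> x; exact: deltas_step.
Qed.

(** Powers of the weight are absorbed one at a time: [wt l] is 1 plus the sum of the [|l_j|], and
    each [|l_j|] is traded for a derivative. *)
Lemma dbound_coef (X : Type) (g : X -> R) N c : dbound g N c ->
  exists2 C : R, 0 <= C & forall x l, wt l ^+ N * nrm (fourier (c x) l) <= C * g x.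
Proof.
elim: N c => [|N ih] c.
  move=> [[C C0 hC] _]; exists C => // x l; rewrite expr0 mul1r.
  exact: le_trans (fourier_le _ _) _.
move=> h; have [C C0 hC] := ih _ (dboundW h); have [_ {}h] := h.
have {}h (j : 'I_n) : exists C : R, 0 <= C /\ forall x l,
    wt l ^+ N * (`|(l 0 j)%:~R| * nrm (fourier (c x) l)) <= C * g x.
  have [c' /ih[C' C'0 hC'] hd] := h j; exists C'; split=> // x l; apply: le_trans (hC' x l).
  rewrite (hd x l) nrmM; have -> : (l 0 j)%:~R = (((l 0 j)%:~R : R)%:C)%C :> R[i] by rewrite rmorph_int.
  by rewrite nrmR.
have [Cj hCj] := choice h.
exists (C + \sum_(j < n) Cj j) => [|x l].
  by rewrite addr_ge0 // sumr_ge0 // => j _; have [] := hCj j.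
rewrite exprSr -mulrA {2}/wt mulrDl mul1r mulrDr [leRHS]mulrDl lerD //.
rewrite !mulr_suml mulr_sumr; apply: ler_sum => j _; by have [_] := hCj j; apply.
Qed.

Lemma drelD j (a a' b b' : A) : drel j a a' -> drel j b b' -> drel j (a + b) (a' + b').
Proof. by move=> h1 h2 k; rewrite !fourierD h1 h2 mulrDr. Qed.

Lemma drelN j (a a' : A) : drel j a a' -> drel j (- a) (- a').
Proof. by move=> h1 k; rewrite !fourierN h1 mulrN. Qed.

Lemma dboundD (X : Type) (g : X -> R) N c d : dbound g N c -> dbound g N d -> dbound g N (fun x => c x + d x).
Proof.
elim: N c d => [|N ih] c d [[C C0 hC] h1] [[D D0 hD] h2].
  split=> //; exists (C + D) => [|x]; first exact: addr_ge0.
  by apply: le_trans (nrmD _ _) _; rewrite mulrDl lerD.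
split.
  exists (C + D) => [|x]; first exact: addr_ge0.
  by apply: le_trans (nrmD _ _) _; rewrite mulrDl lerD.
move=> j; have [c' ? ?] := h1 j; have [d' ? ?] := h2 j; exists (fun x => c' x + d' x); first exact: ih.
by move=> x; exact: drelD.
Qed.

Lemma dboundN (X : Type) (g : X -> R) N c : dbound g N c -> dbound g N (fun x => - c x).
Proof.
elim: N c => [|N ih] c [[C C0 hC] h1]; (split; [by exists C => // x; rewrite nrmN|]) => //.
move=> j; have [c' ? ?] := h1 j; exists (fun x => - c' x); first exact: ih.
by move=> x; exact: drelN.
Qed.

Lemma dboundM (X : Type) N (c d : X -> A) :
  dbound (fun=> 1) N c -> dbound (fun=> 1) N d -> dbound (fun=> 1) N (fun x => c x *c d x).
Proof.
have bM (c0 d0 : X -> A) (C D : R) : 0 <= C -> 0 <= D -> (forall x, nrm (c0 x) <= C * 1) ->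
    (forall x, nrm (d0 x) <= D * 1) ->
    exists2 C : R, 0 <= C & forall x, nrm (c0 x *c d0 x) <= C * 1.
  move=> C0 D0 hC hD; exists (C * D) => [|x]; first exact: mulr_ge0.
  apply: le_trans (nrm_amul _ _) _; rewrite mulr1.
  by apply: ler_pM; rewrite ?nrm_ge0 // -[leRHS]mulr1.
elim: N c d => [|N ih] c d hc hd; have [[C C0 hC] h1] := hc; have [[D D0 hD] h2] := hd.
  by split=> //; exact: bM hC hD.
split=> [|j]; first exact: bM hC hD.
have [c' hc' rc] := h1 j; have [d' hd' rd] := h2 j.
exists (fun x => c' x *c d x + c x *c d' x); last by move=> x; exact: (drelM H).
by apply: dboundD; apply: ih => //; exact: dboundW.
Qed.

(** The derivative of the inverse is [- b a' b], which has N controlled derivatives as soon as b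
    has; the induction starts from the bound on b alone. *)
Lemma dbound_inverse (X : Type) (a b : X -> A) : (forall x, a x *c b x = aone) ->
  (forall x, b x *c a x = aone) -> (forall x, smooth A (b x)) ->
  (forall N, dbound (fun=> 1) N a) -> dbound (fun=> 1) 0 b -> forall N, dbound (fun=> 1) N b.
Proof.
move=> ab ba bs ha hb0; elim=> // N ih; split=> [|j]; first by case: hb0.
have [_ /(_ j)[a' ha' ra]] := ha N.+1.
exists (fun x => - (b x *c a' x *c b x)).
  by apply: dboundN; apply: dboundM => //; exact: dboundM.
move=> x k; have [_ rb] := delta_smooth j (bs x); rewrite -(rb k) fourierN.
(* The relation [a b = 1], differentiated on coefficients; [fourier_eq_mull] then allows
   multiplication by b on the left. *)
have h0 l : fourier (a' x *c b x + a x *c delta j (b x)) l = fourier (0 : A) l.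
  rewrite (drelM H (ra x) rb l) ab fourier_aone fourier0.
  by have [->|] := eqVneq l 0; rewrite ?mulr0 // mxE mul0r.
have := fourier_eq_mull H (b x) h0 k; rewrite amul0r fourier0 amulDr fourierD !amulA ba amul1l.
by move/eqP; rewrite addrC addr_eq0 => /eqP ->.
Qed.

Definition rapid (X : Type) (g : X -> R) (c : X -> A) := forall N, exists2 C : R, 0 <= C &
  forall x l, wt l ^+ N * nrm (fourier (c x) l) <= C * g x.

Lemma rapid_le (X : Type) (g h : X -> R) (c : X -> A) (K : R) : 0 <= K ->
  (forall x, g x <= K * h x) -> rapid g c -> rapid h c.
Proof.
move=> K0 gh hc N; have [C C0 hC] := hc N; exists (C * K) => [|x l]; first exact: mulr_ge0.
by apply: le_trans (hC x l) _; rewrite -mulrA ler_wpM2l.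
Qed.

Lemma rapid_comp (X Y : Type) (f : Y -> X) (g : X -> R) (c : X -> A) :
  rapid g c -> rapid (g \o f) (c \o f).
Proof. by move=> h N; have [C C0 hC] := h N; exists C => // x l; exact: hC. Qed.

Lemma rapidD (X : Type) (g : X -> R) (c d : X -> A) : rapid g c -> rapid g d -> rapid g (fun x => c x + d x).
Proof.
move=> hc hd N; have [C C0 hC] := hc N; have [D D0 hD] := hd N.
exists (C + D) => [|x l]; first exact: addr_ge0.
rewrite fourierD; apply: le_trans (ler_wpM2l (ltW (wtX_gt0 _ _ _)) (nrmD _ _)) _.
by rewrite mulrDr mulrDl lerD.
Qed.

Lemma rapidZ (X : Type) (g : X -> R) (s : X -> R[i]) (c : X -> A) : rapid g c ->
  rapid (fun x => nrm (s x) * g x) (fun x => s x *: c x).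
Proof.
move=> hc N; have [C C0 hC] := hc N; exists C => // x l.
by rewrite fourierZ nrmM mulrCA [leRHS]mulrCA ler_wpM2l ?nrm_ge0.
Qed.

Lemma rapidM (X : Type) (g h : X -> R) (c d : X -> A) : (forall x, 0 <= g x) -> (forall x, 0 <= h x) ->
  rapid g c -> rapid h d -> rapid (fun x => g x * h x) (fun x => c x *c d x).
Proof.
move=> g0 h0 hc hd N; have [C C0 hC] := hc (N + 2 * n)%N; have [D D0 hD] := hd N.
have [S S0 hS] := wt_sum_shift R n; exists (C * D * S) => [|x p].
  by rewrite !mulr_ge0 // ltW.
rewrite mulrC -ler_pdivlMr ?wtX_gt0 //; apply: (fourier_product_le H) => F.
apply: le_trans (_ : \sum_(l <- F) (C * g x * (D * h x) / wt p ^+ N) * wt (p - l) ^- (2 * n) <= _); last first.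
  rewrite -mulr_sumr; apply: le_trans (ler_wpM2l _ (hS p F)) _.
    by rewrite !mulr_ge0 ?invr_ge0 ?exprn_ge0 ?wt_ge0.
  by rewrite [leLHS]mulrAC; apply: ler_wpM2r; rewrite ?invr_ge0 ?exprn_ge0 ?wt_ge0 // le_eqVlt; apply/orP; left; apply/eqP; ring.
apply: ler_sum => l _.
have h1 := hC x (p - l); have h2 := hD x l.
have wpos (k : Z) M : 0 < wt k ^+ M by exact: wtX_gt0.
have hw : wt p ^+ N <= wt (p - l) ^+ N * wt l ^+ N.
  by rewrite -exprMn; apply: lerXn2r; rewrite ?nnegrE ?mulr_ge0 ?wt_ge0 //; exact: wtB.
rewrite mulrAC ler_pdivlMr // ler_pdivlMr //.
apply: le_trans (_ : (wt (p - l) ^+ (N + 2 * n) * nrm (fourier (c x) (p - l))) * (wt l ^+ N * nrm (fourier (d x) l)) <= _).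
  rewrite exprD; move: hw (wpos (p - l) (2 * n)%N) (nrm_ge0 (fourier (c x) (p - l))) (nrm_ge0 (fourier (d x) l)).
  move: (wt p ^+ N) (wt (p - l) ^+ N) (wt l ^+ N) (wt (p - l) ^+ (2 * n)) (nrm _) (nrm _) => y1 y2 y3 y4 y5 y6 hw z1 z2 z3.
  have -> : y2 * y4 * y6 * (y3 * y5) = y5 * y6 * (y2 * y3) * y4 by ring.
  by rewrite ler_wpM2r ?(ltW z1) // ler_wpM2l ?mulr_ge0.
by apply: ler_pM; rewrite ?mulr_ge0 ?nrm_ge0 ?exprn_ge0 ?wt_ge0.
Qed.

End Families.

(** * Symbol estimates *)

Section RealAnalysis.
Variables (R : realType).

Lemma powR_le_comparable (c x y s : R) : 1 <= c -> 0 < x -> 0 < y -> x <= c * y -> y <= c * x ->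
  y `^ s <= c `^ `|s| * x `^ s.
Proof.
move=> c1 x0 y0 xy yx; have c0 : 0 < c by apply: lt_le_trans c1.
have [s0|s0] := leP 0 s.
  rewrite (ger0_norm s0) -powRM ?(ltW c0) ?(ltW x0) //.
  by apply: ge0_ler_powR => //; rewrite nnegrE ?mulr_ge0 ?(ltW c0) ?(ltW x0) ?(ltW y0).
rewrite (ltr0_norm s0) -[s in y `^ s]opprK -[s in x `^ s]opprK !(powRN _ (- s)).
rewrite ler_pdivlMr ?powR_gt0 // mulrC ler_pdivrMr ?powR_gt0 // -powRM ?(ltW c0) ?(ltW y0) //.
apply: ge0_ler_powR; rewrite ?nnegrE ?mulr_ge0 ?(ltW c0) ?(ltW x0) ?(ltW y0) //.
by rewrite oppr_ge0 ltW.
Qed.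

Lemma compact_locally_bounded (T : topologicalType) (K : set T) (f : T -> R) : compact K ->
  (forall x, K x -> exists M : R, \forall y \near x, K y -> f y <= M) ->
  exists M : R, forall x, K x -> f x <= M.
Proof.
move=> /compact_near_coveringP cov h.
have : \forall b \near +oo, K `<=` (fun y => K y -> f y <= b).
  apply: cov => x Kx; have [M hM] := h x Kx.
  exists ([set y | K y -> f y <= M], [set b | M <= b]) => /=.
    by split=> //; apply: nbhs_pinfty_ge; exact: num_real.
  by move=> [y b] [/= hy hb] /hy /le_trans; apply.
move=> [M [_ hM]]; exists (M + 1) => x Kx; apply: hM => //; by rewrite ltrDl.
Qed.

Variable n : nat.
Local Notation rV := 'rV[R]_n.

Lemma sphere_compact : compact [set x : rV | enorm x = 1].
Proof.
have cS (s : seq 'I_n) : continuous (fun x : rV => \sum_(j <- s) x 0 j ^+ 2).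
  elim: s => [|j s ih] x.
    have -> : (fun x : rV => \sum_(j <- [::]) x 0 j ^+ 2) = (fun=> 0).
      by apply/funext => y; rewrite big_nil.
    exact: cst_continuous.
  have -> : (fun y : rV => \sum_(j <- j :: s) y 0 j ^+ 2) =
      (fun y => y 0 j * y 0 j + \sum_(j <- s) y 0 j ^+ 2).
    by apply/funext => y; rewrite big_cons expr2.
  have h := @coord_continuous R 1 n 0 j x.
  exact: (@cvgD _ _ _ _ (nbhs_filter x) _ _ _ _ (@cvgM _ _ _ (nbhs_filter x) _ _ _ _ h h) (ih x)).
have c1 : compact [set x : rV | forall j, `[-1, 1]%classic (x ord0 j)].
  apply: (@rV_compact R n (fun=> `[-1, 1]%classic)) => _; exact: segment_compact.
apply: subclosed_compact c1 _.
  rewrite (_ : [set x | _] = (fun x : rV => \sum_(j <- index_enum 'I_n) x 0 j ^+ 2) @^-1` [set y | y = 1]).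
    by apply: preimage_closed; [move=> x _; exact: cS|exact: closed_eq].
  apply/seteqP; split=> x /=.
    move=> x1; have := congr1 (fun y => y ^+ 2) x1; rewrite expr1n /enorm sqr_sqrtr //.
    by apply: sumr_ge0 => j _; exact: sqr_ge0.
  by move=> x1; rewrite /enorm x1 sqrtr1.
move=> x /= x1 j; rewrite /= in_itv /=.
by rewrite -ler_norml -x1 enorm_coord.
Qed.

End RealAnalysis.

Section CoordinatePath.
Variables (R : realType) (n : nat) (theta : 'M[R]_n) (A : nctorus theta).
Local Notation rV := 'rV[R]_n.

(** Reduces to the mean value theorem for real functions: [phi] will be the real or imaginary part
    of a Fourier coefficient. *)
Lemma is_derive_functional (f : rV -> A) (j : 'I_n) (x : rV) (d : A) (phi : A -> R) :
  diff_quot j f x h @[h --> 0^'] --> d ->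
  (forall a b, phi (a - b) = phi a - phi b) -> (forall (t : R) a, phi (t%:C *: a) = t * phi a) ->
  (forall a, `|phi a| <= nrm a) ->
  is_derive (0 : R) 1 (fun t => phi (f (x + t *: delta_mx 0 j))) (phi d).
Proof.
move=> /cvg_nrmP h pB pZ pb.
suff cv : (fun h : R => h^-1 *: (((fun t => phi (f (x + t *: delta_mx 0 j))) \o shift 0) (h *: 1)
     - phi (f (x + 0 *: delta_mx 0 j)))) @ 0^' --> phi d.
  by apply: DeriveDef; [apply: cvgP cv|apply: cvg_lim cv; exact: Rhausdorff].
apply/cvgrPdist_lt => e /h; apply: filterS => t ht /=.
rewrite scale0r !addr0 [t *: 1]mulr1 -pB; apply: le_lt_trans ht.
have -> : t^-1 *: phi (f (x + t *: delta_mx 0 j) - f x) = phi (diff_quot j f x t) by rewrite pZ.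
by rewrite -pB.
Qed.

Lemma coord_segment (f : rV -> A) (j : 'I_n) (x : rV) (a b M : R) (phi : A -> R) :
  (forall y, diff_quot j f y h @[h --> 0^'] --> pd j f y) ->
  (forall a b, phi (a - b) = phi a - phi b) -> (forall (t : R) a, phi (t%:C *: a) = t * phi a) ->
  (forall a, `|phi a| <= nrm a) ->
  (forall t, Num.min a b <= t <= Num.max a b -> `|phi (pd j f (x + t *: delta_mx 0 j))| <= M) ->
  `|phi (f (x + b *: delta_mx 0 j)) - phi (f (x + a *: delta_mx 0 j))| <= M * `|b - a|.
Proof.
move=> fd pB pZ pb hM.
apply: (@derive_lipschitz R (fun t => phi (f (x + t *: delta_mx 0 j)))
  (fun t => phi (pd j f (x + t *: delta_mx 0 j)))) => t /hM ht; split; last exact: ht.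
have := is_derive_functional (fd (x + t *: delta_mx 0 j)) pB pZ pb.
move=> [d1 d2]; move: d1 d2; rewrite /derivable /derive /=.
have -> : (fun h : R => h^-1 *: (phi (f (x + t *: delta_mx 0 j + (h *: 1 + 0) *: delta_mx 0 j)) -
       phi (f (x + t *: delta_mx 0 j + 0 *: delta_mx 0 j)))) =
   (fun h : R => h^-1 *: (phi (f (x + (h *: 1 + t) *: delta_mx 0 j)) - phi (f (x + t *: delta_mx 0 j)))).
  by apply/funext => h; rewrite scale0r !addr0 -addrA -scalerDl [t + _]addrC.
by move=> d1 d2; exact: DeriveDef.
Qed.

(* From [x] to [y] one coordinate at a time. *)
Lemma fourier_path (f : rV -> A) (x y : rV) (l : 'rV[int]_n) (M : R) :
  (forall j z, diff_quot j f z h @[h --> 0^'] --> pd j f z) ->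
  (forall j (z : rV), (forall i, Num.min (x 0 i) (y 0 i) <= z 0 i <= Num.max (x 0 i) (y 0 i)) ->
     nrm (fourier (pd j f z) l) <= M) ->
  nrm (fourier (f y) l - fourier (f x) l) <= 2 * M * \sum_(j < n) `|y 0 j - x 0 j|.
Proof.
move=> fd hM.
pose p (s : nat) : rV := \row_j (if (j < s)%N then y 0 j else x 0 j).
have px : p 0%N = x by apply/rowP => j; rewrite mxE.
have py : p n = y by apply/rowP => j; rewrite mxE ltn_ord.
have step (j : 'I_n) : nrm (fourier (f (p j.+1)) l - fourier (f (p j)) l) <= 2 * M * `|y 0 j - x 0 j|.
  pose r : rV := \row_i (if (i < j)%N then y 0 i else if i == j then 0 else x 0 i).
  have rE t i : (r + t *: delta_mx 0 j) 0 i = if (i < j)%N then y 0 i else if i == j then t else x 0 i.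
    rewrite !mxE eqxx /=; have [->|ij] := eqVneq i j; first by rewrite ltnn mulr1 add0r.
    by rewrite mulr0 addr0.
  have r1 : p j.+1 = r + y 0 j *: delta_mx 0 j.
    apply/rowP => i; rewrite rE mxE ltnS leq_eqVlt.
    by have [->|ij] := eqVneq i j; [rewrite eqxx ltnn|rewrite (negPf ij : (i == j :> nat) = false)].
  have r0 : p j = r + x 0 j *: delta_mx 0 j.
    by apply/rowP => i; rewrite rE mxE; have [->|] := eqVneq i j; rewrite ?ltnn.
  have hr t : Num.min (x 0 j) (y 0 j) <= t <= Num.max (x 0 j) (y 0 j) ->
      nrm (fourier (pd j f (r + t *: delta_mx 0 j)) l) <= M.
    move=> ht; apply: hM => i; rewrite rE; case: ifP => _.
      by rewrite ge_min le_max lexx !orbT.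
    by case: eqP => [->//|_]; rewrite ge_min le_max lexx.
  (* Real and imaginary parts are bounded separately, whence the factor 2. *)
  rewrite r1 r0 -fourierB; apply: le_trans (nrm_le_ReIm _) _; rewrite fourierB !raddfB.
  rewrite mulrAC [2 * _]mulrC mulrDr mulr1 mulrDl [X in _ <= X](_ : _ = M * `|y 0 j - x 0 j| + M * `|y 0 j - x 0 j|); last by ring.
  have FB a b : fourier (a - b) l = fourier a l - fourier b l by exact: fourierB.
  have FZ t a : fourier (t%:C *: a) l = t%:C * fourier a l by exact: fourierZ.
  apply: lerD.
    apply: (@coord_segment f j r (x 0 j) (y 0 j) M (fun a => complex.Re (fourier a l))) => //.
    - by move=> a b; rewrite FB raddfB.
    - by move=> t a; rewrite FZ; case: (fourier a l) => u v /=; rewrite mul0r subr0.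
    - by move=> a; apply: le_trans (Re_le_nrm _) _; exact: fourier_le.
    - by move=> t /hr; apply: le_trans; exact: Re_le_nrm.
  apply: (@coord_segment f j r (x 0 j) (y 0 j) M (fun a => complex.Im (fourier a l))) => //.
  - by move=> a b; rewrite FB raddfB.
  - by move=> t a; rewrite FZ; case: (fourier a l) => u v /=; rewrite mul0r addr0.
  - by move=> a; apply: le_trans (Im_le_nrm _) _; exact: fourier_le.
  - by move=> t /hr; apply: le_trans; exact: Im_le_nrm.
rewrite -{1}px -{1}py.
have -> : fourier (f (p n)) l - fourier (f (p 0%N)) l =
    \sum_(j < n) (fourier (f (p j.+1)) l - fourier (f (p j)) l).
  by rewrite -(big_mkord xpredT (fun j => fourier (f (p j.+1)) l - fourier (f (p j)) l)) telescope_sumr.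
by apply: le_trans (nrm_sum _ _ _) _; rewrite mulr_sumr; apply: ler_sum => j _.
Qed.

End CoordinatePath.

Section SymbolEstimates.
Variables (R : realType) (n : nat) (theta : 'M[R]_n) (A : nctorus theta) (H : L2completion A).
Variables (q : R[i]) (rho : 'rV[R]_n -> A) (rhos : nat -> 'rV[R]_n -> A).
Hypothesis n0 : (0 < n)%N.
Hypothesis hexp : symbol_expansion q rho rhos.
Hypothesis hinv : forall xi, xi != 0 -> smooth_invertible (rhos 0%N xi).
Local Notation m := (complex.Re q).
Hypothesis m0 : 0 < m.
Local Notation Z := 'rV[int]_n.
Local Notation rV := 'rV[R]_n.
Local Notation wt := (wt R).
Local Notation zv := (zvec R).

Lemma enorm_ge1_neq0 (x : rV) : 1 <= enorm x -> x != 0.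
Proof. by rewrite -enorm_eq0 => h; rewrite gt_eqF // (lt_le_trans ltr01). Qed.

Lemma symbol_dbound (Y : Type) (f : Y -> rV) (N : nat) (beta : 'I_n -> nat) :
  (forall y, 1 <= enorm (f y)) ->
  (forall y, smooth A (pds beta (fun eta => rho eta - \sum_(j < N) rhos j eta) (f y))) ->
  forall M, dbound (fun y => enorm (f y) `^ (m - N%:R - (\sum_(j < n) beta j)%N%:R)) M
    (fun y => pds beta (fun eta => rho eta - \sum_(j < N) rhos j eta) (f y)).
Proof.
move=> f1 fs M; apply: dbound_deltas => // alpha.
have [_ _ /(_ N alpha beta)[C hC]] := hexp; exists `|C| => // y.
have := hC (f y) (f1 y); rewrite nrm_norm_le => /le_trans; apply.
by rewrite ler_wpM2r ?powR_ge0 ?ler_norm.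
Qed.

Lemma rho_smooth x : smooth A (rho x).
Proof. by have [/(_ [::] x I)[]] := hexp. Qed.

Lemma pd_rho_smooth j x : smooth A (pd j rho x).
Proof. by have [/(_ [:: j] x I)[]] := hexp. Qed.

Lemma lead_smooth x : x != 0 -> smooth A (rhos 0%N x).
Proof. by move=> x0; have [_ /(_ 0%N)[/(_ [::] x x0)[]]] := hexp. Qed.

Lemma frechet_cvg_nrm (T : Type) (F : set_system T) (f : T -> A) l : Filter F ->
  frechet_cvg F f l -> f @ F --> l.
Proof.
move=> FF /(_ (fun=> 0%N)) /cvg_nrmP h; apply/cvg_nrmP => e /h; apply: filterS => x.
by rewrite deltas0 sub0r nrmN nrmBC.
Qed.

Lemma rho_pd j x : diff_quot j rho x h @[h --> 0^'] --> pd j rho x.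
Proof. by have [/(_ [::] x I)[_ _ /(_ j) h] _ _] := hexp; exact: frechet_cvg_nrm. Qed.

Lemma lead_cvg (x : rV) : x != 0 -> rhos 0%N @ x --> rhos 0%N x.
Proof. by move=> x0; have [_ /(_ 0%N)[/(_ [::] x x0)[_ h _] _] _] := hexp; exact: (frechet_cvg_nrm (nbhs_filter x) h). Qed.

Lemma pds0 (f : rV -> A) : pds (fun=> 0%N) f = f.
Proof. exact: multi_iter0. Qed.

Lemma pds1 (j : 'I_n) (f : rV -> A) : pds (fun i => (i == j) : nat) f = pd j f.
Proof. exact: multi_iter1. Qed.

Section Subfamily.
Variables (Y : Type) (f : Y -> rV).
Hypothesis f1 : forall y, 1 <= enorm (f y).

Lemma rho_dbound M : dbound (fun y => enorm (f y) `^ m) M (fun y => rho (f y)).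
Proof.
have E : (fun eta => rho eta - \sum_(j < 0) rhos j eta) = rho.
  by apply/funext => x; rewrite big_ord0 subr0.
have := @symbol_dbound Y f 0%N (fun=> 0%N) f1; rewrite E pds0 => /(_ _ M).
have -> : m - 0%:R - (\sum_(j < n) 0)%N%:R = m by rewrite big1 // !subr0.
by apply => y; exact: rho_smooth.
Qed.

Lemma pd_rho_dbound j M : dbound (fun y => enorm (f y) `^ (m - 1)) M (fun y => pd j rho (f y)).
Proof.
have E : (fun eta => rho eta - \sum_(j < 0) rhos j eta) = rho.
  by apply/funext => x; rewrite big_ord0 subr0.
have := @symbol_dbound Y f 0%N (fun i => (i == j) : nat) f1; rewrite pds1 E => /(_ _ M).
have -> : m - 0%:R - (\sum_(i < n) ((i == j) : nat))%N%:R = m - 1.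
  by rewrite (bigD1 j) //= eqxx big1 ?subr0 // => i /negPf ->.
by apply => y; exact: pd_rho_smooth.
Qed.

Lemma rest_dbound M : dbound (fun y => enorm (f y) `^ (m - 1)) M (fun y => rho (f y) - rhos 0%N (f y)).
Proof.
have E : (fun eta => rho eta - \sum_(j < 1) rhos j eta) = (fun eta => rho eta - rhos 0%N eta).
  by apply/funext => x; rewrite big_ord1.
have := @symbol_dbound Y f 1%N (fun=> 0%N) f1; rewrite E pds0 => /(_ _ M).
have -> : m - 1%:R - (\sum_(j < n) 0)%N%:R = m - 1 by rewrite big1 // subr0.
apply => y; apply: smoothB; first exact: rho_smooth.
exact/lead_smooth/enorm_ge1_neq0.
Qed.

Lemma dbound_rapid (g : Y -> R) c : (forall M, dbound g M c) -> rapid (A := A) g c.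
Proof. by move=> h N; exact: dbound_coef. Qed.

End Subfamily.

Lemma cpow_nrm t z : 0 < t -> nrm (cpow t z : R[i]) = t `^ complex.Re z.
Proof.
move=> t0; rewrite /cpow /cexp nrmM nrmR (ger0_norm (expR_ge0 _)).
have -> : complex.Re (z * (ln t)%:C) = complex.Re z * ln t by case: z => a b /=; rewrite mulr0 subr0.
have := nrm_eit (complex.Im (z * (ln t)%:C)); rewrite eitE => ->.
by rewrite mulr1 /powR gt_eqF.
Qed.

Lemma lead_homogeneous t xi : 0 < t -> xi != 0 -> rhos 0%N (t *: xi) = cpow t q *: rhos 0%N xi.
Proof. by have [_ /(_ 0%N)[_ h] _] := hexp; rewrite -[q in RHS]subr0; exact: h. Qed.

Local Notation sphere := {x : rV | enorm x == 1}.

Lemma lead_inverse_ex : exists b : sphere -> A, forall y,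
  [/\ smooth A (b y), rhos 0%N (val y) *c b y = aone & b y *c rhos 0%N (val y) = aone].
Proof.
have h (y : sphere) : exists v : A,
    [/\ smooth A v, rhos 0%N (val y) *c v = aone & v *c rhos 0%N (val y) = aone].
  by apply: hinv; apply: enorm_ge1_neq0; rewrite (eqP (valP y)).
by have [b hb] := choice h; exists b.
Qed.

(* Invertibility is an open condition, with locally bounded inverse. *)
Lemma lead_inverse_bounded : exists B : R, forall x b, enorm x = 1 ->
  rhos 0%N x *c b = aone -> nrm b <= B.
Proof.
have inv_uniq (a b b' : A) : b *c a = aone -> a *c b' = aone -> b = b'.
  by move=> ba ab; rewrite -[b]amul1r -ab amulA ba amul1l.
have ge1 (x : rV) : enorm x = 1 -> x != 0 by move=> x1; apply: enorm_ge1_neq0; rewrite x1.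
(* The compactness argument bounds a real function: here the norm of the inverse, with default value
   0 where there is none. *)
pose f x : R := if pselect (exists b, rhos 0%N x *c b = aone) is left h then nrm (xget 0 [set b | rhos 0%N x *c b = aone]) else 0.
have fE x b : enorm x = 1 -> rhos 0%N x *c b = aone -> f x = nrm b.
  move=> x1 xb; have [v [_ xv vx]] := hinv (ge1 x x1).
  rewrite /f; case: pselect => [h|[]]; last by exists b.
  case: xgetP => [y _ /= xy|/(_ b)//]; by rewrite -(inv_uniq _ _ _ vx xy) -(inv_uniq _ _ _ vx xb).
suff [M hM] : exists M, forall x, [set x | enorm x = 1] x -> f x <= M.
  by exists M => x b x1 /(fE x b x1) <-; exact: hM.
apply: compact_locally_bounded; first exact: sphere_compact.
move=> x /= x1; have x0 := ge1 x x1; have [b [_ xb bx]] := hinv x0.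
have b1 : 0 < 2 * (nrm b + 1) by rewrite mulr_gt0 // ltr_wpDl ?nrm_ge0.
exists (2 * nrm b); have /cvg_nrmP h := lead_cvg x0.
have := h (2 * (nrm b + 1))^-1; rewrite invr_gt0 => /(_ b1); apply: filterS => y hy y1.
have [c [_ yc cy]] := hinv (ge1 y y1); rewrite (fE y c y1 yc).
(* Perturbation identity for inverses; the choice of neighbourhood makes the second term at most
   half of [nrm c]. *)
have e : c = b + b *c ((rhos 0%N x - rhos 0%N y) *c c).
  by rewrite amulBl amulBr amulA bx amul1l yc amul1r addrC subrK.
have h1 : nrm c <= nrm b + nrm b * ((2 * (nrm b + 1))^-1 * nrm c).
  rewrite {1}e; apply: le_trans (nrmD _ _) _; rewrite lerD2l; apply: le_trans (nrm_amul _ _) _.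
  rewrite ler_wpM2l ?nrm_ge0 //; apply: le_trans (nrm_amul _ _) _.
  by rewrite ler_wpM2r ?nrm_ge0 // ltW.
have h2 : nrm b * ((2 * (nrm b + 1))^-1 * nrm c) <= nrm c / 2.
  rewrite invfM mulrA mulrA [nrm c / 2]mulrC ler_wpM2r ?nrm_ge0 //.
  by rewrite mulrAC ler_piMl ?invr_ge0 // ler_pdivrMr ?ltr_wpDl ?nrm_ge0 // mul1r lerDl.
move: h1 h2; set y1' := nrm b * (_ * _); move: y1' (nrm c) (nrm b) => *; lra.
Qed.

Definition nonzero := {k : Z | k != 0}.
Definition zpt (y : nonzero) : rV := zv (val y).

Lemma zpt_ge1 y : 1 <= enorm (zpt y).
Proof. exact/enorm_ge1/(valP y). Qed.

Lemma zpt_comparable y s : enorm (zpt y) `^ s <= (2 * n.+1%:R) `^ `|s| * wt (val y) `^ s.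
Proof.
have h1 := zpt_ge1 y; have h2 := enorm_wt R (val y); have h3 := wt_enorm R (val y).
have n1 : 1 <= n.+1%:R :> R by rewrite ler1n.
apply: powR_le_comparable.
- by move: n1; move: (n.+1%:R : R) => N *; lra.
- exact: wt_gt0.
- exact: lt_le_trans ltr01 h1.
- apply: le_trans h3 _; rewrite mulrAC; rewrite mulrC ler_wpM2r ?ler0n //.
  by move: h1; rewrite /zpt; move: (enorm _) => N *; lra.
- apply: le_trans (_ : wt (val y) <= _).
    by apply: le_trans h2; rewrite lerDr.
  by rewrite ler_peMl ?wt_ge0 //; move: n1; move: (n.+1%:R : R) => N *; lra.
Qed.

(** On the unit sphere every power of [enorm] is 1, so writing the principal symbol as rho minus the
    rest bounds all its derivatives there by the symbol estimates alone. The rule for inverses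
    applies on the sphere, and homogeneity carries the result to lattice points with a factor of
    order -m. *)
Lemma lead_inverse_rapid : exists sg : nonzero -> A,
  (forall y, sg y *c rhos 0%N (zpt y) = aone) /\ rapid (fun y => wt (val y) `^ (- m)) sg.
Proof.
have [b hb] := lead_inverse_ex.
have sph1 (y : sphere) : 1 <= enorm (val y) by rewrite (eqP (valP y)).
have ab (y : sphere) : rhos 0%N (val y) *c b y = aone by case: (hb y).
have ba (y : sphere) : b y *c rhos 0%N (val y) = aone by case: (hb y).
have bs (y : sphere) : smooth A (b y) by case: (hb y).
have w1 s : (fun y : sphere => enorm (val y) `^ s) = (fun=> 1).
  by apply/funext => y; rewrite (eqP (valP y)) powR1.
have da N : dbound (fun=> 1) N (fun y : sphere => rhos 0%N (val y)).
  have h1 := rho_dbound sph1 N; have h2 := rest_dbound sph1 N; rewrite w1 in h1; rewrite w1 in h2.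
  have := dboundD h1 (dboundN h2); congr dbound; apply/funext => y.
  by rewrite opprB addrC subrK.
have db0 : dbound (fun=> 1) 0 b.
  split=> //; have [B hB] := lead_inverse_bounded; exists `|B| => // y.
  by rewrite mulr1; apply: le_trans (ler_norm B); exact: hB (eqP (valP y)) (ab y).
have rb : rapid (fun=> 1) b by apply: dbound_rapid => N; exact: (dbound_inverse H ab ba bs da db0).
have t0 y : 0 < enorm (zpt y) by apply: lt_le_trans (zpt_ge1 y).
have nrmz y : enorm ((enorm (zpt y))^-1 *: zpt y) = 1.
  by rewrite enormZ gtr0_norm ?invr_gt0 // mulVf ?gt_eqF.
pose z y : sphere := exist _ ((enorm (zpt y))^-1 *: zpt y) (introT eqP (nrmz y)).
have cp0 y : cpow (enorm (zpt y)) q != 0.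
  by apply: contraTneq (powR_gt0 m (t0 y)) => c0; rewrite -(cpow_nrm q (t0 y)) c0 nrm0 ltxx.
exists (fun y => (cpow (enorm (zpt y)) q)^-1 *: b (z y)); split.
  move=> y; have zE : enorm (zpt y) *: val (z y) = zpt y.
    by rewrite /= scalerA mulfV ?scale1r ?gt_eqF.
  rewrite -[in X in _ *c X]zE lead_homogeneous // ?amulZl ?amulZr ?scalerA ?ba ?mulVf ?scale1r //.
  by apply: enorm_ge1_neq0; rewrite (eqP (valP (z y))).
have := rapidZ (fun y => (cpow (enorm (zpt y)) q)^-1) (rapid_comp z rb).
apply: (@rapid_le _ _ _ _ _ _ _ _ ((2 * n.+1%:R) `^ `|- m|)); first exact: powR_ge0.
move=> y; rewrite /= mulr1 nrmV (cpow_nrm q (t0 y)) -powRN; exact: zpt_comparable.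
Qed.

End SymbolEstimates.

(** * The remainder left by freezing the principal symbol *)

Section Remainder.
Variables (R : realType) (n : nat) (theta : 'M[R]_n) (A : nctorus theta) (H : L2completion A).
Variables (q : R[i]) (rho : 'rV[R]_n -> A) (rhos : nat -> 'rV[R]_n -> A).
Hypothesis n0 : (0 < n)%N.
Hypothesis hexp : symbol_expansion q rho rhos.
Hypothesis hinv : forall xi, xi != 0 -> smooth_invertible (rhos 0%N xi).
Local Notation m := (complex.Re q).
Hypothesis m0 : 0 < m.
Local Notation Z := 'rV[int]_n.
Local Notation rV := 'rV[R]_n.
Local Notation wt := (wt R).
Local Notation zv := (zvec R).
Local Notation nonzero := (nonzero n).
Local Notation zpt := (zpt R).

Lemma rho_lattice_rapid : rapid (fun k : Z => wt k `^ m) (fun k => rho (zv k)).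
Proof.
move=> N; have [C C0 hC] := dbound_rapid (rho_dbound hexp (@zpt_ge1 R n)) N.
(* The symbol estimates hold only for |xi| >= 1, so k = 0 is covered by smoothness of the single
   element [rho 0]. *)
have /smoothP[/(_ N)[D D0 hD] _] := rho_smooth hexp (zv 0).
pose K := (2 * n.+1%:R : R) `^ `|m|.
have K0 : 0 <= K by exact: powR_ge0.
exists (C * K + D) => [|k l]; first by rewrite addr_ge0 ?mulr_ge0.
have [->|k0] := eqVneq k 0.
  rewrite wt0 powR1 mulr1; apply: le_trans (hD l) _.
  by rewrite lerDr mulr_ge0.
apply: le_trans (hC (exist _ k k0) l) _; rewrite mulrDl; apply: le_trans (_ : C * K * wt k `^ m <= _).
  by rewrite -mulrA ler_wpM2l //; exact: zpt_comparable.
by rewrite lerDl mulr_ge0 ?powR_ge0.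
Qed.

Variable M : nat.
Hypothesis hM : m + 1 <= M%:R.

Let wt_powR_ge1 (k : Z) : 1 <= wt k `^ m.
Proof. by have := @ge0_ler_powR R m (ltW m0) 1 (wt k); rewrite powR1; apply; rewrite ?nnegrE ?wt_ge0 ?ler01 ?wt_ge1. Qed.

Let far_bound (i k : Z) : wt i <= (2 * n%:R + 2) * wt (i - k) ->
  wt k `^ m + wt i `^ m <= 2 * (2 * n%:R + 2) * (wt i `^ (m - 1) * wt (i - k) ^+ M).
Proof.
move=> far; pose D := wt (i - k); have D1 : 1 <= D by exact: wt_ge1.
have D0 : 0 <= D by exact: wt_ge0.
have P0 : 0 <= wt i `^ (m - 1) by exact: powR_ge0.
have h1 : wt k `^ m <= D `^ m * wt i `^ m.
  rewrite -powRM ?wt_ge0 //; apply: ge0_ler_powR; rewrite ?nnegrE ?mulr_ge0 ?wt_ge0 ?(ltW m0) //.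
  by rewrite /D wtBC; exact: wtB.
have h2 : wt i `^ m <= D `^ m * wt i `^ m by rewrite ler_peMl ?powR_ge0 ?wt_powR_ge1.
have h3 : D `^ m * D <= D ^+ M.
  rewrite -{2}(powRr1 D0) -powRD; last by apply/implyP => _; rewrite gt_eqF // (lt_le_trans ltr01).
  by rewrite -powR_mulrn // ler_powR.
apply: le_trans (lerD h1 h2) _; rewrite [leLHS](_ : _ = 2 * (D `^ m * wt i `^ m)); last by ring.
rewrite -[leRHS]mulrA ler_wpM2l //.
rewrite -(mulr_powRB1 (wt_ge0 R i) m0).
apply: le_trans (_ : D `^ m * ((2 * n%:R + 2) * D * wt i `^ (m - 1)) <= _).
  by rewrite ler_wpM2l ?powR_ge0 // ler_wpM2r.
have -> : D `^ m * ((2 * n%:R + 2) * D * wt i `^ (m - 1)) = (2 * n%:R + 2) * (wt i `^ (m - 1) * (D `^ m * D)) by ring.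
by rewrite ler_wpM2l ?addr_ge0 ?mulr_ge0 // ler_wpM2l.
Qed.

Lemma pd_rho_coef N : exists2 C : R, 0 <= C & forall (j : 'I_n) (x : rV) l, 1 <= enorm x ->
  wt l ^+ N * nrm (fourier (pd j rho x) l) <= C * enorm x `^ (m - 1).
Proof.
have h (j : 'I_n) : exists C : R, 0 <= C /\ forall (x : rV) l, 1 <= enorm x ->
    wt l ^+ N * nrm (fourier (pd j rho x) l) <= C * enorm x `^ (m - 1).
  have [C C0 hC] := dbound_rapid (pd_rho_dbound hexp (f := fun x : {x : rV | 1 <= enorm x} => val x) (fun x => valP x) j) N.
  by exists C; split=> // x l x1; exact: hC (exist _ x x1) l.
have [C hC] := choice h; exists (\sum_(j < n) C j) => [|j x l x1].
  by apply: sumr_ge0 => j _; have [] := hC j.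
have [_ /(_ x l x1) h1] := hC j; apply: le_trans h1 _; rewrite ler_wpM2r ?powR_ge0 //.
by rewrite (bigD1 j) //= lerDl sumr_ge0 // => i _; have [] := hC i.
Qed.

(** Two regimes. Far from the diagonal both terms are bounded separately; near it the symbol is
    Lipschitz on the box spanned by i and k, where |xi| is comparable to |i| and the derivative has
    order m - 1. *)
Lemma rho_diff_rapid : rapid (fun p : nonzero * Z => wt (val p.1) `^ (m - 1) * wt (val p.1 - p.2) ^+ M)
  (fun p => rho (zv p.2) - rho (zpt p.1)).
Proof.
move=> N; have [C C0 hC] := rho_lattice_rapid N; have [D D0 hD] := pd_rho_coef N.
pose K := (4 * n%:R : R) `^ `|m - 1|; have K0 : 0 <= K by exact: powR_ge0.
have nR : 1 <= n%:R :> R by rewrite ler1n.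
exists (C * (2 * (2 * n%:R + 2)) + 2 * (D * K)) => [|[[i i0] k] l] /=.
  by rewrite addr_ge0 ?mulr_ge0 ?addr_ge0 ?mulr_ge0.
set P := wt i `^ (m - 1); set W := wt (i - k) ^+ M.
have P0 : 0 <= P by exact: powR_ge0.
have W0 : 0 <= W by rewrite exprn_ge0 ?wt_ge0.
have wl : 0 < wt l ^+ N by exact: wtX_gt0.
rewrite mulrDl.
have [far|near] := leP (wt i) ((2 * n%:R + 2) * wt (i - k)).
  apply: le_trans (_ : C * (2 * (2 * n%:R + 2)) * (P * W) <= _); last first.
    by rewrite lerDl !mulr_ge0.
  rewrite -[leRHS]mulrA; apply: le_trans (ler_wpM2l C0 (far_bound far)).
  rewrite fourierB mulrDr; apply: le_trans (ler_wpM2l (ltW wl) (nrmB _ _)) _.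
  by rewrite mulrDr; apply: lerD; [exact: (hC k l)|exact: (hC i l)].
apply: le_trans (_ : 2 * (D * K) * (P * W) <= _); last first.
  by rewrite lerDr !mulr_ge0 ?addr_ge0 ?mulr_ge0.
pose a := \sum_(j < n) `|zv i 0 j|.
pose d := \sum_(j < n) `|zv k 0 j - zv i 0 j|.
have aE : wt i = 1 + a by congr (1 + _); apply: eq_bigr => j _; rewrite mxE.
have dE : wt (i - k) = 1 + d.
  rewrite wtBC; congr (1 + _); apply: eq_bigr => j _.
  by rewrite !mxE rmorphB.
have d0 : 0 <= d by exact: sumr_ge0.
have hz (z : rV) : (forall j, Num.min (zv i 0 j) (zv k 0 j) <= z 0 j <= Num.max (zv i 0 j) (zv k 0 j)) ->
    1 <= enorm z /\ enorm z `^ (m - 1) <= K * P.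
  move=> hz; have zi : \sum_(j < n) `|z 0 j - zv i 0 j| <= d.
    apply: ler_sum => j _; have := hz j; move: (zv i 0 j) (zv k 0 j) (z 0 j) => x y t.
    rewrite ge_min le_max => /andP[/orP[] h1 /orP[] h2];
      by rewrite ler_norml; have := ler_norm (y - x); have := ler_norm (x - y); rewrite (distrC x y) => *; apply/andP; split; lra.
  have z1 : a - d <= \sum_(j < n) `|z 0 j|.
    rewrite lerBlDr; apply: le_trans (lerD (lexx _) zi); rewrite -big_split /=; apply: ler_sum => j _.
    by have := lerB_dist (zv i 0 j) (z 0 j); rewrite distrC; move: (`|_|) (`|_|) (`|_|) => *; lra.
  have z2 : \sum_(j < n) `|z 0 j| <= a + d.
    apply: le_trans (lerD (lexx _) zi); rewrite -big_split /=; apply: ler_sum => j _.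
    by have := lerB_dist (z 0 j) (zv i 0 j); move: (`|_|) (`|_|) (`|_|) => *; lra.
  have z3 := enorm_le z; have z4 := sum_enorm z; have z5 := enorm_ge0 z.
  move: near z1 z2 z3 z4 z5 nR d0; rewrite aE dE /K /P aE.
  move: (\sum_(_ < _) _) (enorm z) (n%:R : R) => s e N0 near z1 z2 z3 z4 z5 nR d0.
  have Nd : 0 <= N0 * d by rewrite mulr_ge0 //; lra.
  (* The factor 2n + 2 is chosen for this inequality: it keeps the box out of the open unit ball and
     makes norms on it comparable to [wt i] within the factor 4n. *)
  have ad : 2 * d + 2 * N0 <= a by nra.
  have e1 : 1 <= e by nra.
  split=> //; apply: powR_le_comparable; first by lra.
  - by lra.
  - by lra.
  - by nra.
  - by nra.
rewrite fourierB mulrC -ler_pdivlMr //; apply: le_trans (fourier_path (M := D * (K * P) / wt l ^+ N) (rho_pd hexp) _) _.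
  move=> j z /hz[z1 z2]; rewrite ler_pdivlMr // mulrC; apply: le_trans (hD j z l z1) _.
  by rewrite ler_wpM2l.
rewrite -/d; have dW : d <= W.
  apply: le_trans (_ : wt (i - k) <= _); first by rewrite dE lerDr.
  rewrite /W -(prednK (_ : 0 < M)%N) ?exprS ?ler_peMr ?wt_ge0 ?exprn_ege1 ?wt_ge1 //.
  by rewrite -(ltr0n R); apply: lt_le_trans hM; rewrite addr_gt0.
rewrite ler_pdivlMr //.
have -> : 2 * (D * (K * P) / wt l ^+ N) * d * wt l ^+ N = 2 * (D * K) * (P * d).
  by field; rewrite gt_eqF.
by rewrite !ler_wpM2l ?mulr_ge0.
Qed.

(** The difference splits into [rho k - rho i] and rho minus the principal symbol at i, both of
    order m - 1 in i up to a power of [wt (i - k)]; [sg], of order -m, brings this to order -1. *)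
Lemma parametrix : exists sg : nonzero -> A,
  [/\ forall y, sg y *c rhos 0%N (zpt y) = aone, rapid (fun y => wt (val y) `^ (- m)) sg &
  rapid (fun p : nonzero * Z => (wt (val p.1))^-1 * wt (val p.1 - p.2) ^+ M)
    (fun p => sg p.1 *c (rho (zv p.2) - rhos 0%N (zpt p.1)))].
Proof.
have [sg [sg1 sgr]] := lead_inverse_rapid H hexp hinv; exists sg; split=> //.
have g0 (p : nonzero * Z) : 0 <= wt (val p.1) `^ (m - 1) * wt (val p.1 - p.2) ^+ M.
  by rewrite mulr_ge0 ?powR_ge0 ?exprn_ge0 ?wt_ge0.
have rest : rapid (fun p : nonzero * Z => wt (val p.1) `^ (m - 1) * wt (val p.1 - p.2) ^+ M)
    (fun p => rho (zpt p.1) - rhos 0%N (zpt p.1)).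
  have := rapid_comp (@fst nonzero Z) (dbound_rapid (rest_dbound hexp (@zpt_ge1 R n))).
  apply: (@rapid_le _ _ _ _ _ _ _ _ ((2 * n.+1%:R) `^ `|m - 1|)); first exact: powR_ge0.
  move=> [i k] /=; apply: le_trans (zpt_comparable _ _) _.
  by rewrite ler_wpM2l ?powR_ge0 // ler_peMr ?powR_ge0 // exprn_ege1 ?wt_ge1.
have := rapidM H (fun p => powR_ge0 _ _) g0 (rapid_comp (@fst nonzero Z) sgr) (rapidD rho_diff_rapid rest).
have -> : (fun p : nonzero * Z => (sg \o fst) p *c (rho (zv p.2) - rho (zpt p.1) + (rho (zpt p.1) - rhos 0%N (zpt p.1)))) =
   (fun p => sg p.1 *c (rho (zv p.2) - rhos 0%N (zpt p.1))).
  by apply/funext => p; rewrite /= addrA subrK.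
apply: (@rapid_le _ _ _ _ _ _ _ _ 1) => // -[i k] /=.
rewrite mul1r mulrA -powRD; last by apply/implyP => _; rewrite gt_eqF ?wt_gt0.
by rewrite addrA addNr add0r powR_inv1 ?wt_ge0.
Qed.

End Remainder.

(** * Elliptic regularity *)

Section EsumReal.
Variables (R : realType) (T : choiceType) (f : T -> R).
Hypothesis f0 : forall k, 0 <= f k.

Lemma esum_fsum_le B : (forall F : {fset T}, \sum_(k <- F) f k <= B) ->
  (\esum_(k in [set: T]) (f k)%:E <= B%:E)%E.
Proof.
move=> h; apply: ge_ereal_sup => _ [X [fX _] <-].
by rewrite fsbig_finite //= sumEFin lee_fin.
Qed.

Lemma esum_lt_pinfty : (\esum_(k in [set: T]) (f k)%:E < +oo)%E ->
  exists B, forall F : {fset T}, \sum_(k <- F) f k <= B.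
Proof.
have s0 : (0 <= \esum_(k in [set: T]) (f k)%:E)%E by apply: esum_ge0 => k _; rewrite lee_fin.
move=> fin; exists (fine (\esum_(k in [set: T]) (f k)%:E)) => F.
rewrite -lee_fin fineK; last by rewrite ge0_fin_numE.
apply: esum_ge; exists [set` F]; first by split.
by rewrite fsbig_finite //= set_fsetK sumEFin.
Qed.
End EsumReal.

Section Realization.
Variables (R : realType) (n : nat) (theta : 'M[R]_n) (A : nctorus theta) (H : L2completion A).
Local Notation Z := 'rV[int]_n.
Local Notation wt := (wt R).
Local Notation zv := (zvec R).
Local Notation U := (Uk A).
Local Notation emb := (L2_emb H).
Local Notation coef := (L2_coef (H := H)).

Lemma amul_sumr (I : Type) (r : seq I) (a : A) (F : I -> A) :
  a *c (\sum_(i <- r) F i) = \sum_(i <- r) a *c F i.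
Proof. by elim/big_rec2: _ => [|i y x _ <-]; rewrite ?amul0r ?amulDr. Qed.

Lemma nrm_fourier_star (a : A) k : nrm (fourier (star a) k) = nrm (fourier a (- k)).
Proof.
have [c c1 hc] := UUstar A 0 (- k).
rewrite U0 amul1l sub0r opprK in hc.
rewrite -[fourier (star a) k](dot_emb H) dot_cj nrmJ dot_emb starK tau_comm /fourier hc.
by rewrite amulZr tauZ nrmM c1 mul1r.
Qed.

Lemma sum_finite (f : Z -> A) (F : {fset Z}) : (forall k, k \notin F -> f k = 0) ->
  summability.sum f = \sum_(k <- F) f k.
Proof.
move=> h; apply: cvg_lim; first exact: norm_hausdorff.
apply/cvg_nrmP => d d0; exists F => // G /= FG.
have -> : partial_sum f G = \sum_(k <- G) f k by rewrite /partial_sum big_seq_fsetE.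
rewrite (fsum_split f FG) opprD addrA subrr add0r nrmN big_seq big1 ?nrm0 //.
by move=> k; rewrite in_fsetD => /andP[/h].
Qed.

Variables (q : R[i]) (rho : 'rV[R]_n -> A) (P : A -> A).
Hypothesis PE : forall u, smooth A u -> P u = quantization rho u.
Local Notation m := (complex.Re q).
Local Notation T := (realization H m P).

Lemma quantization_tsum (c : Z -> R[i]) (F : {fset Z}) :
  P (tsum A c F) = \sum_(k <- F) c k *: (rho (zv k) *c U k).
Proof.
rewrite PE; last exact: tsum_smooth.
rewrite /quantization (sum_finite (F := F)) => [|k /negPf kF]; last by rewrite fourier_tsum kF scale0r.
by rewrite big_seq [RHS]big_seq; apply: eq_bigr => k kF; rewrite fourier_tsum kF.
Qed.

Lemma quantization_0 : P 0 = 0.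
Proof. by have := quantization_tsum (fun=> 0) fset0; rewrite /tsum !big_seq_fset0. Qed.

(** The zero approximant is at Sobolev distance 0 from u = 0, and [P 0 = 0]. Injectivity of the
    resolvent rests on this. *)
Lemma realization_0 w : T (0, w) -> w = 0.
Proof.
move=> [_ h]; apply: nrm_eps0 => e /h[d [d0 hd]]; rewrite -nrm_norm_le; apply: ltW.
have := hd 0 (smooth0 A); rewrite quantization_0 linear0 !subr0; apply.
rewrite /sobolev_norm2 esum1 ?lte_fin // => k _.
by rewrite {1}/fst /L2_coef dot0l normr0 expr0n mulr0.
Qed.

(** Finite Fourier truncations of u are smooth and converge to u in the Sobolev norm, so the
    defining limit may be taken along them, where P is an explicit finite sum. *)
Lemma realization_approx u w (e : R) : T (u, w) -> 0 < e -> exists F0 : {fset Z},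
  forall F, (F0 `<=` F)%fset -> nrm (w - emb (P (tsum A (coef u) F))) <= e.
Proof.
move=> [/= su h] /h[d [d0 hd]].
pose f k : R := (1 + enorm (zv k) ^+ 2) `^ m * nrm (coef u k) ^+ 2.
have f0 k : 0 <= f k by rewrite mulr_ge0 ?powR_ge0 ?sqr_ge0.
have [B hB] := esum_lt_pinfty f0 su.
have d2 : 0 < d / 2 by rewrite divr_gt0.
have [F0 hF] := fsum_tail f0 hB d2; exists F0 => F F0F.
rewrite -nrm_norm_le; apply/ltW/hd; first exact: tsum_smooth.
pose f' k := if k \in F then 0 else f k.
have -> : sobolev_norm2 m (u - emb (tsum A (coef u) F)) = (\esum_(k in [set: Z]) (f' k)%:E)%E.
  apply: eq_esum => k _; congr (_%:E); rewrite /f' coefB coef_emb fourier_tsum.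
  by case: ifP => _; rewrite ?subr0 // subrr normr0 expr0n mulr0.
apply: le_lt_trans (_ : (d / 2)%:E < _)%E; last by rewrite lte_fin; lra.
apply: esum_fsum_le => G.
apply: le_trans (hF (F0 `|` (G `\` F))%fset (fsubsetUl _ _)).
rewrite (bigID (mem F)) /= big1 ?add0r => [|k kF]; last by rewrite /f' kF.
rewrite -big_filter; have -> : \sum_(k <- [seq k <- G | k \notin F]) f' k = \sum_(k <- (G `\` F)%fset) f k.
  rewrite [RHS](perm_big [seq k <- G | k \notin F]) /=; last first.
    by apply: uniq_perm => [||k]; rewrite ?filter_uniq ?fset_uniq // mem_filter in_fsetD.
  rewrite big_filter [RHS]big_filter; apply: eq_bigr => k kF.
  by rewrite /f' (negPf kF).
apply: fsum_le => //; apply/fsubsetP => k; rewrite !in_fsetE => /andP[kF kG].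
by rewrite kF kG orbT andbT; apply: contra kF; exact: (fsubsetP F0F).
Qed.

Variables (rhos : nat -> 'rV[R]_n -> A).
Hypothesis n0 : (0 < n)%N.
Hypothesis hexp : symbol_expansion q rho rhos.
Hypothesis hinv : forall xi, xi != 0 -> smooth_invertible (rhos 0%N xi).
Hypothesis m0 : 0 < m.
Let dl := Num.min 1 m.

(* Testing T u = w against the vector (sigma(i)^* U^i), sigma(i) the inverse of  *)
(* the principal symbol at i, recovers u_i up to the remainder of [parametrix].  *)
Lemma regularity N : exists2 C : R, 0 <= C & forall u w, T (u, w) -> forall i (e : R), 0 < e ->
  exists F : {fset Z}, nrm (coef u i) <=
    C * wt i `^ (- dl) * \sum_(k <- F) wt (i - k) ^- N * (nrm (coef u k) + nrm (coef w k)) + e.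
Proof.
pose M := (Num.truncn (m + 1)).+1; have hM : m + 1 <= M%:R by apply/ltW/truncnS_gt.
have [sg [sg1 sgr rem]] := parametrix H n0 hexp hinv m0 hM.
(* M of the [N + M] powers compensate the growth in [i - k] that [parametrix] allows. *)
have [C1 C10 hC1] := rem (N + M)%N; have [C2 C20 hC2] := sgr N.
exists (C1 + C2 + 1) => [|u w uw i e e0]; first by rewrite !addr_ge0.
have wpos (k : Z) N' : 0 < wt k ^+ N' by exact: wtX_gt0.
(* At i = 0 there is no inverse symbol; the term k = 0 alone suffices, which explains the [+ 1] in
   the constant. *)
have [->|i0] := eqVneq i 0.
  exists [fset 0]%fset; rewrite big_seq_fset1 subr0 wt0 powR1 expr1n invr1 mulr1 mul1r.
  apply: le_trans (_ : 1 * nrm (coef u 0) <= _); first by rewrite mul1r.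
  apply: le_trans (_ : (C1 + C2 + 1) * (nrm (coef u 0) + nrm (coef w 0)) <= _); last by rewrite lerDl ltW.
  by apply: ler_pM; rewrite ?nrm_ge0 // ?lerDl ?nrm_ge0 // lerDr addr_ge0.
pose y : nonzero n := exist _ i i0.
pose g := emb (star (sg y) *c U i).
pose Rm k := fourier (sg y *c (rho (zv k) - rhos 0%N (zpt R y)) *c U k) i.
have test (F : {fset Z}) : i \in F ->
    dot (emb (P (tsum A (coef u) F))) g = coef u i + \sum_(k <- F) coef u k * Rm k.
  move=> iF; rewrite dot_emb starM starK amulA tau_comm amulA -/(fourier _ i).
  rewrite quantization_tsum amul_sumr fourier_sum.
  have E k : fourier (sg y *c (coef u k *: (rho (zv k) *c U k))) i = coef u k * Rm k + coef u k * (k == i)%:R.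
    rewrite amulZr fourierZ -mulrDr; congr (_ * _).
    by rewrite /Rm amulBr sg1 amulBl amul1l fourierB fourier_U subrK amulA.
  rewrite (eq_bigr _ (fun k _ => E k)) big_split /= addrC; congr (_ + _).
  rewrite (bigD1_seq i) ?fset_uniq //= eqxx mulr1 big1 ?addr0 // => k /negPf ki.
  by rewrite ki mulr0.
have wi1 : 1 <= wt i by exact: wt_ge1.
have wdl : 0 <= wt i `^ (- dl) by exact: powR_ge0.
have hR k : nrm (Rm k) <= C1 * wt i `^ (- dl) * wt (i - k) ^- N.
  rewrite /Rm nrm_fourier_mulU; have := hC1 (y, k) (i - k) => /=.
  rewrite exprD mulrAC [leRHS]mulrA ler_pM2r // => h.
  rewrite ler_pdivlMr // mulrC; apply: le_trans h _; rewrite ler_wpM2l //.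
  by rewrite -powR_inv1 ?wt_ge0 // ler_powR // lerN2 ge_min lexx.
have hg k : nrm (coef g k) <= C2 * wt i `^ (- dl) * wt (i - k) ^- N.
  rewrite coef_emb nrm_fourier_mulU nrm_fourier_star opprB ler_pdivlMr // mulrC.
  apply: le_trans (hC2 y (i - k)) _; rewrite ler_wpM2l //=.
  by rewrite ler_powR // lerN2 ge_min lexx orbT.
have e2 : 0 < e / 2 by rewrite divr_gt0.
have g1 : 0 < nrm g + 1 by rewrite ltr_wpDl ?nrm_ge0.
have [F1 hF1] := realization_approx uw (divr_gt0 e2 g1).
have [F2 hF2] := parseval w g e2.
pose F := (i |` (F1 `|` F2))%fset; exists F.
have iF : i \in F by rewrite in_fsetE fset11.
have {}hF1 := hF1 F (fsubset_trans (fsubsetUl F1 F2) (fsubsetUr _ _)).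
have {}hF2 := hF2 F (fsubset_trans (fsubsetUr F1 F2) (fsubsetUr _ _)).
(* The first two terms are the errors of Parseval's identity and of truncating u, each at most
   [e / 2]; the difference of sums carries the estimate. *)
have -> : coef u i = (dot w g - \sum_(k <- F) coef w k * cj (coef g k))
    - dot (w - emb (P (tsum A (coef u) F))) g
    + (\sum_(k <- F) coef w k * cj (coef g k) - \sum_(k <- F) coef u k * Rm k).
  by rewrite dotBl test //; ring.
apply: le_trans (nrmD _ _) _; rewrite addrC; apply: lerD.
  rewrite -sumrB; apply: le_trans (nrm_sum _ _ _) _; rewrite mulr_sumr; apply: ler_sum => k _.
  apply: le_trans (nrmB _ _) _; rewrite !nrmM nrmJ.
  apply: le_trans (lerD (ler_wpM2l (nrm_ge0 _) (hg k)) (ler_wpM2l (nrm_ge0 _) (hR k))) _.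
  have p0 : 0 <= wt i `^ (- dl) * wt (i - k) ^- N by rewrite mulr_ge0 ?invr_ge0 ?(ltW (wpos _ _)).
  rewrite -(mulrA C2) -(mulrA C1).
  rewrite [leRHS](_ : _ = (C1 + C2 + 1) * (wt i `^ (- dl) * wt (i - k) ^- N * (nrm (coef u k) + nrm (coef w k)))); last by ring.
  move: p0 (nrm_ge0 (coef w k)) (nrm_ge0 (coef u k)); move: (wt i `^ (- dl) * wt (i - k) ^- N) (nrm _) (nrm _) => p a b p0 b0 a0.
  have ab0 : 0 <= p * a by exact: mulr_ge0.
  have bb0 : 0 <= p * b by exact: mulr_ge0.
  have -> : b * (C2 * p) + a * (C1 * p) = C2 * (p * b) + C1 * (p * a) by ring.
  have -> : (C1 + C2 + 1) * (p * (a + b)) = C2 * (p * b) + C1 * (p * a) + ((C1 + 1) * (p * b) + (C2 + 1) * (p * a)) by ring.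
  by rewrite lerDl addr_ge0 // mulr_ge0 // addr_ge0.
apply: le_trans (nrmB _ _) _; rewrite [leRHS]splitr lerD //.
apply: le_trans (CauchySchwarz _ _) _; apply: le_trans (ler_wpM2r (nrm_ge0 _) hF1) _.
by rewrite mulrAC ler_pdivrMr // ler_wpM2l ?(ltW e2) // lerDl.
Qed.

End Realization.

(** * Compactness of the resolvent and bootstrapping *)

Section EllipticRegularity.
Variables (R : realType) (n : nat) (theta : 'M[R]_n) (A : nctorus theta) (H : L2completion A).
Local Notation Z := 'rV[int]_n.
Local Notation wt := (wt R).
Local Notation U := (Uk A).
Local Notation emb := (L2_emb H).
Local Notation coef := (L2_coef (H := H)).
Hypothesis n0 : (0 < n)%N.

Lemma weighted_CauchySchwarz (I : Type) (r : seq I) (p y : I -> R) (S : R) : 0 < S ->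
  (forall k, 0 <= p k) -> \sum_(k <- r) p k <= S ->
  (\sum_(k <- r) p k * y k) ^+ 2 <= S * \sum_(k <- r) p k * y k ^+ 2.
Proof.
move=> S0 p0 pS; set a := \sum_(_ <- _) _ in pS; set b := \sum_(_ <- _) _; set d := \sum_(_ <- _) _.
have sq t : \sum_(k <- r) p k * (S * y k - t) ^+ 2 = S ^+ 2 * d - 2 * S * t * b + t ^+ 2 * a.
  rewrite !mulr_sumr -sumrB -big_split; apply: eq_bigr => k _ /=; ring.
have : 0 <= \sum_(k <- r) p k * (S * y k - b) ^+ 2.
  by apply: sumr_ge0 => k _; rewrite mulr_ge0 ?sqr_ge0.
rewrite sq.
move=> h; have hb : b ^+ 2 * a <= b ^+ 2 * S by rewrite ler_wpM2l ?sqr_ge0.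
have {}h : 0 <= S * (S * d - b ^+ 2).
  by apply: le_trans h _; rewrite -subr_ge0; move: hb; rewrite -subr_ge0; congr (0 <= _); ring.
by move: h; rewrite pmulr_rge0 // subr_ge0.
Qed.

(** Outside a finite set the terms of the convergent sum of [wt k^(-2n)] are at most [L^(-2n)]. *)
Lemma wt_large (L : R) : 0 < L -> exists F : {fset Z}, forall k, k \notin F -> L <= wt k.
Proof.
move=> L0; have [S S0 hS] := wt_sum R n.
have f0 (k : Z) : 0 <= wt k ^- (2 * n) by rewrite invr_ge0 ltW ?wtX_gt0.
have d0 : 0 < L ^- (2 * n) by rewrite invr_gt0 exprn_gt0.
have [F hF] := fsum_tail f0 hS d0; exists F => k kF.
have := hF (k |` F)%fset (fsubsetU1 _ _).
have -> : ((k |` F) `\` F)%fset = [fset k]%fset.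
  apply/fsetP => j; rewrite !in_fsetE; have [->|] := eqVneq j k; first by rewrite kF.
  by rewrite /= andNb.
rewrite big_seq_fset1 lef_pV2 ?posrE ?wtX_gt0 ?exprn_gt0 // ler_pXn2r ?nnegrE ?wt_ge0 ?(ltW L0) //.
by rewrite muln_gt0.
Qed.

Variables (T : set (H * H)) (dl : R).
Hypothesis dl0 : 0 < dl.
Hypothesis reg : forall N, exists2 C : R, 0 <= C & forall u w, T (u, w) -> forall i (e : R), 0 < e ->
  exists F : {fset Z}, nrm (coef u i) <=
    C * wt i `^ (- dl) * \sum_(k <- F) wt (i - k) ^- N * (nrm (coef u k) + nrm (coef w k)) + e.

Let sqrD_le (x y : R) : (x + y) ^+ 2 <= 2 * (x ^+ 2 + y ^+ 2).
Proof. by have := sqr_ge0 (x - y); nra. Qed.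

(** Schur's test: the kernel [wt (i - k)^(-2n)] is symmetric with sums at most S in either variable,
    hence bounded on square-summable sequences; the factor [wt i^(-dl)] makes the part with
    [wt i >= L] small. *)
Lemma coef_tail : exists2 C : R, 0 <= C & forall u w, T (u, w) -> forall (L : R) (I : {fset Z}),
  0 < L -> (forall i, i \in I -> L <= wt i) ->
  \sum_(i <- I) nrm (coef u i) ^+ 2 <= (C * L `^ (- dl)) ^+ 2 * (nrm u ^+ 2 + nrm w ^+ 2).
Proof.
have [C C0 hC] := reg (2 * n); have [S S0 hS] := wt_sum_shift R n.
exists (2 * C * S) => [|u w uw L I L0 IL]; first by rewrite !mulr_ge0 // ltW.
pose y k := nrm (coef u k) + nrm (coef w k).
pose p (i k : Z) := wt (i - k) ^- (2 * n).
have p0 i k : 0 <= p i k by rewrite invr_ge0 ltW ?wtX_gt0.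
have y0 k : 0 <= y k by rewrite addr_ge0 ?nrm_ge0.
have yS (F : {fset Z}) : \sum_(k <- F) y k ^+ 2 <= 2 * (nrm u ^+ 2 + nrm w ^+ 2).
  apply: le_trans (_ : \sum_(k <- F) 2 * (nrm (coef u k) ^+ 2 + nrm (coef w k) ^+ 2) <= _).
    by apply: ler_sum => k _; exact: sqrD_le.
  by rewrite -mulr_sumr big_split ler_wpM2l // lerD ?bessel_coef.
apply/ler_addgt0Pr => e e0; pose c := (size I).+1%:R : R.
have c0 : 0 < c by rewrite ltr0n.
(* Each of the finitely many rows carries an error d; this choice keeps [2 |I| d^2] below e. *)
pose d := Num.min 1 (e / (2 * c)).
have d0 : 0 < d by rewrite lt_min ltr01 divr_gt0 ?mulr_gt0.
have [F hF] := choice (fun i => hC u w uw i d d0).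
pose G := \big[fsetU/fset0]_(i <- I) F i.
have FG i : i \in I -> (F i `<=` G)%fset by move=> iI; exact: bigfcup_sup.
have LP : 0 <= L `^ (- dl) by exact: powR_ge0.
have row i : i \in I -> nrm (coef u i) ^+ 2 <= 2 * ((C * L `^ (- dl)) ^+ 2 * (S * \sum_(k <- G) p i k * y k ^+ 2) + d ^+ 2).
  move=> iI; apply: le_trans (_ : (C * L `^ (- dl) * \sum_(k <- G) p i k * y k + d) ^+ 2 <= _).
    apply: lerXn2r; rewrite ?nnegrE ?nrm_ge0 //.
      by rewrite addr_ge0 ?(ltW d0) // mulr_ge0 ?mulr_ge0 // sumr_ge0 // => k _; rewrite mulr_ge0.
    apply: le_trans (hF i) _; rewrite lerD2r; apply: ler_pM; rewrite ?mulr_ge0 ?powR_ge0 //.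
    - by apply: sumr_ge0 => k _; apply: mulr_ge0; [exact: p0|exact: y0].
    - rewrite ler_wpM2l // !powRN lef_pV2 ?posrE ?powR_gt0 ?wt_gt0 //.
      by apply: ge0_ler_powR; rewrite ?nnegrE ?wt_ge0 ?(ltW L0) ?(ltW dl0) // IL.
    - by apply: fsum_le; [exact: FG|move=> k; apply: mulr_ge0; [exact: p0|exact: y0]].
  apply: le_trans (sqrD_le _ _) _; rewrite ler_wpM2l // lerD2r exprMn ler_wpM2l ?sqr_ge0 //.
  by apply: weighted_CauchySchwarz => //; exact: hS.
rewrite big_seq; apply: le_trans (ler_sum _ row) _; rewrite -big_seq -mulr_sumr big_split /=.
rewrite -mulr_sumr -mulr_sumr exchange_big /=.
have h1 : \sum_(k <- G) \sum_(i <- I) p i k * y k ^+ 2 <= S * (2 * (nrm u ^+ 2 + nrm w ^+ 2)).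
  apply: le_trans (ler_wpM2l (ltW S0) (yS G)); rewrite mulr_sumr; apply: ler_sum => k _.
  rewrite -mulr_suml ler_wpM2r ?sqr_ge0 //; apply: le_trans (hS k I).
  by apply: ler_sum => i _; rewrite /p wtBC.
have h2 : 2 * \sum_(i <- I) d ^+ 2 <= e.
  rewrite big_const_seq count_predT iter_addr_0.
  have dd : d ^+ 2 <= e / (2 * c).
    by apply: le_trans (_ : d <= _); [rewrite expr2 ler_piMl ?(ltW d0) // ge_min lexx|rewrite ge_min lexx orbT].
  rewrite -[d ^+ 2 *+ _]mulr_natl; apply: le_trans (_ : 2 * (c * (e / (2 * c))) <= _).
    rewrite ler_wpM2l //; apply: ler_pM; rewrite ?sqr_ge0 //.
    by rewrite ler_nat.
  by rewrite le_eqVlt; apply/orP; left; apply/eqP; field; rewrite gt_eqF.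
rewrite mulrDr; apply: lerD => //.
apply: le_trans (_ : 2 * ((C * L `^ (- dl)) ^+ 2 * (S * (S * (2 * (nrm u ^+ 2 + nrm w ^+ 2))))) <= _).
  by rewrite !ler_wpM2l ?sqr_ge0 // ltW.
by rewrite le_eqVlt; apply/orP; left; apply/eqP; ring.
Qed.

(** [K x] and its image [z K x - x] under T are both bounded in terms of x, so [coef_tail] controls
    the Fourier tail of [K x] uniformly. *)
Lemma resolvent_compact (K : {linear H -> H}) (z : R[i]) : bounded_op K ->
  (forall x, T (K x, z *: K x - x)) -> compact_op K.
Proof.
move=> [B B0 hB] TK e e0; have [C C0 hC] := coef_tail.
pose D := B + (nrm z * B + 1).
have D0 : 0 < D by rewrite ltr_wpDl // ltr_wpDl // mulr_ge0 ?nrm_ge0.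
(* V exceeds [C D / e], and L is its power of exponent [1/dl], so that [C D L^(-dl) <= e]. *)
pose V := 1 + C * D / e; have V1 : 1 <= V by rewrite lerDl !mulr_ge0 ?invr_ge0 // ltW.
have V0 : 0 < V by apply: lt_le_trans V1.
pose L := V `^ dl^-1; have L0 : 0 < L by exact: powR_gt0.
have LV : L `^ (- dl) = V^-1.
  by rewrite powRN -powRrM mulVf ?gt_eqF // powRr1 // ltW.
have [F hF] := wt_large L0.
exists [seq emb (U k) | k <- F] => x; rewrite big_map.
rewrite [\sum_(_ <- _) _](_ : _ = fproj F (K x)); last by [].
apply/ler_addgt0Pr => d d0; have [G hG] := fproj_cvg (K x) d0.
pose G' := (F `|` G)%fset.
have -> : K x - fproj F (K x) = (K x - fproj G' (K x)) + fproj (G' `\` F)%fset (K x).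
  rewrite {2}/fproj (fsum_split _ (fsubsetUl F G)) -!/(fproj _ _) opprD addrA subrK //.
apply: le_trans (nrmD _ _) _; rewrite addrC; apply: lerD; last exact: hG (fsubsetUr _ _).
have ex : 0 <= e * nrm x by rewrite mulr_ge0 ?nrm_ge0 // ltW.
rewrite -(@ler_pXn2r _ 2) ?nnegrE ?nrm_ge0 // nrm_fproj.
apply: le_trans (hC _ _ (TK x) L _ L0 _) _.
  by move=> i; rewrite in_fsetD => /andP[/hF].
have h1 : nrm (K x) ^+ 2 + nrm (z *: K x - x) ^+ 2 <= (D * nrm x) ^+ 2.
  have k1 := hB x; have k2 : nrm (z *: K x - x) <= (nrm z * B + 1) * nrm x.
    apply: le_trans (nrmB _ _) _; rewrite nrmZ mulrDl mul1r lerD2r -mulrA.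
    by rewrite ler_wpM2l ?nrm_ge0.
  rewrite /D mulrDl; move: k1 k2 (nrm_ge0 (K x)) (nrm_ge0 (z *: K x - x)).
  move: (nrm (K x)) (nrm (z *: K x - x)) (B * nrm x) ((nrm z * B + 1) * nrm x) => *; nra.
apply: le_trans (ler_wpM2l (sqr_ge0 _) h1) _; rewrite -exprMn.
clearbody D.
apply: lerXn2r; rewrite ?nnegrE ?mulr_ge0 ?nrm_ge0 ?powR_ge0 ?(ltW D0) ?(ltW e0) //.
rewrite mulrA ler_wpM2r ?nrm_ge0 // LV mulrAC ler_pdivrMr // /V mulrDr mulr1.
by rewrite mulrCA mulfV ?gt_eqF // mulr1 lerDr ltW.
Qed.

Definition coef_decay (s : R) (u : H) := exists2 C : R, 0 <= C & forall k, nrm (coef u k) <= C * wt k `^ (- s).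

Lemma coef_decayD s u v : coef_decay s u -> coef_decay s v -> coef_decay s (u + v).
Proof.
move=> [C C0 hC] [D D0 hD]; exists (C + D) => [|k]; first exact: addr_ge0.
by rewrite coefD mulrDl; apply: le_trans (nrmD _ _) (lerD _ _).
Qed.

Lemma coef_decayZ s c u : coef_decay s u -> coef_decay s (c *: u).
Proof.
move=> [C C0 hC]; exists (nrm c * C) => [|k]; first by rewrite mulr_ge0 ?nrm_ge0.
by rewrite coefZ nrmM -mulrA ler_wpM2l ?nrm_ge0.
Qed.

Lemma coef_decay0 u : coef_decay 0 u.
Proof. by exists (nrm u) => [|k]; rewrite ?nrm_ge0 // oppr0 powRr0 mulr1 nrm_coef. Qed.

(** Averaging against a rapidly decaying kernel preserves the rate s, by Peetre's inequality, and
    the factor [wt i^(-dl)] improves it. *)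
Lemma coef_decay_step s u w : 0 <= s -> T (u, w) -> coef_decay s u -> coef_decay s w -> coef_decay (s + dl) u.
Proof.
move=> s0 uw [B B0 hB] [D D0 hD]; pose M := (Num.truncn s).+1; have hM : s <= M%:R by apply/ltW/truncnS_gt.
have [C C0 hC] := reg (2 * n + M); have [S S0 hS] := wt_sum_shift R n.
exists (C * ((B + D) * S)) => [|i]; first by rewrite !mulr_ge0 ?addr_ge0 // ltW.
apply/ler_addgt0Pr => e e0; have [F hF] := hC u w uw i e e0; apply: le_trans hF _; rewrite lerD2r.
rewrite opprD powRD; last by apply/implyP => _; rewrite gt_eqF ?wt_gt0.
rewrite [leRHS](_ : _ = C * wt i `^ (- dl) * ((B + D) * wt i `^ (- s) * S)); last by ring.
rewrite ler_wpM2l ?mulr_ge0 ?powR_ge0 //.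
have BD : 0 <= (B + D) * wt i `^ (- s) by rewrite mulr_ge0 ?addr_ge0 ?powR_ge0.
apply: le_trans (ler_wpM2l BD (hS i F)); rewrite mulr_sumr; apply: ler_sum => k _.
have wpos (j : Z) N : 0 < wt j ^+ N by exact: wtX_gt0.
apply: le_trans (_ : wt (i - k) ^- (2 * n + M) * ((B + D) * wt k `^ (- s)) <= _).
  by rewrite ler_wpM2l ?invr_ge0 ?(ltW (wpos _ _)) // mulrDl lerD.
have h : wt k `^ (- s) <= wt i `^ (- s) * wt (i - k) ^+ M.
  rewrite !powRN ler_pdivlMl ?powR_gt0 ?wt_gt0 // ler_pdivrMr ?powR_gt0 ?wt_gt0 //.
  apply: le_trans (_ : (wt (i - k) * wt k) `^ s <= _).
    by apply: ge0_ler_powR; rewrite ?nnegrE ?mulr_ge0 ?wt_ge0 //; exact: wtB.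
  rewrite powRM ?wt_ge0 // ler_wpM2r ?powR_ge0 // -powR_mulrn ?wt_ge0 //.
  by rewrite ler_powR ?wt_ge1.
rewrite mulrCA -mulrA ler_wpM2l ?addr_ge0 //.
rewrite ler_pdivrMl // exprD; apply: le_trans h _.
by rewrite le_eqVlt; apply/orP; left; apply/eqP; field; rewrite gt_eqF.
Qed.

Lemma coef_decay_smooth u : (forall N : nat, coef_decay N%:R u) -> exists2 a, smooth A a & emb a = u.
Proof.
move=> h; have dc : decay (R := R) (coef u).
  move=> N; have [C C0 hC] := h N; exists C => // k; rewrite mulrC -ler_pdivlMr ?wtX_gt0 //.
  by have := hC k; rewrite powRN powR_mulrn ?wt_ge0.
have [a [as_ ac _]] := decay_smooth A dc; exists a => //; apply/eqP; rewrite -subr_eq0; apply/eqP.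
by apply: coef_eq0 => k; rewrite coefB coef_emb ac subrr.
Qed.

(** The induction on the decay rate runs over all of [E] at once: the image of u is [lam u + v] with
    v again in [E], so both sides of the estimate improve together. *)
Lemma invariant_smooth (E : set H) (lam : R[i]) :
  (forall u, E u -> exists2 v, E v & T (u, lam *: u + v)) -> E `<=` emb @` smooth A.
Proof.
move=> hE; have dec t u : E u -> coef_decay (t%:R * dl) u.
  elim: t u => [|t ih] u Eu; first by rewrite mul0r; exact: coef_decay0.
  have [v Ev uv] := hE u Eu; rewrite -natr1 mulrDl mul1r.
  apply: coef_decay_step uv _ _; [by rewrite mulr_ge0 // ltW|exact: ih|].
  by apply: coef_decayD; [apply: coef_decayZ|]; exact: ih.
move=> u Eu; have [|a sa ea] := @coef_decay_smooth u; last by exists a.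
move=> N; pose t := (Num.truncn (N%:R / dl)).+1; have [C C0 hC] := dec t u Eu; exists C => // k.
apply: le_trans (hC k) _; rewrite ler_wpM2l // ler_powR ?wt_ge1 // lerN2.
by rewrite -ler_pdivrMr // ltW // truncnS_gt.
Qed.

End EllipticRegularity.

(** [op_pow] adds its new factor at the end; peeling off the first application instead shows that
    [T - lambda] maps a generalized eigenspace into itself. *)
Lemma op_powSr (R : realType) (H : hilbertType R) (T : set (H * H)) l u v :
  op_pow T l.+1 (u, v) <-> exists w, T (u, w) /\ op_pow T l (w, v).
Proof.
elim: l u v => [|l ih] u v; first by split=> [[w [/= -> ?]]|[w [? /= ->]]]; [exists v|exists u].
split=> [[w [/ih[x [ux xw]] wv]]|[x [ux [w [xw wv]]]]].
  by exists x; split=> //; exists w.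
by exists w; split=> //; apply/ih; exists x.
Qed.

Theorem proposition5p2 (R : realType) (n : nat) (hn : (2 <= n)%N)
    (theta : 'M[R]_n) (htheta : theta^T = - theta)
    (A : nctorus theta) (L2 : L2completion A)
    (q : R[i]) (P : A -> A) (hP : pdo q P) (hell : elliptic q P)
    (hm : 0 < complex.Re q)
    (hSp : spectrum (realization L2 (complex.Re q) P) <> [set: R[i]])
    (lambda : R[i]) (hlambda : spectrum (realization L2 (complex.Re q) P) lambda) :
  let T := realization L2 (complex.Re q) P in
  let E := gen_eigenspace T in
  let E' := orthocomp (gen_eigenspace (op_adjoint T) (lambda^* )) in
  [/\ [/\ finite_dim_subspace (E lambda),
          E lambda `<=` L2_emb L2 @` smooth A &
          exists nu : nat, (1 <= nu)%N /\
            E lambda = op_ker (op_pow (op_shift T lambda) nu)],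
      (exists Pi : {linear L2 -> L2},
          is_riesz_projection T lambda Pi /\
          projection_onto_along Pi (E lambda) E') /\
        direct_decomposition (E lambda) E' &
      family_independent (spectrum T `\ lambda) E /\
        family_sum (spectrum T `\ lambda) E `<=` E'].
Proof.
move=> T E E'; have n0 : (0 < n)%N by apply: ltn_trans hn.
have [sigma [[rho [rhos [hexp PE sE]]] sinv]] := hell.
have hinv xi : xi != 0 -> smooth_invertible (rhos 0%N xi) by move=> x0; rewrite -sE //; exact: sinv.
(* A spectrum different from the plane provides the base point of the resolvent. *)
have [z0 nz0] : exists z0, ~ spectrum T z0.
  by apply/not_existsP => h; apply: hSp; apply/seteqP; split=> // z _; apply: contrapT; exact: h.
have [K [cK TK KT]] : exists K : {linear L2 -> L2}, is_resolvent T z0 K by exact: contrapT.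
have bK := continuous_bounded_op cK.
have TE u v : T (u, v) <-> u = K (z0 *: u - v).
  split=> [/KT ->//|uE]; have := TK (z0 *: u - v); rewrite -uE.
  by rewrite opprB addrC subrK.
have Kinj w : K w = 0 -> w = 0.
  move=> Kw; have := TK w; rewrite Kw scaler0 sub0r => /(realization_0 PE) /eqP.
  by rewrite oppr_eq0 => /eqP.
have dl0 : 0 < Num.min 1 (complex.Re q) by rewrite lt_min ltr01.
have reg := regularity L2 PE n0 hexp hinv hm.
have comp := resolvent_compact n0 dl0 reg bK TK.
have [[fdim nu] proj fam] := spectral_decomposition TE Kinj bK comp hlambda.
split=> //; split=> //.
have T00 : T (0, 0) by apply/TE; rewrite scaler0 subr0 linear0.
apply: (invariant_smooth dl0 reg (lam := lambda)) => u [l /= l1 ul].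
case: l l1 ul => // l _ /op_powSr[v [uv vl]]; exists v; last first.
  by move: uv; rewrite /op_shift /= addrC.
(* The l-th power already kills v, but l may be 0; one more application, through [T (0, 0)], keeps
   the exponent positive. *)
exists l.+1 => //; exists 0; split; first exact: vl.
by rewrite /op_shift /= scaler0 addr0.
Qed.
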